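(* Let $n<\omega$. In the measure algebra $\mathrm{MALG}$: (a) the following subsets are $\boldsymbol{\Pi}^1_1$: $\widehat{\mathrm{Shrp}}_n$, $\widehat{\mathrm{Shrp}}_{\le n}$, $\widehat{\mathrm{Shrp}}_{<\omega}$, $\widehat{\mathrm{Shrp}}_{\le\omega}$, $\widehat{\mathrm{Shrp}}_\omega$; $\widehat{\mathrm{Blr}}_n$, $\widehat{\mathrm{Blr}}_{\le n}$, $\widehat{\mathrm{Blr}}_{<\omega}$, $\widehat{\mathrm{Blr}}_{\le\omega}$, $\widehat{\mathrm{Blr}}_\omega$; $\widehat{\mathrm{Rng}}_{\le n}$, $\widehat{\mathrm{Rng}}_{<\omega}$, $\widehat{\mathrm{Rng}}_{\le\omega}$, $\widehat{\mathrm{Rng}}_{\mathrm{inj}}$, $\widehat{\mathrm{Rng}}_{\mathrm{MGR}}$, and $\widehat{\mathrm{Rng}}_{\lambda\le a}$, $\widehat{\mathrm{Rng}}_{\lambda<a}$ for any $a\in[0;1]$; $\widehat{\mathrm{Sld}}$, $\widehat{\mathrm{qDl}}$, $\widehat{\mathrm{Dl}}$. (b) the following subsets are in $2$-$\boldsymbol{\Sigma}^1_1$: $\widehat{\mathrm{Rng}}_{n+1}$, $\widehat{\mathrm{Rng}}_\omega$, $\widehat{\mathrm{Rng}}_{\lambda=a}$ for $a\in[0;1]$, $\widehat{\mathrm{Rng}}(S)$ for countable $S\subseteq(0;1)$, and $\widehat{\mathrm{Spng}}$. (c) $\widehat{\mathrm{Rng}}(S)$ is $\boldsymbol{\Pi}^1_2$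 for every $S\subseteq(0;1)$. Moreover, for each class $\mathcal{C}$ above, the set of compact sets belonging to $\mathcal{C}$ is, as a subset of $\mathbf{K}$, in the same pointclass as $\widehat{\mathcal{C}}$.
   Context: $2^{\omega}$ is the Cantor space; $N_s=\{x\in2^\omega:s\subset x\}$; $\mu$ is the coin-tossing measure, $\mu(N_s)=2^{-\mathrm{lh}(s)}$. $\mathrm{MALG}$ is the measure algebra of Borel subsets of $2^\omega$ modulo null sets, a Polish space with metric $\delta([A],[B])=\mu(A\triangle B)$. $\mathbf{K}$ is the Polish space of compact subsets of $2^\omega$ with the Vietoris topology. For measurable $A$, $\mathcal{D}_A(z)=\lim_n\mu(A\cap N_{z\restriction n})/\mu(N_{z\restriction n})$ when the limit exists; $\operatorname{ran}\mathcal{D}_A$ is the set of values attained where defined. $z$ is blurry for $A$ if $\mathcal{D}_A(z)$ does not exist, sharp if it exists and lies in $(0;1)$; $\mathrm{Blur}(A)$, $\mathrm{Sharp}(A)$ are the sets of such points. Solid: no blurry points ($\mathrm{Sld}$); quasi-dualistic: no sharp points ($\mathrm{qDl}$); dualistic: both ($\mathrm{Dl}$); spongy: quasi-dualistic but not solid ($\mathrm{Spng}$). For $\kappa\le\omega$ and $\bowtie\in\{=,\le,<\}$: $\mathrm{Shrp}_{\bowtie\kappa}=\{A:|\mathrm{Sharp}(A)|\bowtie\kappa\}$, $\mathrm{Blr}_{\bowtie\kappa}=\{A:|\mathrm{Blur}(A)|\bowtie\kappa\}$, $\mathrm{Rng}_{\bowtie\kappa}=\{A:|\operatorname{ran}\mathcal{D}_A\cap(0;1)|\bowtie\kappa\}$,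 a bare subscript $\kappa$ meaning $=\kappa$. $\mathrm{Rng}_{\mathrm{inj}}=\{A:\forall z_1,z_2(\mathcal{D}_A(z_1)=\mathcal{D}_A(z_2)\in(0;1)\Rightarrow z_1=z_2)\}$; $\mathrm{Rng}_{\mathrm{MGR}}=\{A:\operatorname{ran}\mathcal{D}_A\text{ meager}\}$; $\mathrm{Rng}_{\lambda\bowtie a}=\{A:\lambda(\operatorname{ran}\mathcal{D}_A)\bowtie a\}$ ($\lambda$ Lebesgue measure); $\mathrm{Rng}(S)=\{A:\operatorname{ran}\mathcal{D}_A=S\cup\{0,1\}\}$. All these classes are invariant under equality modulo null sets, and $\widehat{\mathcal{C}}=\{[A]\in\mathrm{MALG}:A\in\mathcal{C}\}$. $2$-$\boldsymbol{\Sigma}^1_1$ is the class of sets $A\cap B$ with $A$ analytic, $B$ coanalytic. *)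

(* Defs.v *)
From HB Require Import structures.
From mathcomp Require Import all_boot all_order all_algebra.
From mathcomp Require Import all_classical all_reals all_analysis.
From mathcomp Require Import Rstruct Rstruct_topology.
Set Implicit Arguments. Unset Strict Implicit. Unset Printing Implicit Defensive.
Import Order.TTheory GRing.Theory Num.Theory.
Import numFieldNormedType.Exports.
Local Open Scope classical_set_scope.
Local Open Scope ring_scope.
Local Open Scope card_scope.

Notation reals := Rdefinitions.R.

Definition cyl (s : seq bool) : set cantor_space :=
  [set x | forall i, (i < size s)%N -> x i = nth false s i].

Definition prefix (z : cantor_space) (n : nat) : seq bool := mkseq z n.

(* Coin-tossing (outer) measure: infimum of sum_k 2^{-lh(s_k)} over countable
   covers of A by basic cylinders N_{s_k}.  On Borel sets this is mu. *)
Definition mu (A : set cantor_space) : reals :=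
  fine (ereal_inf [set (\sum_(0 <= k <oo) ((2 ^- size (s k) : reals)%:E))%E
                  | s in [set s : nat -> seq bool | A `<=` \bigcup_k cyl (s k)]]).

Definition borel (A : set cantor_space) : Prop := <<s @open cantor_space >> A.

Definition dens (A : set cantor_space) (z : cantor_space) (r : reals) : Prop :=
  (fun n : nat => mu (A `&` cyl (prefix z n)) / (2 ^- n : reals)) @ \oo --> r.

Definition Sharp (A : set cantor_space) : set cantor_space :=
  [set z | exists r, dens A z r /\ 0 < r < 1].
Definition Blur (A : set cantor_space) : set cantor_space :=
  [set z | ~ exists r, dens A z r].
Definition ranD (A : set cantor_space) : set reals :=
  [set r | exists z, dens A z r].
Definition ran01 (A : set cantor_space) : set reals :=
  [set r | ranD A r /\ 0 < r < 1].

Inductive card_bound := CEq of nat | CLe of nat | CLtw | CLew | CEqw.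

Definition card_sat {T} (k : card_bound) (S : set T) : Prop :=
  match k with
  | CEq n => is_true (S #= `I_n)
  | CLe n => is_true (S #<= `I_n)
  | CLtw => finite_set S
  | CLew => countable S
  | CEqw => is_true (S #= @setT nat)
  end.

Definition Shrp (k : card_bound) (A : set cantor_space) : Prop := card_sat k (Sharp A).
Definition Blr (k : card_bound) (A : set cantor_space) : Prop := card_sat k (Blur A).
Definition Rng (k : card_bound) (A : set cantor_space) : Prop := card_sat k (ran01 A).

Definition Rng_inj (A : set cantor_space) : Prop :=
  forall z1 z2 r, dens A z1 r -> dens A z2 r -> 0 < r < 1 -> z1 = z2.

Definition nowhere_dense_set (N : set reals) : Prop := interior (closure N) = set0.
Definition meager_set (M : set reals) : Prop :=
  exists N : nat -> set reals, (forall k, nowhere_dense_set (N k)) /\ M `<=` \bigcup_k N k.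

Definition Rng_MGR (A : set cantor_space) : Prop := meager_set (ranD A).

Definition Rng_lam_le (a : reals) (A : set cantor_space) : Prop :=
  (lebesgue_measure (ranD A) <= a%:E)%E.
Definition Rng_lam_lt (a : reals) (A : set cantor_space) : Prop :=
  (lebesgue_measure (ranD A) < a%:E)%E.
Definition Rng_lam_eq (a : reals) (A : set cantor_space) : Prop :=
  lebesgue_measure (ranD A) = a%:E.

Definition RngS (S : set reals) (A : set cantor_space) : Prop :=
  ranD A = S `|` [set 0; 1].

Definition Sld (A : set cantor_space) : Prop := Blur A = set0.
Definition qDl (A : set cantor_space) : Prop := Sharp A = set0.
Definition Dl (A : set cantor_space) : Prop := Sld A /\ qDl A.
Definition Spng (A : set cantor_space) : Prop := qDl A /\ ~ Sld A.

(* A (pseudo)metrizable space presented by "near n a b" (a, b are 2^{-n}-close);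
   points a, b with near n a b for all n are identified. *)
Record space := Space { pt : Type; near : nat -> pt -> pt -> Prop }.

Definition baire := nat -> nat.

Definition eqv (X : space) (a b : pt X) : Prop := forall n, @near X n a b.

Definition cont_baire (X : space) (f : baire -> pt X) : Prop :=
  forall (x : baire) n, exists m, forall y : baire,
    (forall i, (i < m)%N -> y i = x i) -> @near X n (f x) (f y).

Definition analytic (X : space) (P : pt X -> Prop) : Prop :=
  (forall a, ~ P a) \/
  exists f : baire -> pt X, cont_baire f /\ forall a, P a <-> exists x, eqv (f x) a.

Definition coanalytic (X : space) (P : pt X -> Prop) : Prop :=
  analytic (fun a => ~ P a).

Definition diff_analytic (X : space) (P : pt X -> Prop) : Prop :=
  exists A B : pt X -> Prop, analytic A /\ coanalytic B /\ forall a, P a <-> A a /\ B a.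

Definition prodB (X : space) : space :=
  Space (fun n (p q : pt X * baire) =>
           @near X n p.1 q.1 /\ forall i, (i < n)%N -> p.2 i = q.2 i).

Definition sigma12 (X : space) (P : pt X -> Prop) : Prop :=
  exists Q : pt (prodB X) -> Prop, coanalytic Q /\ forall a, P a <-> exists x, Q (a, x).
Definition pi12 (X : space) (P : pt X -> Prop) : Prop :=
  sigma12 (fun a => ~ P a).

(* MALG: Borel sets with the pseudometric δ(A,B) = mu(A Δ B); identification mod null *)
Definition MALG : space :=
  @Space {A : set cantor_space | borel A}
    (fun n A B => mu ((sval A `\` sval B) `|` (sval B `\` sval A)) < 2 ^- n).

(* K: compact subsets of Cantor space with the Vietoris topology, presented by
   the Hausdorff metric: C, D are 2^{-n}-close iff they have the same
   initial segments of length n. *)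
Definition Kspace : space :=
  @Space {C : set cantor_space | compact C}
    (fun n C D => forall s : seq bool, size s = n ->
       ((exists x, sval C x /\ cyl s x) <-> (exists x, sval D x /\ cyl s x))).

Definition hatM (C : set cantor_space -> Prop) : pt MALG -> Prop := fun A => C (sval A).
Definition hatK (C : set cantor_space -> Prop) : pt Kspace -> Prop := fun K => C (sval K).

Definition in_class (G : forall X : space, (pt X -> Prop) -> Prop)
  (C : set cantor_space -> Prop) : Prop := G MALG (hatM C) /\ G Kspace (hatK C).

(* Main.v *)
Require Import Defs.
From HB Require Import structures.
From mathcomp Require Import all_boot all_order all_algebra.
From mathcomp Require Import all_classical all_reals all_analysis.
From mathcomp Require Import Rstruct Rstruct_topology.
From mathcomp Require Import lra.
Import Order.TTheory GRing.Theory Num.Theory.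
Import numFieldNormedType.Exports.
Import Defs.
Local Open Scope classical_set_scope.
Local Open Scope ring_scope.

(** Everything is pulled back to Baire space along a continuous surjection onto MALG (limits of
    fast sequences of clopen sets) or onto K (pruned binary trees), under which the numbers
    mu(A `&` N_s) have open sublevel sets. Hence "z is sharp" and "z is blurry" are Borel, and
    ran D_A is the projection of a closed set of codes, given by a tree that is Borel in A.

    For sections of such trees: "more than n points" and "infinite" are Sigma^1_1 outright;
    "uncountable" is Sigma^1_1 because it means that some sequence of branches is dense in itself
    with values that keep changing; "nonmeager" is witnessed by a scheme of open sets refining the
    Souslin scheme; "outer measure > a" is witnessed by a bounding branch whose finitely branching
    subtree has a compact projection of measure > a. "Exactly one point" is Pi^1_1 by Lusin's
    unicity theorem, obtained by comparing the ranks of the trees of the branches that leave a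
    given cylinder. A countable closed set with at least n points has n isolated ones, so
    "exactly n" and "countably infinite" follow once Borel sections are represented as injective
    projections of closed sets. *)

Set Implicit Arguments.
Unset Strict Implicit.
Unset Printing Implicit Defensive.

(** * Analytic and Borel subsets of Baire space *)

Local Open Scope nat_scope.

(** Only sublevel sets are asked to be open because on K the measure of a compact set inside a
    cylinder is merely upper semicontinuous; this common property lets MALG and K share one proof.
    Every class depends on A through the partial function [dens A] alone, so it respects the
    identifications of either space, and a Sigma^1_1 set of codes then projects to an analytic set
    of points.

    The cardinality bounds for sharp and blurry points are better than those for the range. A
    section of a Borel set can be coded with exactly one branch per point, so that counting points
    is counting branches of a closed set, where isolated branches and unicity are available. A
    density value, in contrast, may be attained at many points and has many codes. There only the
    lower bounds (more than n values, infinitely many, uncountably many) are expressed directly, and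
    an exact cardinality becomes a difference of two of them. *)

Definition agree (m : nat) (x y : baire) : Prop := forall i, i < m -> y i = x i.

Lemma agree_sym m x y : agree m x y -> agree m y x.
Proof. by move=> h i im; rewrite h. Qed.

Lemma agree_trans m x y z : agree m x y -> agree m y z -> agree m x z.
Proof. by move=> h1 h2 i im; rewrite h2 // h1. Qed.

Lemma agree_le m n x y : m <= n -> agree n x y -> agree m x y.
Proof. by move=> mn h i im; apply: h; apply: leq_trans mn. Qed.

Lemma agree_mkseq m x y : agree m x y <-> mkseq y m = mkseq x m.
Proof.
split=> [h|h i im].
  by apply/eq_in_map => i; rewrite mem_iota add0n => /h.
by have := congr1 (nth 0 ^~ i) h; rewrite /= !nth_mkseq.
Qed.

Definition open_baire (U : baire -> Prop) : Prop :=
  forall x, U x -> exists m, forall y, agree m x y -> U y.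
Definition closed_baire (C : baire -> Prop) : Prop := open_baire (fun x => ~ C x).
Definition clopen_baire (C : baire -> Prop) : Prop := open_baire C /\ closed_baire C.
Definition continuous_baire (h : baire -> baire) : Prop :=
  forall x n, exists m, forall y, agree m x y -> agree n (h x) (h y).

Lemma uniform_clopen (Q : baire -> Prop) m :
  (forall x y, agree m x y -> Q x -> Q y) -> clopen_baire Q.
Proof.
move=> h; split=> x Qx; exists m => y xy; first exact: h Qx.
by move=> Qy; apply: Qx; apply: h Qy; apply: agree_sym.
Qed.

Lemma open_and (U V : baire -> Prop) :
  open_baire U -> open_baire V -> open_baire (fun x => U x /\ V x).
Proof.
move=> oU oV x [Ux Vx]; have [m hm] := oU x Ux; have [n hn] := oV x Vx.
exists (maxn m n) => y xy; split; [apply: hm|apply: hn]; apply: agree_le xy.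
  exact: leq_maxl.
exact: leq_maxr.
Qed.

Lemma closed_forall I (C : I -> baire -> Prop) :
  (forall i, closed_baire (C i)) -> closed_baire (fun x => forall i, C i x).
Proof.
move=> cC x /existsNP[i nC]; have [m hm] := cC i x nC.
by exists m => y /hm nCy Cy; apply: nCy.
Qed.

Lemma closed_and (C D : baire -> Prop) :
  closed_baire C -> closed_baire D -> closed_baire (fun x => C x /\ D x).
Proof.
move=> cC cD x /not_andP[] n; [have [m hm] := cC x n|have [m hm] := cD x n].
  by exists m => y /hm nCy [].
by exists m => y /hm nDy [].
Qed.

Lemma closed_imp (C D : baire -> Prop) :
  open_baire C -> closed_baire D -> closed_baire (fun x => C x -> D x).
Proof.
move=> oC cD x /not_implyP[Cx nDx].
have [m hm] := @open_and C (fun x => ~ D x) oC cD x (conj Cx nDx).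
by exists m => y /hm[Cy nDy] /(_ Cy).
Qed.

Lemma continuous_coord (h : baire -> baire) (j : nat -> nat) :
  (forall x i, h x i = x (j i)) -> continuous_baire h.
Proof.
move=> hj x n; exists (\max_(i < n) (j i).+1) => y xy i ltin; rewrite !hj; apply: xy.
exact: (@leq_bigmax_cond _ xpredT (fun i : 'I_n => (j i).+1) (Ordinal ltin)).
Qed.

Lemma continuous_comp (g h : baire -> baire) :
  continuous_baire g -> continuous_baire h -> continuous_baire (g \o h).
Proof.
move=> cg ch x n; have [m hm] := cg (h x) n; have [k hk] := ch x m.
by exists k => y /hk/hm.
Qed.

Lemma continuous_id : continuous_baire id.
Proof. exact: (@continuous_coord _ id). Qed.

Lemma open_preimage (h : baire -> baire) U :
  continuous_baire h -> open_baire U -> open_baire (U \o h).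
Proof.
move=> ch oU x Ux; have [m hm] := oU (h x) Ux; have [k hk] := ch x m.
by exists k => y /hk/hm.
Qed.

Lemma closed_preimage (h : baire -> baire) C :
  continuous_baire h -> closed_baire C -> closed_baire (C \o h).
Proof. by move=> ch cC; apply: (@open_preimage h (fun x => ~ C x)). Qed.

(** * Coding of pairs and sequences in Baire space *)

Definition pairB (x y : baire) : baire := fun n => if odd n then y n./2 else x n./2.
Definition fstB (v : baire) : baire := fun n => v n.*2.
Definition sndB (v : baire) : baire := fun n => v n.*2.+1.
Definition col (v : baire) (i : nat) : baire := fun n => v (pickle (i, n)).
Definition joinB (u : nat -> baire) : baire :=
  fun k => if unpickle k is Some (i, n) then u i n else 0.
Definition tailB (v : baire) : baire := fun n => v n.+1.
Definition consB (k : nat) (v : baire) : baire := fun n => if n is n'.+1 then v n' else k.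

Lemma fst_pairB x y : fstB (pairB x y) = x.
Proof. by apply/funext => n; rewrite /fstB /pairB odd_double doubleK. Qed.

Lemma snd_pairB x y : sndB (pairB x y) = y.
Proof. by apply/funext => n; rewrite /sndB /pairB /= odd_double /= uphalf_double. Qed.

Lemma pair_fst_snd v : pairB (fstB v) (sndB v) = v.
Proof.
apply/funext => n; rewrite /pairB /fstB /sndB; case: ifPn => on.
  by congr v; rewrite -[RHS]odd_double_half on.
by congr v; rewrite -[RHS]odd_double_half (negbTE on).
Qed.

Lemma col_joinB u i : col (joinB u) i = u i.
Proof. by apply/funext => n; rewrite /col /joinB pickleK. Qed.

Lemma cons_tailB v : consB (v 0) (tailB v) = v.
Proof. by apply/funext => -[]. Qed.

Lemma tail_consB k v : tailB (consB k v) = v.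
Proof. by []. Qed.

Lemma continuous_fstB : continuous_baire fstB.
Proof. exact: (@continuous_coord _ double). Qed.

Lemma continuous_sndB : continuous_baire sndB.
Proof. exact: (@continuous_coord _ (fun n => n.*2.+1)). Qed.

Lemma continuous_col i : continuous_baire (col^~ i).
Proof. exact: (@continuous_coord _ (fun n => pickle (i, n))). Qed.

Lemma continuous_tailB : continuous_baire tailB.
Proof. exact: (@continuous_coord _ S). Qed.

Lemma continuous_cst (c : baire) : continuous_baire (fun=> c).
Proof. by move=> x n; exists 0. Qed.

Lemma continuous_pairB (g h : baire -> baire) :
  continuous_baire g -> continuous_baire h -> continuous_baire (fun x => pairB (g x) (h x)).
Proof.
move=> cg ch x n; have [m hm] := cg x n; have [k hk] := ch x n.
exists (maxn m k) => y xy i ltin; rewrite /pairB.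
have i2n : i./2 < n by apply: leq_ltn_trans ltin; rewrite leq_half_double -addnn -addSn leq_addl.
case: ifP => _; [apply: hk => //|apply: hm => //]; apply: agree_le xy.
  exact: leq_maxr.
exact: leq_maxl.
Qed.

Lemma continuous_fstc (h : baire -> baire) :
  continuous_baire h -> continuous_baire (fun x => fstB (h x)).
Proof. by move=> ch; exact: (continuous_comp continuous_fstB ch). Qed.

Lemma continuous_sndc (h : baire -> baire) :
  continuous_baire h -> continuous_baire (fun x => sndB (h x)).
Proof. by move=> ch; exact: (continuous_comp continuous_sndB ch). Qed.

Lemma continuous_colc (h : baire -> baire) i :
  continuous_baire h -> continuous_baire (fun x => col (h x) i).
Proof. by move=> ch; exact: (continuous_comp (@continuous_col i) ch). Qed.

Lemma continuous_tailc (h : baire -> baire) :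
  continuous_baire h -> continuous_baire (fun x => tailB (h x)).
Proof. by move=> ch; exact: (continuous_comp continuous_tailB ch). Qed.

Create HintDb baire.
#[local] Hint Resolve continuous_id continuous_cst continuous_fstc continuous_sndc
  continuous_colc continuous_tailc continuous_pairB : baire.
Local Ltac cont := solve [auto 20 with baire].

Lemma eq_coord_clopen i k : clopen_baire (fun x => x i = k).
Proof. by apply: (@uniform_clopen _ i.+1) => x y xy <-; apply: xy. Qed.

Lemma mkseq_clopen n u : clopen_baire (fun x => mkseq x n = u).
Proof. by apply: (@uniform_clopen _ n) => x y /agree_mkseq ->. Qed.

Lemma clopen_not Q : clopen_baire Q -> clopen_baire (fun x => ~ Q x).
Proof.
move=> [oQ cQ]; split=> // x /contrapT /oQ[m hm].
by exists m => y /hm Qy; apply.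
Qed.

Lemma closed_eq (g h : baire -> baire) :
  continuous_baire g -> continuous_baire h -> closed_baire (fun x => g x = h x).
Proof.
move=> cg ch x ne; have /existsNP[i nei] : ~ forall i, g x i = h x i.
  by move=> e; apply: ne; apply/funext.
have [m hm] := cg x i.+1; have [k hk] := ch x i.+1.
exists (maxn m k) => y xy e; apply: nei.
rewrite -(hm y _ i) ?e ?(hk y _ i) //; apply: agree_le xy.
  exact: leq_maxr.
exact: leq_maxl.
Qed.

(** * Retraction onto a closed set *)

Section Retraction.
Variables (C : baire -> Prop).
Hypothesis cC : closed_baire C.

Let meets (x : baire) n := exists y, C y /\ agree n x y.

Let meets_le x m n : m <= n -> meets x n -> meets x m.
Proof. by move=> mn [y [Cy xy]]; exists y; split=> //; apply: agree_le xy. Qed.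

(* [r x] follows [x] while [x|n] has an extension in [C], then switches to a point of [C] chosen
   from the last such prefix only. *)
Lemma closed_retract x0 : C x0 ->
  exists r, [/\ continuous_baire r, forall x, C (r x) & forall x, C x -> r x = x].
Proof.
move=> Cx0.
have /choice[pick hpick] : forall u : seq nat, exists y, 
    (exists z, C z /\ mkseq z (size u) = u) -> C y /\ mkseq y (size u) = u.
  move=> u; case: (pselect (exists z, C z /\ mkseq z (size u) = u)) => [[z hz]|n].
    by exists z.
  by exists x0 => /n.
have pickP x n : meets x n -> C (pick (mkseq x n)) /\ agree n x (pick (mkseq x n)).
  move=> [y [Cy /agree_mkseq xy]].
  have [|h1 h2] := hpick (mkseq x n).
    by exists y; rewrite size_mkseq.
  by split=> //; apply/agree_mkseq; rewrite size_mkseq in h2.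
(* Restricting to prefixes of length at most [i + 1] makes coordinate [i] of [r x] depend on
   finitely much of [x]; length [i + 1] is just enough for it to equal [x i] when [x] lies in
   [C]. *)
pose last_meet x i := \max_(k < i.+2 | `[< meets x k >]) k.
pose r x i := pick (mkseq x (last_meet x i)) i.
have meets0 x : meets x 0 by exists x0.
have last_meetP x i : meets x (last_meet x i).
  rewrite /last_meet; elim/big_ind: _ => //.
    by move=> a b ma mb; case: leqP.
  by move=> k /asboolP.
have last_le x i : last_meet x i <= i.+1.
  by apply/bigmax_leqP => k _; rewrite -ltnS.
have last_ge x i k : k <= i.+1 -> meets x k -> k <= last_meet x i.
  move=> ki mk; pose K : 'I_i.+2 := Ordinal (ki : k < i.+2).
  by rewrite (@leq_bigmax_cond _ _ (fun k : 'I_i.+2 => k : nat) K) //; apply/asboolP.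
have rC x : C x -> r x = x.
  move=> Cx; apply/funext => i; rewrite /r.
  have [_ h] := pickP x _ (last_meetP x i).
  by rewrite h //; apply: last_ge => //; exists x.
exists r; split=> // [x n|x].
  exists n.+1 => y xy i ltin; rewrite /r.
  have mxy k : k <= n.+1 -> meets x k <-> meets y k.
    move=> kn; split=> -[z [Cz xz]]; exists z; split=> //; apply: agree_trans xz.
      by apply/agree_sym/(agree_le kn).
    exact: agree_le xy.
  have -> : last_meet y i = last_meet x i.
    apply: eq_bigl => k; apply: asbool_equiv_eq; apply: iff_sym; apply: mxy.
    by rewrite -ltnS; apply: leq_trans (ltn_ord k) _; rewrite !ltnS ltnW.
  congr (pick _ i); apply/agree_mkseq; apply: agree_le xy.
  by apply: leq_trans (last_le x i) _; apply: leqW.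
case: (pselect (forall n, meets x n)) => [h|/existsNP[n nn]].
  have Cx : C x.
    apply: contrapT => /cC[m hm]; have [y [Cy xy]] := h m; exact: (hm y xy).
  by rewrite rC.
have [N [mN hN]] : exists N, meets x N /\ ~ meets x N.+1.
  apply: contrapT => /forallNP h; apply: nn; elim: n => // n IH.
  by apply: contrapT => nm; apply: (h n).
have [CN aN] := pickP x N mN.
suff -> : r x = pick (mkseq x N) by [].
apply/funext => i; rewrite /r.
have [iN|Ni] := ltnP i N.
  have li : i < last_meet x i by apply: last_ge => //; apply: meets_le mN.
  by have [_ ->//] := pickP x _ (last_meetP x i); rewrite aN.
congr (pick (mkseq x _) i); apply/eqP; rewrite eqn_leq last_ge 1?leqW ?andbT //.
rewrite leqNgt; apply/negP => lt; apply: hN; exact: meets_le lt (last_meetP x i).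
Qed.

End Retraction.

(** * Projections and injective projections of closed sets *)

Definition sigma11 (Q : baire -> Prop) : Prop :=
  exists2 C, closed_baire C & forall x, Q x <-> exists w, C (pairB x w).

Definition usigma11 (Q : baire -> Prop) : Prop :=
  exists2 C, closed_baire C & forall x,
    (Q x <-> exists w, C (pairB x w)) /\
    forall w w', C (pairB x w) -> C (pairB x w') -> w = w'.

(* By the Lusin-Souslin theorem these are exactly the Borel sets: injective projections of
   closed sets are more convenient here than sigma-algebra membership. *)
Definition borel_baire (Q : baire -> Prop) : Prop :=
  usigma11 Q /\ usigma11 (fun x => ~ Q x).

Lemma usigma11_sigma11 Q : usigma11 Q -> sigma11 Q.
Proof. by move=> [C cC h]; exists C => // x; have [] := h x. Qed.

Lemma eq_sigma11 (P Q : baire -> Prop) : (forall x, P x <-> Q x) -> sigma11 P -> sigma11 Q.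
Proof. by move=> PQ; have -> : P = Q by apply/funext => x; apply/propext. Qed.

Lemma eq_usigma11 (P Q : baire -> Prop) :
  (forall x, P x <-> Q x) -> usigma11 P -> usigma11 Q.
Proof. by move=> PQ; have -> : P = Q by apply/funext => x; apply/propext. Qed.

Lemma eq_borel (P Q : baire -> Prop) :
  (forall x, P x <-> Q x) -> borel_baire P -> borel_baire Q.
Proof. by move=> PQ; have -> : P = Q by apply/funext => x; apply/propext. Qed.

Lemma usigma11_preimage h Q :
  continuous_baire h -> usigma11 Q -> usigma11 (fun x => Q (h x)).
Proof.
move=> ch [C cC hC].
exists (fun v => C (pairB (h (fstB v)) (sndB v))).
  apply: (@closed_preimage (fun v => pairB (h (fstB v)) (sndB v))) => //.
  apply: continuous_pairB; last by cont.
  exact/(continuous_comp ch)/continuous_fstB.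
move=> x; have [-> u] := hC (h x); split.
  by split=> -[w Cw]; exists w; rewrite fst_pairB snd_pairB // in Cw *.
by move=> w w'; rewrite !fst_pairB !snd_pairB; apply: u.
Qed.

Lemma borel_preimage h Q :
  continuous_baire h -> borel_baire Q -> borel_baire (fun x => Q (h x)).
Proof. by move=> ch [uQ unQ]; split; [apply: usigma11_preimage uQ|apply: usigma11_preimage unQ]. Qed.

Lemma closed_usigma11 C : closed_baire C -> usigma11 C.
Proof.
move=> cC; exists (fun v => C (fstB v) /\ sndB v = fun=> 0).
  apply: closed_and; last by apply: closed_eq; cont.
  exact: (closed_preimage continuous_fstB).
move=> x; split; last first.
  by move=> w w'; rewrite !snd_pairB => -[_ ->] [_ ->].
split=> [Cx|[w]]; last by rewrite fst_pairB => -[].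
by exists (fun=> 0); rewrite fst_pairB snd_pairB.
Qed.

(** The witnesses are stored as columns of one sequence. Columns leave the coordinates outside the
    range of [pickle] free, so the joint witness is also required to be a canonical [joinB]; this
    restores uniqueness. *)
Lemma usigma11_forall (Q : nat -> baire -> Prop) :
  (forall i, usigma11 (Q i)) -> usigma11 (fun x => forall i, Q i x).
Proof.
move=> hQ; have /choice[C hC] : forall i, exists C, closed_baire C /\ forall x,
    (Q i x <-> exists w, C (pairB x w)) /\
    forall w w', C (pairB x w) -> C (pairB x w') -> w = w'.
  by move=> i; have [C c h] := hQ i; exists C.
exists (fun v => (forall i, C i (pairB (fstB v) (col (sndB v) i))) /\
                 sndB v = joinB (col (sndB v))).
  apply: closed_and.
    apply: closed_forall => i.
    apply: (@closed_preimage (fun v => pairB (fstB v) (col (sndB v) i))).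
      by cont.
    by have [] := hC i.
  apply: closed_eq; first by cont.
  (* Coordinate [k] of the canonical sequence reads at most coordinate [pickle (unpickle k)] of the
     original, so [q] bounds how much has to be fixed. *)
  pose q (k : nat) := (pickle (odflt (0, 0) (unpickle k : option (nat * nat)))).+1.
  move=> x n; have [m hm] := continuous_sndB x (\max_(k < n) q k).
  exists m => y /hm xy i ltin; rewrite /joinB.
  case e: (unpickle i) => [[a b]|//]; apply: xy.
  have := @leq_bigmax_cond _ xpredT (fun k : 'I_n => q k) (Ordinal ltin).
  by rewrite /q /= e => /(_ isT).
move=> x; split.
  split.
    move=> h; have /choice[w hw] : forall i, exists w, C i (pairB x w).
      by move=> i; apply/(proj1 ((hC i).2 x)).
    exists (joinB w); rewrite fst_pairB snd_pairB; split=> [i|]; first by rewrite col_joinB.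
    by congr joinB; apply/funext => i; rewrite col_joinB.
  move=> [w]; rewrite fst_pairB snd_pairB => -[h _] i.
  by apply/(proj1 ((hC i).2 x)); exists (col w i).
move=> w w'; rewrite !fst_pairB !snd_pairB => -[h ->] [h' ->].
congr joinB; apply/funext => i; have [_ u] := (hC i).2 x; exact: u.
Qed.

(** The first entry of the witness names the index; disjointness determines that entry, and
    injectivity for this index determines the rest. *)
Lemma usigma11_exists_disjoint (Q : nat -> baire -> Prop) :
  (forall i, usigma11 (Q i)) -> (forall x i j, Q i x -> Q j x -> i = j) ->
  usigma11 (fun x => exists i, Q i x).
Proof.
move=> hQ dQ; have /choice[C hC] : forall i, exists C, closed_baire C /\ forall x,
    (Q i x <-> exists w, C (pairB x w)) /\
    forall w w', C (pairB x w) -> C (pairB x w') -> w = w'.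
  by move=> i; have [c c' h] := hQ i; exists c.
exists (fun v => forall i, sndB v 0 = i -> C i (pairB (fstB v) (tailB (sndB v)))).
  apply: closed_forall => i; apply: closed_imp.
    by have [/(open_preimage continuous_sndB)] := eq_coord_clopen 0 i.
  apply: (@closed_preimage (fun v => pairB (fstB v) (tailB (sndB v)))).
    by cont.
  by have [] := hC i.
move=> x; split.
  split.
    move=> [i /(proj1 ((hC i).2 x))[w Cw]]; exists (consB i w) => j.
    by rewrite fst_pairB snd_pairB tail_consB => <-.
  move=> [w /(_ (w 0))]; rewrite fst_pairB snd_pairB => /(_ erefl) Cw.
  by exists (w 0); apply/(proj1 ((hC _).2 x)); exists (tailB w).
move=> w w' /(_ (w 0)) + /(_ (w' 0)); rewrite !fst_pairB !snd_pairB => /(_ erefl) h /(_ erefl) h'.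
have e : w 0 = w' 0.
  apply: (dQ x); apply/(proj1 ((hC _).2 x)); first by exists (tailB w).
  by exists (tailB w').
rewrite -e in h'.
by rewrite -(cons_tailB w) -(cons_tailB w') e ((proj2 ((hC _).2 x)) _ _ h h').
Qed.

Lemma borel_not Q : borel_baire Q -> borel_baire (fun x => ~ Q x).
Proof.
move=> [uQ unQ]; split=> //.
by have -> : (fun x => ~ ~ Q x) = Q by apply/funext => x; rewrite notK.
Qed.

Lemma borel_cst (P : Prop) : borel_baire (fun=> P).
Proof. by split; apply: closed_usigma11 => x h; exists 0 => y _. Qed.

(** The union becomes disjoint when [Q i] is cut down to the points whose least index is [i].
    Excluding smaller indices requires injective projections for the complements too, which is why
    [borel_baire] is two-sided. *)
Local Lemma usigma11_exists (Q : nat -> baire -> Prop) :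
  (forall i, borel_baire (Q i)) -> usigma11 (fun x => exists i, Q i x).
Proof.
move=> hQ; pose D i x := forall j, (j < i -> ~ Q j x) /\ (j = i -> Q i x).
have -> : (fun x => exists i, Q i x) = (fun x => exists i, D i x).
  apply/funext => x; apply/propext; split=> -[i h]; last by exists i; apply: (h i).2.
  have [n /asboolP Qn hn] := @ex_minnP (fun i => `[< Q i x >]) (ex_intro _ i (asboolT h)).
  exists n => j; split=> [jn Qj|_]; last exact: Qn.
  by have := hn j (asboolT Qj); rewrite leqNgt jn.
apply: usigma11_exists_disjoint => [i|x i j Di Dj].
  apply: usigma11_forall => j.
  case: (ltngtP j i) => ji.
  - have [_] := hQ j; apply: eq_usigma11 => x.
    by split=> [h|[/(_ isT)]//]; split=> // e; rewrite e ltnn in ji.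
  - have [+ _] := borel_cst True; apply: eq_usigma11 => x.
    by split=> // _; split=> // e; rewrite e ltnn in ji.
  - have [+ _] := hQ i; apply: eq_usigma11 => x.
    by split=> [h|[_ /(_ ji)]//].
have Qi := (Di i).2 erefl; have Qj := (Dj j).2 erefl.
by case: (ltngtP i j) => // ij; [have [/(_ ij)] := Dj i|have [/(_ ij)] := Di j].
Qed.

Lemma borel_forall (Q : nat -> baire -> Prop) :
  (forall i, borel_baire (Q i)) -> borel_baire (fun x => forall i, Q i x).
Proof.
move=> hQ; split; first by apply: usigma11_forall => i; have [] := hQ i.
have -> : (fun x => ~ forall i, Q i x) = (fun x => exists i, ~ Q i x).
  by apply/funext => x; apply/propext; split=> [/existsNP//|[i h] /(_ i)].
by apply: usigma11_exists => i; apply: borel_not.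
Qed.

Lemma borel_exists (Q : nat -> baire -> Prop) :
  (forall i, borel_baire (Q i)) -> borel_baire (fun x => exists i, Q i x).
Proof.
move=> hQ; have := borel_not (borel_forall (fun i => borel_not (hQ i))).
by apply: eq_borel => x; rewrite -existsNP; split=> -[i]; exists i => //; apply: contrapT.
Qed.

Lemma borel_and P Q : borel_baire P -> borel_baire Q -> borel_baire (fun x => P x /\ Q x).
Proof.
move=> hP hQ.
have /borel_forall : forall i, borel_baire (fun x => if i is 0 then P x else Q x) by case.
apply: eq_borel => x; split=> [h|[Px Qx] []//].
by split; [apply: (h 0)|apply: (h 1)].
Qed.

Lemma borel_imp P Q : borel_baire P -> borel_baire Q -> borel_baire (fun x => P x -> Q x).
Proof.
move=> hP /borel_not hQ; have := borel_not (borel_and hP hQ).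
by apply: eq_borel => x; split=> [h Px|h [/h]//]; apply: contrapT => nQ; apply: h.
Qed.

Lemma borel_forall_count (T : countType) (Q : T -> baire -> Prop) :
  (forall i, borel_baire (Q i)) -> borel_baire (fun x => forall i, Q i x).
Proof.
move=> hQ.
have /borel_forall : forall n, borel_baire
    (fun x => if @unpickle T n is Some i then Q i x else True).
  by move=> n; case: (unpickle n) => [i|]; [exact: hQ|exact: borel_cst].
apply: eq_borel => x; split=> [h i|h n]; first by have := h (pickle i); rewrite pickleK.
by case: (unpickle n).
Qed.

Lemma borel_exists_count (T : countType) (Q : T -> baire -> Prop) :
  (forall i, borel_baire (Q i)) -> borel_baire (fun x => exists i, Q i x).
Proof.
move=> hQ; have := borel_not (borel_forall_count (fun i => borel_not (hQ i))).
by apply: eq_borel => x; rewrite -existsNP; split=> -[i]; exists i => //; apply: contrapT.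
Qed.

Lemma clopen_borel C : clopen_baire C -> borel_baire C.
Proof. by move=> /[dup] [[_ /closed_usigma11 ?]] /clopen_not [_ /closed_usigma11 ?]. Qed.

Lemma open_borel U : open_baire U -> borel_baire U.
Proof.
move=> oU.
have : borel_baire (fun x => exists n, forall u : seq nat, mkseq x n = u ->
          forall y, mkseq y n = u -> U y).
  apply: borel_exists => n; apply: borel_forall_count => u.
  apply: borel_imp; last exact: borel_cst.
  exact/clopen_borel/mkseq_clopen.
apply: eq_borel => x; split=> [[n h]|Ux]; first exact: (h (mkseq x n)).
have [m hm] := oU x Ux; exists m => u <- y /agree_mkseq xy; exact: hm.
Qed.

Lemma borel_sigma11 Q : borel_baire Q -> sigma11 Q.
Proof. by move=> [/usigma11_sigma11]. Qed.

Lemma sigma11_cst (P : Prop) : sigma11 (fun=> P).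
Proof. exact/borel_sigma11/borel_cst. Qed.

Lemma sigma11_forall (Q : nat -> baire -> Prop) :
  (forall i, sigma11 (Q i)) -> sigma11 (fun x => forall i, Q i x).
Proof.
move=> hQ; have /choice[C hC] : forall i, exists C, closed_baire C /\ forall x,
    (Q i x <-> exists w, C (pairB x w)).
  by move=> i; have [C c h] := hQ i; exists C.
exists (fun v => forall i, C i (pairB (fstB v) (col (sndB v) i))).
  apply: closed_forall => i.
  apply: (@closed_preimage (fun v => pairB (fstB v) (col (sndB v) i))).
    by cont.
  by have [] := hC i.
move=> x; split.
  move=> h; have /choice[w hw] : forall i, exists w, C i (pairB x w).
    by move=> i; apply/((hC i).2 x).
  by exists (joinB w) => i; rewrite fst_pairB snd_pairB col_joinB.
move=> [w h] i; apply/((hC i).2 x); exists (col w i).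
by have := h i; rewrite fst_pairB snd_pairB.
Qed.

Lemma sigma11_existsB (Q : baire -> baire -> Prop) :
  sigma11 (fun v => Q (fstB v) (sndB v)) -> sigma11 (fun x => exists y, Q x y).
Proof.
move=> [C cC hC].
exists (fun v => C (pairB (pairB (fstB v) (fstB (sndB v))) (sndB (sndB v)))).
  apply: (@closed_preimage (fun v => pairB (pairB (fstB v) (fstB (sndB v))) (sndB (sndB v)))) => //.
  by cont.
move=> x; split=> [[y Qxy]|[w]].
  have /hC[w Cw] : Q (fstB (pairB x y)) (sndB (pairB x y)) by rewrite fst_pairB snd_pairB.
  by exists (pairB y w); rewrite !(fst_pairB, snd_pairB).
rewrite fst_pairB !snd_pairB => h; exists (fstB w).
have /hC : exists w', C (pairB (pairB x (fstB w)) w') by exists (sndB w).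
by rewrite fst_pairB snd_pairB.
Qed.

Lemma sigma11_exists (Q : nat -> baire -> Prop) :
  (forall i, sigma11 (Q i)) -> sigma11 (fun x => exists i, Q i x).
Proof.
move=> hQ; have /choice[C hC] : forall i, exists C, closed_baire C /\ forall x,
    (Q i x <-> exists w, C (pairB x w)).
  by move=> i; have [c c' h] := hQ i; exists c.
exists (fun v => forall i, sndB v 0 = i -> C i (pairB (fstB v) (tailB (sndB v)))).
  apply: closed_forall => i; apply: closed_imp.
    by have [/(open_preimage continuous_sndB)] := eq_coord_clopen 0 i.
  apply: (@closed_preimage (fun v => pairB (fstB v) (tailB (sndB v)))).
    by cont.
  by have [] := hC i.
move=> x; split.
  move=> [i /((hC i).2 x)[w Cw]]; exists (consB i w) => j.
  by rewrite fst_pairB snd_pairB tail_consB => <-.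
move=> [w /(_ (w 0))]; rewrite fst_pairB snd_pairB => /(_ erefl) Cw.
by exists (w 0); apply/((hC _).2 x); exists (tailB w).
Qed.

Lemma sigma11_and P Q : sigma11 P -> sigma11 Q -> sigma11 (fun x => P x /\ Q x).
Proof.
move=> hP hQ.
have /sigma11_forall : forall i, sigma11 (fun x => if i is 0 then P x else Q x) by case.
apply: eq_sigma11 => x; split=> [h|[Px Qx] []//].
by split; [apply: (h 0)|apply: (h 1)].
Qed.

Lemma sigma11_or P Q : sigma11 P -> sigma11 Q -> sigma11 (fun x => P x \/ Q x).
Proof.
move=> hP hQ.
have /sigma11_exists : forall i, sigma11 (fun x => if i is 0 then P x else Q x) by case.
apply: eq_sigma11 => x; split=> [[[|i]]|[Px|Qx]]; [by left|by right|by exists 0|by exists 1].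
Qed.

Lemma sigma11_forall_count (T : countType) (Q : T -> baire -> Prop) :
  (forall i, sigma11 (Q i)) -> sigma11 (fun x => forall i, Q i x).
Proof.
move=> hQ.
have /sigma11_forall : forall n, sigma11
    (fun x => if @unpickle T n is Some i then Q i x else True).
  by move=> n; case: (unpickle n) => [i|]; [exact: hQ|exact: sigma11_cst].
apply: eq_sigma11 => x; split=> [h i|h n]; first by have := h (pickle i); rewrite pickleK.
by case: (unpickle n).
Qed.

Lemma sigma11_exists_count (T : countType) (Q : T -> baire -> Prop) :
  (forall i, sigma11 (Q i)) -> sigma11 (fun x => exists i, Q i x).
Proof.
move=> hQ.
have /sigma11_exists : forall n, sigma11
    (fun x => if @unpickle T n is Some i then Q i x else False).
  by move=> n; case: (unpickle n) => [i|]; [exact: hQ|exact: sigma11_cst].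
apply: eq_sigma11 => x; split=> [[n]|[i h]]; last by exists (pickle i); rewrite pickleK.
by case: (unpickle n) => // i; exists i.
Qed.

Lemma sigma11_const_imp (P : Prop) Q : (P -> sigma11 Q) -> sigma11 (fun x => P -> Q x).
Proof.
move=> h; case: (pselect P) => p.
  by apply: eq_sigma11 (h p) => x; split=> // /(_ p).
by apply: eq_sigma11 (sigma11_cst True) => x; split=> // _ /p.
Qed.

Definition parametrizes (X : space) (f : baire -> pt X) : Prop :=
  cont_baire f /\ forall a, exists x, eqv (f x) a.

(** The required continuous surjection from Baire space is a retraction onto the closed set of pairs
    (code, witness), followed by the first projection and [f]. The retraction needs a point to start
    from, hence the separate case of the empty set. *)
Lemma sigma11_analytic (X : space) (f : baire -> pt X) (P : pt X -> Prop) :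
  parametrizes f -> (forall x a, eqv (f x) a -> P (f x) <-> P a) ->
  sigma11 (fun x => P (f x)) -> analytic P.
Proof.
move=> [cf sf] eP [C cC hC].
case: (pselect (exists a, P a)) => [[a Pa]|/forallNP h]; last by left.
have fP b : P b -> exists x w, eqv (f x) b /\ C (pairB x w).
  move=> Pb; have [x xb] := sf b; have /hC[w Cw] : P (f x) by apply/(eP x b).
  by exists x, w.
have [x0 [w0 [_ C0]]] := fP a Pa.
have [r [cr Cr rC]] := closed_retract cC C0.
right; exists (fun y => f (fstB (r y))); split=> [x n|b].
  have [m hm] := cf (fstB (r x)) n; have [k hk] := continuous_fstc cr x m.
  by exists k => y /hk/hm.
split=> [/fP[x [w [xb Cw]]]|[x xb]].
  by exists (pairB x w); rewrite rC // fst_pairB.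
by apply/(eP _ _ xb)/hC; exists (sndB (r x)); rewrite pair_fst_snd.
Qed.

(** * Closed sets with a unique element *)

Lemma mkseq_cons (y : baire) n : mkseq y n.+1 = y 0 :: mkseq (tailB y) n.
Proof. by rewrite /mkseq /= (iotaDl 1 0) -map_comp. Qed.

Lemma mkseq_rcons (y : baire) n : mkseq y n.+1 = rcons (mkseq y n) (y n).
Proof. by rewrite /mkseq -addn1 iotaD map_cat cats1. Qed.

Lemma take_mkseq (y : baire) k n : take k (mkseq y n) = mkseq y (minn k n).
Proof. by rewrite /mkseq -map_take take_iota. Qed.

Definition body (E : seq nat -> Prop) : set baire := [set y | forall n, E (mkseq y n)].
Definition prefix_closed (E : seq nat -> Prop) := forall u k, E u -> E (take k u).
Definition subtree (E : seq nat -> Prop) (i : nat) : seq nat -> Prop := fun u => E (i :: u).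

(** The answers of a strategy that sees the moves made so far, the current one included. Thus
    [play phi] preserves lengths and prefixes, and a map of this kind between well-founded trees
    witnesses an inequality of ranks. *)
Fixpoint play (phi : seq nat -> nat) (u : seq nat) : seq nat :=
  if u is i :: u' then phi [:: i] :: play (fun w => phi (i :: w)) u' else [::].

Definition embeds (E E' : seq nat -> Prop) : Prop := exists phi, forall u, E u -> E' (play phi u).

Lemma eq_play phi psi u : (forall i w, phi (i :: w) = psi (i :: w)) -> play phi u = play psi u.
Proof.
elim: u phi psi => //= i u IH phi psi h; congr (_ :: _); first exact: h.
by apply: IH => j w; apply: h.
Qed.

Lemma play_mkseq phi y n : play phi (mkseq y n) = mkseq (fun k => phi (mkseq y k.+1)) n.
Proof.
elim: n phi y => // n IH phi y; rewrite !mkseq_cons /= IH; congr (_ :: _).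
by apply: eq_map => k; rewrite /tailB [in RHS]mkseq_cons.
Qed.

Lemma prefix_closed_subtree E i : prefix_closed E -> prefix_closed (subtree E i).
Proof. by move=> cE u k /cE - /(_ k.+1). Qed.

(* A comparison of tree ranks: [rank E <= rank E'] or [rank E' < rank E]. *)
Lemma embeds_total (E E' : seq nat -> Prop) : prefix_closed E -> prefix_closed E' ->
  (forall y, ~ body E' y) -> embeds E E' \/ exists i, embeds E' (subtree E i).
Proof.
move=> cE cE' nb; apply: contrapT => bad0.
pose tree := seq nat -> Prop.
(* A pair violating the dichotomy produces a violating pair of immediate subtrees; iterating this
   descends along a branch of [E'], which does not exist. *)
pose bad (p : tree * tree) := [/\ prefix_closed p.1, prefix_closed p.2 &
  ~ (embeds p.1 p.2 \/ exists i, embeds p.2 (subtree p.1 i))].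
have bad_root p : bad p -> p.2 [::].
  case: p => F F' [/= cF cF' nF]; apply: contrapT => n0; apply: nF; right; exists 0.
  by exists (fun=> 0) => u /(cF' u 0); rewrite take0.
have /choice[next hnext] : forall p, exists ij : nat * nat,
    bad p -> bad (subtree p.1 ij.1, subtree p.2 ij.2).
  case=> F F'; apply: contrapT => /forallNP h.
  have bF : bad (F, F') by have := h (0, 0); move=> /not_implyP[].
  have [cF cF' nF] := bF.
  have {}h i j : embeds (subtree F i) (subtree F' j) \/
      exists k, embeds (subtree F' j) (subtree (subtree F i) k).
    have /not_implyP[_ nb'] := h (i, j); apply: contrapT => n; apply: nb'; split=> //=.
      exact: prefix_closed_subtree.
    exact: prefix_closed_subtree.
  apply: nF => /=.
  have F'0 := bad_root _ bF.
  (* This is the recursion for ranks. If every child of [F] embeds in some child of [F'], the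
     strategies glue to one from [F] to [F']. Otherwise some child [i] of [F] embeds in no child of
     [F'], so by [h] every child of [F'] embeds strictly below that child, and [F'] embeds in it. *)
  case: (pselect (forall i, exists j, embeds (subtree F i) (subtree F' j))) => [sF|].
    left; have /choice[j /choice[phi hphi]] := sF.
    exists (fun u => if u is i :: w then (if w is [::] then j i else phi i w) else 0).
    case=> [//|i u] Fiu /=; have := hphi i u Fiu; rewrite /subtree.
    rewrite (@eq_play _ (phi i))//.
  move=> /existsNP[i /forallNP ni]; right; exists i.
  have /choice[k /choice[phi hphi]] : forall j, exists k, 
      embeds (subtree F' j) (subtree (subtree F i) k).
    by move=> j; have [/ni//|] := h i j.
  exists (fun u => if u is j :: w then (if w is [::] then k j else phi j w) else 0).
  case=> [_|j u F'ju] /=.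
    (* If [[:: i]] were not in [F], the subtree at [i] would be empty and would embed anywhere,
       against the choice of [i]. *)
    apply: contrapT => nFi; apply: (ni 0); exists (fun=> 0) => u Fu.
    by have := @prefix_closed_subtree _ i cF u 0 Fu; rewrite take0.
  have := hphi j u F'ju; rewrite /subtree.
  by rewrite (@eq_play _ (phi j)).
pose p n := iter n (fun p => (subtree p.1 (next p).1, subtree p.2 (next p).2)) (E, E').
have badp n : bad (p n) by elim: n => //= n /hnext.
pose y n := (next (p n)).2.
apply: (nb y) => n.
suff <- : (p n).2 [::] = E' (mkseq y n) by apply/bad_root/badp.
rewrite -[in RHS](cats0 (mkseq y n)); elim: n [::] => // n IH u.
by rewrite mkseq_rcons cat_rcons -IH.
Qed.

Lemma embeds_body E E' y : embeds E E' -> body E y -> exists y', body E' y'.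
Proof.
move=> [phi h] Ey; exists (fun k => phi (mkseq y k.+1)) => n.
by rewrite -play_mkseq; apply: h.
Qed.

Lemma play_clopen u v :
  clopen_baire (fun y => play (fun w => y (pickle w)) u = v).
Proof.
suff [m hm] : exists m, forall x y, agree m x y ->
    play (fun w => x (pickle w)) u = play (fun w => y (pickle w)) u.
  by apply: (@uniform_clopen _ m) => x y /hm ->.
suff : forall p, exists m, forall x y, agree m x y ->
    play (fun w => x (pickle (p ++ w))) u = play (fun w => y (pickle (p ++ w))) u.
  by move=> /(_ [::]).
elim: u => [|i u IH] p; first by exists 0.
have [m hm] := IH (rcons p i).
exists (maxn m (pickle (rcons p i)).+1) => x y xy /=; congr (_ :: _).
  by rewrite cats1 xy // leq_maxr.
have := hm x y (agree_le (leq_maxl _ _) xy).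
rewrite (@eq_play _ (fun w => x (pickle (p ++ i :: w)))) => [->|j w]; last by rewrite cat_rcons.
by apply: eq_play => j w; rewrite cat_rcons.
Qed.

Lemma sigma11_embeds (E E' : baire -> seq nat -> Prop) :
  (forall u, borel_baire (E^~ u)) -> (forall u, borel_baire (E'^~ u)) ->
  sigma11 (fun x => embeds (E x) (E' x)).
Proof.
move=> bE bE'.
have : sigma11 (fun x => exists y, forall u, E x u ->
    exists v, play (fun w => y (pickle w)) u = v /\ E' x v).
  apply: sigma11_existsB; apply: borel_sigma11; apply: borel_forall_count => u.
  apply: borel_imp; first exact: (borel_preimage continuous_fstB (bE u)).
  apply: borel_exists_count => v; apply: borel_and.
    exact: (borel_preimage continuous_sndB (clopen_borel (play_clopen u v))).
  exact: (borel_preimage continuous_fstB (bE' v)).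
apply: eq_sigma11 => x; split=> [[y h]|[phi h]].
  by exists (fun w => y (pickle w)) => u /h[v [->]].
exists (fun n => phi (odflt [::] (unpickle n))) => u /h h'.
by exists (play phi u); split=> //; apply: eq_play => i w; rewrite pickleK.
Qed.

Lemma borel_body (T : baire -> seq nat -> Prop) :
  (forall u, borel_baire (T^~ u)) -> forall g h, continuous_baire g -> continuous_baire h ->
  borel_baire (fun v => body (T (g v)) (h v)).
Proof.
move=> bT g h cg ch; apply: borel_forall => n.
have : borel_baire (fun v => exists u, mkseq (h v) n = u /\ T (g v) u).
  apply: borel_exists_count => u; apply: borel_and.
    exact: (borel_preimage ch (clopen_borel (mkseq_clopen n u))).
  exact: (borel_preimage cg (bT u)).
apply: eq_borel => v; split=> [[u [<-]]//|h']; by exists (mkseq (h v) n).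
Qed.

Definition unique_branch (E : seq nat -> Prop) : Prop :=
  exists y, body E y /\ forall y', body E y' -> y' = y.

Section Unicity.
Variable T : baire -> seq nat -> Prop.
Hypothesis bT : forall u, borel_baire (T^~ u).

(* The branches of [off x s] are those of [T x] outside the cylinder of [s]. *)
Let off x s (u : seq nat) := (forall k, T x (take k u)) /\ take (size s) u <> s.

Let off_closed x s : prefix_closed (off x s).
Proof.
move=> u k [Tu su]; split=> [j|]; first by rewrite -take_min.
have [sk|ks] := leqP (size s) k; first by rewrite take_takel.
rewrite take_taker 1?ltnW // => e; have := size_take_min k u.
by rewrite e => es; move: ks; rewrite es ltnNge geq_minl.
Qed.

Let body_off x s y : body (off x s) y <-> body (T x) y /\ mkseq y (size s) <> s.
Proof.
split=> [h|[Ty ys] n].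
  split=> [n|]; first by have [/(_ n)] := h n; rewrite take_mkseq minnn.
  by have [_] := h (size s); rewrite take_mkseq minnn.
split=> [k|]; first by rewrite take_mkseq; apply: Ty.
rewrite take_mkseq => e; apply: ys; rewrite -[RHS]e; congr mkseq.
by rewrite -[in LHS]e size_mkseq.
Qed.

Let off_borel s u : borel_baire (fun x => off x s u).
Proof.
by apply: borel_and; [apply: borel_forall => k; apply: bT|apply: borel_cst].
Qed.

(* [~ beaten x s] says that [off x s] has minimal rank among the [off x t] with [size t = size s],
   ties being broken by codes: it uniformises, in [s], the relation "[off x s] is well-founded". *)
Let beaten x s := exists t : seq nat, (size t = size s /\ t <> s) /\
  ((exists i, embeds (off x t) (subtree (off x s) i)) \/
   (pickle t < pickle s /\ embeds (off x t) (off x s))).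

Let beaten_sigma11 s : sigma11 (beaten^~ s).
Proof.
apply: sigma11_exists_count => t; apply: sigma11_and; first exact: sigma11_cst.
apply: sigma11_or.
  apply: sigma11_exists => i; apply: sigma11_embeds => u; exact: off_borel.
apply: sigma11_and; first exact: sigma11_cst.
by apply: sigma11_embeds => u; apply: off_borel.
Qed.

Let not_unique x := (exists y, (body (T x) (col y 0) /\ body (T x) (col y 1)) /\
    exists n, col y 0 n <> col y 1 n) \/
  exists n, forall s, size s = n -> forall j,
    (exists k, ~ T x (take k (rcons s j))) \/ beaten x s \/ beaten x (rcons s j).

(** A competitor [off x t] still contains the branch [y], whereas [off x (mkseq y n)] has no branch;
    an embedding would transport one. *)
Let unbeaten_branch x y n : body (T x) y -> (forall y', body (T x) y' -> y' = y) ->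
  ~ beaten x (mkseq y n).
Proof.
move=> Ty uy [t [[st tN]]]; rewrite size_mkseq in st.
have yt : body (off x t) y by apply/body_off; split=> //; rewrite st => e; apply: tN.
have noff y' : ~ body (off x (mkseq y n)) y'.
  by move=> /body_off[/uy ->]; rewrite size_mkseq.
move=> [[i /embeds_body/(_ yt)[y' hy']]|[_ /embeds_body/(_ yt)[y' /noff//]]].
apply: (noff (consB i y')) => -[|k]; last by rewrite mkseq_cons; exact: hy'.
by have := off_closed 0 (hy' 0); rewrite take0.
Qed.

(** Uniqueness fails through two branches or through none. In the second case some level has no
    unbeaten node with an unbeaten successor in the tree: otherwise the unbeaten nodes, at most one
    per level, would cohere into a branch. When there is exactly one branch, its own prefixes are
    unbeaten at every level, so the second alternative cannot hold. *)
Lemma sigma11_not_unique_branch : sigma11 (fun x => ~ unique_branch (T x)).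
Proof.
have : sigma11 not_unique.
  apply: sigma11_or.
    apply: sigma11_existsB; apply: borel_sigma11; apply: borel_and.
      by apply: borel_and; apply: borel_body => //; cont.
    apply: borel_exists => n; apply: borel_not.
    have : borel_baire (fun v => exists k, col (sndB v) 0 n = k /\ col (sndB v) 1 n = k).
      apply: borel_exists => k; apply: borel_and; apply: clopen_borel; exact: eq_coord_clopen.
    by apply: eq_borel => v; split=> [[k [-> ->]]//|->]; exists (col (sndB v) 1 n).
  apply: sigma11_exists => n; apply: sigma11_forall_count => s.
  apply: sigma11_const_imp => _; apply: sigma11_forall => j.
  apply: sigma11_or; last by apply: sigma11_or; apply: beaten_sigma11.
  by apply: borel_sigma11; apply: borel_exists => k; apply/borel_not/bT.
apply: eq_sigma11 => x; split.
  move=> + [y [Ty uy]] => -[[z [[/uy -> /uy ->]]] [n]//|[n h]].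
  have [[k]|[|]] := h (mkseq y n) (size_mkseq _ _) (y n).
  - by rewrite -mkseq_rcons take_mkseq.
  - exact: unbeaten_branch.
  - by rewrite -mkseq_rcons; apply: unbeaten_branch.
apply: contra_notP => /not_orP[n2 /forallNP hn].
have hT y y' : body (T x) y -> body (T x) y' -> y' = y.
  move=> Ty Ty'; apply: contrapT => ne; apply: n2.
  exists (joinB (fun i => if i is 0 then y else y')); rewrite !col_joinB; split=> //.
  by apply: contrapT => /forallNP h; apply/ne/esym/funext => i; apply: contrapT.
apply: contrapT => nu.
have nT y : ~ body (T x) y by move=> Ty; apply: nu; exists y; split=> // y'; apply: hT.
(* Without branches all the trees [off x s] are well-founded, hence comparable; of two nodes on one
   level, rank and then code decide which one is beaten. *)
have unbeaten_uniq s t : size s = size t -> ~ beaten x s -> ~ beaten x t -> s = t.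
  have main s' t' : size s' = size t' -> ~ beaten x s' -> ~ beaten x t' -> ~ pickle s' < pickle t'.
    move=> st bs bt lt.
    have ne : s' <> t' by move=> e; rewrite e ltnn in lt.
    have [||y|st'|[i ts]] := @embeds_total (off x s') (off x t').
    - exact: off_closed.
    - exact: off_closed.
    - by move=> /body_off[/nT].
    - by apply: bt; exists s'; split=> //; right.
    - by apply: bs; exists t'; split; [split=> // e; apply: ne|left; exists i].
  move=> st bs bt; apply: (pcan_inj pickleK); apply/eqP.
  by case: ltngtP => // h; case: (main _ _ _ _ _ h).
have /choice[s hs] : forall n, exists s, size s = n /\ exists j, 
    ~ (exists k, ~ T x (take k (rcons s j))) /\ ~ beaten x s /\ ~ beaten x (rcons s j).
  move=> n; have /existsNP[s /not_implyP[sn /existsNP[j /not_orP[h1 /not_orP[h2 h3]]]]] := hn n.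
  by exists s; split=> //; exists j.
have step n : exists j, s n.+1 = rcons (s n) j /\ forall k, T x (take k (s n.+1)).
  have [sn [j [/forallNP h1 [h2 h3]]]] := hs n; exists j.
  have [sn' [_ [_ [h4 _]]]] := hs n.+1.
  have -> : s n.+1 = rcons (s n) j by apply: unbeaten_uniq => //; rewrite size_rcons sn sn'.
  by split=> // k; apply: contrapT.
have /choice[y hy] := step.
have sy n : s n = mkseq y n.
  elim: n => [|n IH]; first by have [/size0nil] := hs 0.
  by rewrite (hy n).1 IH mkseq_rcons.
apply: (nT y) => n; have [_ /(_ n)] := hy n.
by rewrite sy take_mkseq (minn_idPl _).
Qed.

End Unicity.

(** * Cardinality of sections *)

Local Open Scope card_scope.

Lemma card_not_leP (V : pointedType) (S : set V) n :
  ~ (S #<= `I_n) <-> exists Y : nat -> V,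
    (forall i, i < n.+1 -> S (Y i)) /\ forall i j, i < j -> j < n.+1 -> Y i <> Y j.
Proof.
split=> [nS|[Y [SY dY]] Sn].
  have : `I_n.+1 #<= S.
    case: (pselect (finite_set S)) => [[m Sm]|/infiniteP]; last first.
      by apply: card_le_trans; apply: card_leT.
    rewrite (card_le_eqr Sm) card_le_II ltnNge; apply/negP => mn; apply: nS.
    by rewrite (card_le_eql Sm) card_le_II.
  move=> /pcard_leP/injfunPex[f fS finj]; exists f; split=> [i i_n|i j ij jn e]; first exact: fS.
  have : i = j by apply: (finj i j _ _ e); rewrite inE //=; apply: ltn_trans jn.
  by move=> e'; rewrite e' ltnn in ij.
have injY : {in `I_n.+1 &, injective Y}.
  move=> i j /[!inE]/= iN jN e; case: (ltngtP i j) => // ij; exfalso.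
    exact: dY ij jN e.
  exact: dY ij iN (esym e).
have : Y @` `I_n.+1 #<= S by apply: subset_card_le => _ [i i_n <-]; apply: SY.
rewrite (card_le_eql (inj_card_eq injY)) => /card_le_trans/(_ Sn).
by rewrite card_le_II ltnn.
Qed.

Lemma infinite_not_leP (V : Type) (S : set V) :
  ~ finite_set S <-> forall n, ~ (S #<= `I_n).
Proof.
by split=> [h n Sn|h /finite_set_leP[n Sn]]; [apply: h; apply/finite_set_leP; exists n|exact: (h n)].
Qed.

(* A Baire category argument: pass to smaller cylinders, avoiding at stage [j] the point with
   index [j] of an enumeration. *)
Lemma dense_in_itself_uncountable (V : Type) (E : seq nat -> Prop) (g : baire -> V) (Y : set baire) :
  (forall y y', body E y -> body E y' -> g y <> g y' ->
     exists m, forall y'', body E y'' -> agree m y y'' -> g y'' <> g y') ->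
  Y `<=` body E -> Y !=set0 ->
  (forall y m, Y y -> exists y', [/\ Y y', agree m y y' & g y' <> g y]) ->
  ~ countable (g @` body E).
Proof.
move=> sep YE [y0 Yy0] dY /countable_injP[h injh].
have next (jym : nat * (baire * nat)) : exists ym' : baire * nat, Y jym.2.1 ->
    [/\ Y ym'.1, jym.2.2 < ym'.2, agree jym.2.2 jym.2.1 ym'.1 &
      forall y'', body E y'' -> agree ym'.2 ym'.1 y'' -> h (g y'') <> jym.1].
  case: jym => j [y m]; case: (pselect (Y y)) => [Yy|nY]; last by exists (y, m) => /=.
  case: (pselect (exists z, body E z /\ h (g z) = j)) => [[z [Ez hz]]|nz]; last first.
    exists (y, m.+1); split=> //= y'' Ey'' _ hy''; apply: nz; by exists y''.
  have [y' [Yy' yy' ne]] : exists y', [/\ Y y', agree m y y' & g y' <> g z].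
    case: (pselect (g y = g z)) => [<-|ne]; first exact: dY.
    by exists y.
  have [k hk] := sep y' z (YE _ Yy') Ez ne.
  exists (y', maxn m.+1 k); split=> //=; first by rewrite leq_max leqnn.
  move=> y'' Ey'' y'y'' e; apply: (hk y'' Ey'').
    by apply: agree_le y'y''; apply: leq_maxr.
  by apply: injh; rewrite ?inE ?e.
have /choice[f hf] := next.
pose p := fix p n := if n is n'.+1 then f (n', p n') else (y0, 0).
have Yp n : Y (p n).1 by elim: n => //= n IH; have [] := hf (n, p n) IH.
have pS n : [/\ (p n).2 < (p n.+1).2, agree (p n).2 (p n).1 (p n.+1).1 &
      forall y'', body E y'' -> agree (p n.+1).2 (p n.+1).1 y'' -> h (g y'') <> n].
  by have [] := hf (n, p n) (Yp n).
have pge n : n <= (p n).2 by elim: n => // n IH; apply: leq_ltn_trans IH _; have [] := pS n.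
have pmono n k : (p n).2 <= (p (n + k)).2.
  elim: k => [|k IH]; first by rewrite addn0.
  by apply: leq_trans IH _; rewrite addnS ltnW //; have [] := pS (n + k).
have pagree n k : agree (p n).2 (p n).1 (p (n + k)).1.
  elim: k => [|k IH]; first by rewrite addn0.
  apply: agree_trans IH _; rewrite addnS; have [_ h1 _] := pS (n + k).
  exact: agree_le h1.
pose z i := (p i.+1).1 i.
have zp n : agree (p n).2 (p n).1 z.
  move=> i lt; rewrite /z; have [ni|i_n] := leqP n i.+1.
    by rewrite -(subnKC ni); apply: pagree.
  by rewrite -(subnKC (ltnW i_n)); apply/esym/pagree; exact: pge.
have Ez : body E z.
  move=> n; have /agree_mkseq -> : agree n (p n).1 z by apply: agree_le (zp n).
  exact: (YE _ (Yp n)).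
have [_ _ /(_ z Ez (zp _))] := pS (h (g z)).
exact.
Qed.

Section Counting.
Variables (V : pointedType) (T : baire -> seq nat -> Prop) (g : baire -> V).
(** A relation between finite prefixes witnessing that two values differ. It makes distinctness of
    values an open condition on codes, which is all that counting values has to know about [g]. *)
Variable apart : seq nat -> seq nat -> Prop.
Hypothesis bT : forall u, borel_baire (T^~ u).
Hypothesis apartP : forall x y y', body (T x) y -> body (T x) y' ->
  g y <> g y' <-> exists n, apart (mkseq y n) (mkseq y' n).

Lemma borel_apart (h k : baire -> baire) : continuous_baire h -> continuous_baire k ->
  borel_baire (fun v => exists n, apart (mkseq (h v) n) (mkseq (k v) n)).
Proof.
move=> ch ck; apply: borel_exists => n.
have : borel_baire (fun v => exists u : seq nat * seq nat,
    (mkseq (h v) n = u.1 /\ mkseq (k v) n = u.2) /\ apart u.1 u.2).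
  apply: borel_exists_count => u; apply: borel_and; last exact: borel_cst.
  apply: borel_and; first exact: (borel_preimage ch (clopen_borel (mkseq_clopen n u.1))).
  exact: (borel_preimage ck (clopen_borel (mkseq_clopen n u.2))).
apply: eq_borel => v; split=> [[u [[-> ->]]]//|a].
by exists (mkseq (h v) n, mkseq (k v) n).
Qed.

Lemma sigma11_card_not_le n : sigma11 (fun x => ~ (g @` body (T x) #<= `I_n)).
Proof.
have : sigma11 (fun x => exists y, forall i, i < n.+1 -> body (T x) (col y i) /\
    forall j, i < j -> j < n.+1 -> exists m, apart (mkseq (col y i) m) (mkseq (col y j) m)).
  apply: sigma11_existsB; apply: borel_sigma11; apply: borel_forall => i.
  apply: borel_imp; first exact: borel_cst.
  apply: borel_and; first by apply: borel_body => //; cont.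
  apply: borel_forall => j; do 2 (apply: borel_imp; first exact: borel_cst).
  by apply: borel_apart; cont.
apply: eq_sigma11 => x; rewrite card_not_leP; split=> [[y hy]|[Y [SY dY]]].
  exists (fun i => g (col y i)); split=> [i i_n|i j ij jn].
    by exists (col y i) => //; have [] := hy i i_n.
  have i_n := ltn_trans ij jn.
  have [Ti /(_ j ij jn)] := hy i i_n; have [Tj _] := hy j jn.
  by move/(apartP Ti Tj).
have /choice[y hy] : forall i, exists y, i < n.+1 -> body (T x) y /\ g y = Y i.
  move=> i; case: (ltnP i n.+1) => [/SY[y Ty gy]|_]; first by exists y.
  by exists (fun=> 0).
exists (joinB y) => i i_n; rewrite !col_joinB; have [Ti gi] := hy i i_n.
split=> // j ij jn; rewrite !col_joinB; have [Tj gj] := hy j jn.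
by apply/(apartP Ti Tj); rewrite gi gj; apply: dY.
Qed.

Lemma sigma11_infinite : sigma11 (fun x => ~ finite_set (g @` body (T x))).
Proof.
apply: eq_sigma11 (sigma11_forall sigma11_card_not_le) => x.
exact: (iff_sym (infinite_not_leP _)).
Qed.

Let apart_sep x y y' : body (T x) y -> body (T x) y' -> g y <> g y' ->
  exists m, forall y'', body (T x) y'' -> agree m y y'' -> g y'' <> g y'.
Proof.
move=> Ty Ty' /(apartP Ty Ty')[n a]; exists n => y'' Ty'' /agree_mkseq e.
by apply/(apartP Ty'' Ty'); exists n; rewrite e.
Qed.

(* For the witness, remove the cylinders whose image is countable and take a countable dense set of
   what remains; conversely use [dense_in_itself_uncountable]. *)
Lemma sigma11_uncountable : sigma11 (fun x => ~ countable (g @` body (T x))).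
Proof.
have : sigma11 (fun x => exists y, (forall k, body (T x) (col y k)) /\
    forall k m, exists l, agree m (col y k) (col y l) /\
      exists n, apart (mkseq (col y l) n) (mkseq (col y k) n)).
  apply: sigma11_existsB; apply: borel_sigma11; apply: borel_and.
    by apply: borel_forall => k; apply: borel_body => //; cont.
  apply: borel_forall => k; apply: borel_forall => m; apply: borel_exists => l.
  apply: borel_and; last by apply: borel_apart; cont.
  apply: borel_forall => i; apply: borel_imp; first exact: borel_cst.
  have : borel_baire (fun v => exists c, col (sndB v) l i = c /\ col (sndB v) k i = c).
    by apply: borel_exists => c; apply: borel_and; apply: clopen_borel; exact: eq_coord_clopen.
  by apply: eq_borel => v; split=> [[c [-> ->]]//|->]; exists (col (sndB v) k i).
apply: eq_sigma11 => x; split=> [[y [Ty hy]]|unc].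
  apply: (@dense_in_itself_uncountable _ _ _ (range (col y))) => [z z'|z [k _ <-]//| |z m [k _ <-]].
  - exact: apart_sep.
  - by exists (col y 0), 0.
  - have [l [kl a]] := hy k m; exists (col y l); split=> //.
    exact/(apartP (Ty l) (Ty k)).
pose N (u : seq nat) : set baire := [set y | mkseq y (size u) = u].
pose small u := countable (g @` (body (T x) `&` N u)).
pose F' : set baire := [set y | body (T x) y /\ forall m, ~ small (mkseq y m)].
have F'P y m : F' y -> exists y', [/\ F' y', agree m y y' & g y' <> g y].
  move=> [Ty nsy]; apply: contrapT => /forallNP h; apply: (nsy m).
  (* Otherwise the points of [F'] in this cylinder all have the value [g y], and its other branches
     lie in countably many cylinders with countable image; the cylinder itself would have a
     countable image. *)
  pose B := [set g y] `|` \bigcup_(u in [set u | small u]) (g @` (body (T x) `&` N u)).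
  apply: (@sub_countable _ _ _ B).
    apply: subset_card_le => _ [y' [Ty' yy'] <-].
    rewrite /N /= size_mkseq in yy'.
    case: (pselect (F' y')) => [Fy'|/not_andP[]//]; last first.
      move=> /existsNP[k /contrapT sk]; right; exists (mkseq y' k) => //.
      by exists y' => //; split=> //; rewrite /N /= size_mkseq.
    left; apply: contrapT => ne; apply: (h y'); split=> //; exact/agree_mkseq.
  rewrite /B; apply: (@sub_countable _ _ _ (\bigcup_(b in [set: option (seq nat)])
     (if b is Some u then if `[< small u >] then g @` (body (T x) `&` N u) else set0 else [set g y]))).
    apply: subset_card_le => r [->|[u su gu]]; first by exists None.
    by exists (Some u) => //; rewrite asboolT.
  apply: bigcup_countable; first exact: countableP.
  move=> [u|] _; last exact: countable1.
  by case: asboolP => // _; exact: countable0.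
have F'0 : exists y, F' y.
  apply: contrapT => /forallNP h; apply: unc.
  apply: (@sub_countable _ _ _ (\bigcup_(u in [set: seq nat])
     (if `[< small u >] then g @` (body (T x) `&` N u) else set0))).
    apply: subset_card_le => _ [y Ty <-].
    have /not_andP[//|/existsNP[k /contrapT sk]] := h y.
    exists (mkseq y k) => //; rewrite asboolT //.
    by exists y => //; split=> //; rewrite /N /= size_mkseq.
  apply: bigcup_countable; first exact: countableP.
  by move=> u _; case: asboolP => // _; exact: countable0.
have [y0 Fy0] := F'0.
(* A dense sequence in [F']: the entry with index [pickle u] lies in the cylinder of [u] whenever
   [F'] meets that cylinder. *)
have /choice[d hd] : forall k : nat, exists y, F' y /\
    forall u, @unpickle (seq nat) k = Some u -> (exists2 y', F' y' & N u y') -> N u y.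
  move=> k; case: (unpickle k) => [u|]; last by exists y0.
  case: (pselect (exists2 y', F' y' & N u y')) => [[y' Fy' uy']|n].
    by exists y'; split=> // _ [<-].
  by exists y0; split=> // _ [<-] /n.
exists (joinB d); split=> [k|k m]; rewrite col_joinB; first by have [[]] := hd k.
have [Fk _] := hd k; have [y' [Fy' ky' ne]] := F'P (d k) m Fk.
have [n hn] := apart_sep Fy'.1 Fk.1 ne.
(* The first [m] entries keep the new point close to [d k], the first [n] keep its value different
   from [g (d k)]. *)
pose u := mkseq y' (maxn m n).
have [Fl /(_ u)] := hd (pickle u); rewrite pickleK => /(_ erefl) Nl.
have /agree_mkseq yl : mkseq (d (pickle u)) (maxn m n) = mkseq y' (maxn m n).
  have : N u (d (pickle u)) by apply: Nl; exists y' => //; rewrite /N /u /= size_mkseq.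
  by rewrite /N /u /= size_mkseq.
exists (pickle u); rewrite !col_joinB; split.
  by apply: agree_trans ky' _; apply: agree_le yl; apply: leq_maxl.
apply/(apartP Fl.1 Fk.1)/hn; first exact: Fl.1.
by apply: agree_le yl; apply: leq_maxr.
Qed.

End Counting.

(** * Isolated branches of closed sets *)

Section Isolated.
Variable T : baire -> seq nat -> Prop.
Hypothesis bT : forall u, borel_baire (T^~ u).

Let restr x s (u : seq nat) := T x u /\ (size s <= size u -> take (size s) u = s).

Let body_restr x s y : body (restr x s) y <-> body (T x) y /\ mkseq y (size s) = s.
Proof.
split=> [h|[Ty ys] n].
  split=> [n|]; first by have [] := h n.
  by have [_] := h (size s); rewrite size_mkseq leqnn take_mkseq minnn; apply.
by split=> //; rewrite size_mkseq take_mkseq => /minn_idPl ->.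
Qed.

Definition incompatible (s t : seq nat) : Prop :=
  forall y : baire, mkseq y (size s) = s -> mkseq y (size t) = t -> False.

(** Isolated branches are counted by incompatible cylinders each containing exactly one branch.
    Finite lists of cylinders form a countable set, so only the unicity of a branch contributes to
    the complexity. *)
Definition isolated_ge (E : seq nat -> Prop) n : Prop := exists ss : seq (seq nat),
  size ss = n /\ forall i, i < n ->
    (exists y, (body E y /\ mkseq y (size (nth [::] ss i)) = nth [::] ss i) /\
       forall y', body E y' /\ mkseq y' (size (nth [::] ss i)) = nth [::] ss i -> y' = y) /\
    forall j, i < j -> j < n -> incompatible (nth [::] ss i) (nth [::] ss j).

Lemma sigma11_not_isolated_ge n : sigma11 (fun x => ~ isolated_ge (T x) n).
Proof.
have : sigma11 (fun x => forall ss : seq (seq nat), size ss = n -> exists i, i < n /\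
   (~ unique_branch (restr x (nth [::] ss i)) \/
    ~ forall j, i < j -> j < n -> incompatible (nth [::] ss i) (nth [::] ss j))).
  apply: sigma11_forall_count => ss; apply: sigma11_const_imp => _.
  apply: sigma11_exists => i; apply: sigma11_and; first exact: sigma11_cst.
  apply: sigma11_or; last exact: sigma11_cst.
  apply: sigma11_not_unique_branch => u; apply: borel_and => //; exact: borel_cst.
have ubP x s : unique_branch (restr x s) <->
    exists y, (body (T x) y /\ mkseq y (size s) = s) /\
       forall y', body (T x) y' /\ mkseq y' (size s) = s -> y' = y.
  split=> -[y [/body_restr ys uy]]; exists y; split=> // y'; by move=> /body_restr /uy.
apply: eq_sigma11 => x; split=> [h [ss [sn hs]]|h ss sn].
  have [i [i_n []]] := h ss sn; have [h1 h2] := hs i i_n; last exact.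
  by apply; apply/ubP.
apply: contrapT => /forallNP hi; apply: h; exists ss; split=> // i i_n.
have /not_andP[//|/not_orP[/contrapT/ubP h1 /contrapT h2]] := hi i.
by split.
Qed.

Lemma isolated_ge_card E n : isolated_ge E n.+1 -> ~ (body E #<= `I_n).
Proof.
move=> [ss [sn hs]]; apply/card_not_leP.
have /choice[Y hY] : forall i, exists y, i < n.+1 ->
    body E y /\ mkseq y (size (nth [::] ss i)) = nth [::] ss i.
  move=> i; case: (ltnP i n.+1) => [i_n|_]; last by exists (fun=> 0).
  by have [[y [hy _]] _] := hs i i_n; exists y.
exists Y; split=> [i /hY[]//|i j ij jn e].
have i_n := ltn_trans ij jn; have [_ /(_ j ij jn)] := hs i i_n.
move=> /(_ (Y i)); apply; first by have [] := hY i i_n.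
by rewrite e; have [] := hY j jn.
Qed.

(** The branches outside the [k] cylinders already found form a nonempty set, since each of those
    cylinders holds one branch and there are more than [k]. If none of the remaining branches were
    isolated among them, [dense_in_itself_uncountable] would contradict countability. *)
Lemma countable_isolated_ge E n :
  countable (body E) -> (forall m, m < n -> ~ (body E #<= `I_m)) -> isolated_ge E n.
Proof.
move=> cE; elim: n => [|k IH] hn; first by exists [::].
have [|ss [sk hs]] := IH; first by move=> m mk; apply: hn; apply: ltnW.
pose G : set baire := [set y | body E y /\
  forall i, i < k -> mkseq y (size (nth [::] ss i)) <> nth [::] ss i].
have G0 : G !=set0.
  apply: contrapT => /forallNP nG; apply: (hn k) => //.
  have /choice[f hf] : forall y, exists i, body E y ->
      i < k /\ mkseq y (size (nth [::] ss i)) = nth [::] ss i.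
    move=> y; case: (pselect (body E y)) => [Ey|nE]; last by exists 0.
    have /not_andP[//|/existsNP[i /not_implyP[ik /contrapT h]]] := nG y.
    by exists i.
  apply/pcard_leP; rewrite injfunPex; exists f => [y /hf[]//|y y' /[!inE] Ey Ey' e].
  have [fk fy] := hf y Ey; have [_ fy'] := hf y' Ey'.
  have [[z [_ uz]] _] := hs (f y) fk.
  by rewrite (uz y) // (uz y') //; split=> //; rewrite e.
have [y [[Ey yss] [m ym]]] : exists y, G y /\ exists m, forall y', G y' -> agree m y y' -> y' = y.
  apply: contrapT => /forallNP h.
  apply: (@dense_in_itself_uncountable _ E id G _ _ G0) => [z z' _ _ ne|z []//|y m Gy|].
  - have /existsNP[i ne'] : ~ forall i, z i = z' i by move=> e; apply: ne; apply/funext.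
    by exists i.+1 => z'' _ zz'' e; apply: ne'; rewrite -(zz'' i) // e.
  - have /not_andP[//|/forallNP/(_ m)/existsNP[y' /not_implyP[Gy' /not_implyP[yy' ne]]]] := h y.
    by exists y'.
  - by rewrite image_id.
(* Length [m] isolates [y] in [G]; being at least as long as all earlier words makes the new
   cylinder incompatible with each of them. *)
pose M := maxn m (\max_(s <- ss) size s).
have sM i : i < k -> size (nth [::] ss i) <= M.
  move=> ik; apply: leq_trans (leq_maxr _ _).
  by apply: leq_bigmax_seq => //; rewrite mem_nth // sk.
have inc i : i < k -> incompatible (nth [::] ss i) (mkseq y M).
  move=> ik z zi; rewrite size_mkseq => zy; apply: (yss i ik).
  rewrite -[RHS]zi; have := congr1 (take (size (nth [::] ss i))) zy.
  by rewrite !take_mkseq (minn_idPl (sM i ik)) => <-.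
exists (rcons ss (mkseq y M)); split=> [|i]; first by rewrite size_rcons sk.
rewrite ltnS leq_eqVlt => /predU1P[->|ik].
  rewrite nth_rcons sk ltnn eqxx size_mkseq; split; last first.
    by move=> j kj jk; move: (leq_trans kj jk); rewrite ltnn.
  exists y; split=> // y' [Ey' y'M]; apply: ym; last first.
    by apply/agree_mkseq; have := congr1 (take m) y'M; rewrite !take_mkseq (minn_idPl (leq_maxl _ _)).
  split=> // j jk e; apply: (inc j jk y') => //; by rewrite size_mkseq.
rewrite nth_rcons sk ik; have [h1 h2] := hs i ik; split=> // j ij.
rewrite ltnS leq_eqVlt => /predU1P[->|jk]; rewrite nth_rcons sk.
  by rewrite ltnn eqxx; apply: inc.
by rewrite jk; apply: h2.
Qed.

End Isolated.

Section CardinalitySections.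
Variables (V : pointedType) (T : baire -> seq nat -> Prop) (g : baire -> V).
Variable apart : seq nat -> seq nat -> Prop.
Hypothesis bT : forall u, borel_baire (T^~ u).
Hypothesis apartP : forall x y y', body (T x) y -> body (T x) y' ->
  g y <> g y' <-> exists n, apart (mkseq y n) (mkseq y' n).
Hypothesis g_inj : forall x y y', body (T x) y -> body (T x) y' -> g y = g y' -> y = y'.

(** Injectivity of [g] turns values into branches. Having exactly [n] branches means having at most
    [n] branches and [n] isolated ones; being countably infinite means being countable with
    arbitrarily many isolated branches. The negations are Sigma^1_1 clause by clause. *)
Lemma sigma11_not_card_sat k : sigma11 (fun x => ~ card_sat k (g @` body (T x))).
Proof.
have geq x : g @` body (T x) #= body (T x).
  by apply: inj_card_eq => y y' /[!inE]; apply: g_inj.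
have leq1 x m : (g @` body (T x) #<= `I_m) = (body (T x) #<= `I_m).
  exact: card_le_eql.
have iso n : sigma11 (fun x => ~ isolated_ge (T x) n) by exact: sigma11_not_isolated_ge.
case: k => [n|n|||] /=.
- have := sigma11_or (sigma11_card_not_le bT apartP n) (iso n).
  apply: eq_sigma11 => x; split=> [[nle|niso] eqn|neqn].
  + by apply: nle; rewrite (card_le_eql eqn) card_le_II.
  + have eqn' : body (T x) #= `I_n by rewrite -(card_eql (geq x)).
    apply: niso; apply: countable_isolated_ge => [|m mn].
      by apply: finite_set_countable; exists n.
    by rewrite (card_le_eql eqn') card_le_II; apply/negP; rewrite -ltnNge.
  + case: (pselect (g @` body (T x) #<= `I_n)) => [le|]; last by left.
    right=> iso_n; apply: neqn; rewrite card_eq_le le /=.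
    case: n iso_n le => [|n] iso_n le; first by rewrite II0 card_ge0.
    rewrite (card_le_eqr (geq x)); have := isolated_ge_card iso_n.
    move=> /card_not_leP[Y [TY dY]]; apply/pcard_leP; rewrite injfunPex; exists Y => //.
    move=> i j /[!inE]/= iN jN e; case: (ltngtP i j) => // ij; exfalso.
      exact: dY ij jN e.
    exact: dY ij iN (esym e).
- exact: (sigma11_card_not_le bT apartP).
- exact: (sigma11_infinite bT apartP).
- exact: (sigma11_uncountable bT apartP).
- have := sigma11_or (sigma11_uncountable bT apartP) (sigma11_exists iso).
  apply: eq_sigma11 => x; split=> [[unc|[n niso]] eqn|neqn].
  + by apply: unc; rewrite /countable card_eq_le in eqn *; case/andP: eqn.
  + have eqn' : body (T x) #= [set: nat] by rewrite -(card_eql (geq x)).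
    apply: niso; apply: countable_isolated_ge => [|m mn].
      by move: eqn'; rewrite card_eq_le => /andP[].
    rewrite (card_le_eql eqn') => le; apply: infinite_nat.
    by apply/finite_set_leP; exists m.
  + case: (pselect (countable (g @` body (T x)))) => [cg|]; last by left.
    right; apply: contrapT => /forallNP all_iso; apply: neqn.
    rewrite card_eq_le; apply/andP; split=> //.
    apply/infiniteP/infinite_not_leP => n; rewrite leq1.
    by apply: isolated_ge_card; apply: contrapT; apply: all_iso.
Qed.

End CardinalitySections.

Local Close Scope card_scope.
Local Open Scope ring_scope.

(** * Meager sections *)

Definition ritv (I : rat * rat) : set reals := [set r | ratr I.1 < r < ratr I.2].

Lemma open_ritv I : open (ritv I).
Proof.
suff -> : ritv I = `]ratr I.1, ratr I.2[%classic by exact: interval_open.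
by apply/seteqP; split=> r /=; rewrite in_itv.
Qed.

Lemma ritv0 (I : rat * rat) : I.1 < I.2 -> ritv I !=set0.
Proof.
rewrite -(@ltr_rat reals) /ritv; move: (ratr I.1 : reals) (ratr I.2 : reals) => a b ab.
by exists ((a + b) / 2) => /=; lra.
Qed.

Lemma ritv_lt I r : ritv I r -> I.1 < I.2.
Proof. by move=> /andP[a b]; rewrite -(@ltr_rat reals) (lt_trans a b). Qed.

Lemma open_contains_ritv (U : set reals) r :
  open U -> U r -> exists I, ritv I r /\ ritv I `<=` U.
Proof.
move=> oU Ur; have /nbhs_ballP[e /= e0 he] : nbhs r U by apply: open_nbhs_nbhs.
have [|p] := @rat_in_itvoo _ (r - e) r; first by lra.
have [|q] := @rat_in_itvoo _ r (r + e); first by lra.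
rewrite !in_itv /= => /andP[q1 q2] /andP[p1 p2]; exists (p, q); split=> [|s].
  by rewrite /ritv /=; lra.
move=> /andP[/= s1 s2]; apply: he; rewrite /ball /= ltr_norml; lra.
Qed.

Lemma nowhere_denseI (N : set reals) :
  (forall I, I.1 < I.2 -> exists J : rat * rat, [/\ J.1 < J.2, ritv J `<=` ritv I & ritv J `&` N = set0]) ->
  nowhere_dense_set N.
Proof.
move=> h; rewrite /nowhere_dense_set -subset0 => r hr.
have [I [Ir Icl]] := open_contains_ritv (@open_interior _ (closure N)) hr.
have [J [lt JI JN]] := h I (ritv_lt Ir); have [s Js] := ritv0 lt.
have : closure N s by apply: interior_subset; apply: Icl; apply: JI.
move=> /(_ (ritv J))[|t [Nt Jt]]; first by apply: open_nbhs_nbhs; split=> //; exact: open_ritv.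
by have : (ritv J `&` N) t by []; rewrite JN.
Qed.

Lemma nowhere_dense0 : nowhere_dense_set set0.
Proof. by apply: nowhere_denseI => I lt; exists I; split=> //; rewrite setI0. Qed.

Lemma sub_meager (A B : set reals) : A `<=` B -> meager_set B -> meager_set A.
Proof. by move=> AB [N [nN BN]]; exists N; split=> //; apply: subset_trans BN. Qed.

Lemma meager_bigcup (A : nat -> set reals) :
  (forall i, meager_set (A i)) -> meager_set (\bigcup_i A i).
Proof.
move=> /choice[N hN].
exists (fun n => if unpickle n is Some (i, k) then N i k else set0); split=> [n|r [i _ Ar]].
  by case: (unpickle n) => [[i k]|]; [apply: (hN i).1|exact: nowhere_dense0].
by have [k _ Nr] := (hN i).2 r Ar; exists (pickle (i, k)) => //=; rewrite pickleK.
Qed.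

Lemma meager_bigcup_count (T : countType) (A : T -> set reals) :
  (forall i, meager_set (A i)) -> meager_set (\bigcup_i A i).
Proof.
move=> mA.
have m0 : meager_set set0 by exists (fun=> set0); split=> // _; exact: nowhere_dense0.
apply: (@sub_meager _ (\bigcup_n (if @unpickle T n is Some i then A i else set0))).
  by move=> r [i _ Ar]; exists (pickle i) => //; rewrite pickleK.
by apply: meager_bigcup => n; case: unpickle.
Qed.

Lemma nowhere_dense_meager N : nowhere_dense_set N -> meager_set N.
Proof. by move=> nN; exists (fun=> N); split=> // r Nr; exists 0%N. Qed.

Lemma meagerU A B : meager_set A -> meager_set B -> meager_set (A `|` B).
Proof.
move=> mA mB; apply: (@sub_meager _ (\bigcup_b (if b then A else B))).
  by move=> r [Ar|Br]; [exists true|exists false].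
by apply: meager_bigcup_count => -[].
Qed.

Lemma ritv_not_meager (I : rat * rat) : I.1 < I.2 -> ~ meager_set (ritv I).
Proof.
move=> lt [N [nN IN]].
have /(_ (ritv I) (ritv0 lt) (@open_ritv I))[r [Ir h]] :
    dense (\bigcap_k ~` closure (N k) : set reals^o).
  apply: Baire => k; split; first by rewrite openC; exact: closed_closure.
  move=> O O0 oO; apply: contrapT => /forallNP h.
  have OcN : O `<=` closure (N k) by move=> s Os; apply: contrapT => ns; apply: (h s).
  have [s Os] := O0; have : interior (closure (N k)) s.
    exact: (filterS OcN (open_nbhs_nbhs (conj oO Os))).
  by rewrite (nN k).
have [k _ Nr] := IN r Ir.
by apply: (h k Logic.I); apply: subset_closure.
Qed.

Definition everywhere_nonmeager (S : set reals) (I : rat * rat) : Prop :=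
  I.1 < I.2 /\ forall J, J.1 < J.2 -> ritv J `<=` ritv I -> ~ meager_set (S `&` ritv J).

(** Suppose every rational interval inside [U] contains one on which [S] is meager. The union [W] of
    all these meager pieces is meager because there are countably many, and the points of [U] in
    none of the small intervals form a nowhere dense set. *)
Lemma nonmeager_somewhere (S U : set reals) : open U -> ~ meager_set (S `&` U) ->
  exists I, everywhere_nonmeager S I /\ ritv I `<=` U.
Proof.
move=> oU nm; apply: contrapT => /forallNP h; apply: nm.
have {}h (I : rat * rat) : I.1 < I.2 -> ritv I `<=` U ->
    exists J : rat * rat, [/\ J.1 < J.2, ritv J `<=` ritv I & meager_set (S `&` ritv J)].
  move=> lt IU; apply: contrapT => /forallNP h'; apply: (h I); split=> //; split=> // J ltJ JI mJ.
  exact: (h' J).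
pose small (I : rat * rat) := I.1 < I.2 /\ meager_set (S `&` ritv I).
pose W := \bigcup_I (if `[< small I >] then S `&` ritv I else set0).
have mW : meager_set W.
  apply: meager_bigcup_count => I; case: asboolP => [[]//|_].
  by exists (fun=> set0); split=> // _; exact: nowhere_dense0.
pose D := [set r | U r /\ forall I, small I -> ~ ritv I r].
have nD : nowhere_dense_set D.
  apply: nowhere_denseI => I lt.
  case: (pselect (exists r, (ritv I `&` D) r)) => [[r [Ir [Ur _]]]|/forallNP n]; last first.
    by exists I; split=> //; rewrite -subset0 => r /n.
  have [J [Jr JIU]] := open_contains_ritv (openI (@open_ritv I) oU) (conj Ir Ur).
  have [|J' [lt' J'J mJ']] := h J (ritv_lt Jr); first by move=> s /JIU[].
  exists J'; split=> // [s /J'J/JIU[]//|].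
  by rewrite -subset0 => s [Js [_ /(_ J' (conj lt' mJ'))]].
apply: sub_meager (meagerU mW (nowhere_dense_meager nD)) => r [Sr Ur].
case: (pselect (D r)) => [|/not_andP[]//]; first by right.
move=> /existsNP[I /not_implyP[sI /contrapT Ir]]; left; exists I => //.
by rewrite asboolT.
Qed.

(** * Category of Souslin sets *)

Section Souslin.
Variables (T : baire -> seq nat -> Prop) (K : seq nat -> set reals).

Definition souslin x : set reals :=
  [set r | exists y, forall n, T x (mkseq y n) /\ K (mkseq y n) r].

Hypothesis bT : forall u, borel_baire (T^~ u).
Hypothesis cK : forall u, closed (K u).

Let part x u : set reals :=
  [set r | exists y, mkseq y (size u) = u /\ forall n, T x (mkseq y n) /\ K (mkseq y n) r].

(* [v (u, I) != 0] means [I `<=` V u], for a scheme of open sets with [V u `<=` K u] in which the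
   union of the [V (rcons u i)] is dense in [V u]; almost every point of [V [::]] then lies
   along a branch. *)
Let scheme x (v : baire) :=
  (exists I : rat * rat, v (pickle ([::] : seq nat, I)) <> 0%N) /\
  forall (u : seq nat) (I : rat * rat), v (pickle (u, I)) <> 0%N ->
    (T x u /\ (I.1 < I.2 /\ ritv I `<=` K u)) /\
    forall J : rat * rat, J.1 < J.2 /\ ritv J `<=` ritv I ->
      exists (i : nat) (I' : rat * rat),
        v (pickle (rcons u i, I')) <> 0%N /\ ritv I' `&` ritv J !=set0.

(** The points of [V u] that are lost on the next level form a nowhere dense set. Hence, off a
    meager set, a point of the initial interval can be followed forever, and a meager Souslin set
    would make that interval meager. *)
Let scheme_nonmeager x v : scheme x v -> ~ meager_set (souslin x).
Proof.
move=> [[I0 vI0] hv] mS.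
pose V (u : seq nat) : set reals := [set r | exists I : rat * rat, v (pickle (u, I)) <> 0%N /\ ritv I r].
pose B (u : seq nat) : set reals := [set r | V u r /\ forall i, ~ V (rcons u i) r].
have mB : meager_set (\bigcup_u B u).
  apply: meager_bigcup_count => u; apply/nowhere_dense_meager/nowhere_denseI => I lt.
  case: (pselect (exists r, (ritv I `&` B u) r)) => [[r [Ir [[I1 [vI1 I1r]] _]]]|/forallNP n];
    last by exists I; split=> //; rewrite -subset0 => r /n.
  have [J [Jr JI]] := open_contains_ritv (openI (@open_ritv I) (@open_ritv I1)) (conj Ir I1r).
  have [_ /(_ J)] := hv u I1 vI1.
  move=> [|i [I' [vI' [s sI'J]]]]; first by split; [exact: ritv_lt Jr|move=> s /JI[]].
  have [J' [J's J'J]] := open_contains_ritv (openI (@open_ritv I') (@open_ritv J)) sI'J.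
  exists J'; split=> [|t /J'J[_ /JI[]]//|]; first exact: ritv_lt J's.
  rewrite -subset0 => t [/J'J[I't _] [_ /(_ i)]]; apply.
  by exists I'.
have lt0 : I0.1 < I0.2 by have [[_ []]] := hv _ _ vI0.
apply: (ritv_not_meager lt0); apply: sub_meager (meagerU mS mB) => r I0r.
apply: contrapT => /not_orP[nS nB]; apply: nS.
have step u : exists i, V u r -> V (rcons u i) r.
  apply: contrapT => /forallNP h; apply: nB; exists u => //; split.
    by have /not_implyP[] := h 0%N.
  by move=> i; have /not_implyP[] := h i.
have /choice[f hf] := step.
pose us := fix us n := if n is n'.+1 then rcons (us n') (f (us n')) else [::].
pose y n := f (us n).
have usE n : us n = mkseq y n by elim: n => // n IH; rewrite mkseq_rcons -IH.
have Vus n : V (us n) r.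
  by elim: n => [|n IH]; [exists I0|apply: hf].
exists y => n; rewrite -usE; have [I [vI Ir]] := Vus n.
by have [[Tu [_ IK]] _] := hv _ _ vI; split=> //; apply: IK.
Qed.

(** The intervals put into [V u] are those on which [part x u] is everywhere nonmeager. Density of
    [part x u] there and closedness of [K u] give the inclusion in [K u]. As [part x u] is the
    countable union of the parts of the successors of [u], one of these is nonmeager in any given
    subinterval. *)
Let nonmeager_scheme x : ~ meager_set (souslin x) -> exists v, scheme x v.
Proof.
move=> nm.
pose v : baire := fun k => if @unpickle (seq nat * (rat * rat))%type k is Some (u, J)
  then `[< everywhere_nonmeager (part x u) J >] : nat else 0%N.
have vP u I : v (pickle (u, I)) <> 0%N <-> everywhere_nonmeager (part x u) I.
  by rewrite /v pickleK; case: asboolP.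
exists v; split=> [|u I /vP[lt nmI]].
  have [||I [nI _]] := @nonmeager_somewhere (part x [::]) setT.
  - exact: openT.
  - rewrite setIT; apply: contra_not nm; apply: sub_meager => r [y hy].
    by exists y.
  - by exists I; apply/vP.
have partT r : part x u r -> T x u /\ K u r.
  by move=> [y [yu /(_ (size u))]]; rewrite yu.
have part_meets J : J.1 < J.2 -> ritv J `<=` ritv I -> exists r, (part x u `&` ritv J) r.
  move=> ltJ JI; apply: contrapT => /forallNP n; apply: (nmI J ltJ JI).
  by exists (fun=> set0); split=> [_|r /n//]; exact: nowhere_dense0.
split.
  split; first by have [r [/partT[]]] := part_meets I lt (@subset_refl _ _).
  split=> // r Ir; apply: (cK (u := u)) => U /nbhs_interior Ur.
  have [J [Jr JUI]] := open_contains_ritv (openI (@open_interior _ U) (@open_ritv I))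
    (conj (nbhs_singleton Ur) Ir).
  have [|s [/partT[_ Ks] Js]] := part_meets J (ritv_lt Jr); first by move=> s /JUI[].
  by exists s; split=> //; apply: interior_subset; have [] := JUI s Js.
move=> J [ltJ JI].
have [i nmi] : exists i, ~ meager_set (part x (rcons u i) `&` ritv J).
  apply: contrapT => /forallNP h; apply: (nmI J ltJ JI).
  have {}h i : meager_set (part x (rcons u i) `&` ritv J) by apply: contrapT; apply: h.
  apply: sub_meager (meager_bigcup h) => r [[y [yu hy]] Jr].
  exists (y (size u)) => //; split=> //; exists y; split=> //.
  by rewrite size_rcons mkseq_rcons yu.
have [I' [nI' I'J]] := nonmeager_somewhere (@open_ritv J) nmi.
exists i, I'; split; first exact/vP.
have [s I's] := ritv0 nI'.1; by exists s; split=> //; apply: I'J.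
Qed.

Lemma sigma11_nonmeager : sigma11 (fun x => ~ meager_set (souslin x)).
Proof.
have : sigma11 (fun x => exists v, scheme x v).
  have bv k : borel_baire (fun v => sndB v k <> 0%N).
    apply: borel_not; exact: (borel_preimage continuous_sndB (clopen_borel (eq_coord_clopen k 0))).
  apply: sigma11_existsB; apply: borel_sigma11; apply: borel_and.
    exact: borel_exists_count.
  apply: borel_forall_count => u; apply: borel_forall_count => I.
  apply: borel_imp => //; apply: borel_and.
    apply: borel_and; last exact: borel_cst.
    exact: (borel_preimage continuous_fstB (bT u)).
  apply: borel_forall_count => ?; apply: borel_imp; first exact: borel_cst.
  do 2 apply: borel_exists_count => ?; apply: borel_and => //; exact: borel_cst.
apply: eq_sigma11 => x; split=> [[v]|]; first exact: scheme_nonmeager.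
exact: nonmeager_scheme.
Qed.

End Souslin.

(** * Lebesgue measure of sections *)

Lemma exists_expn_lt (e : reals) : 0 < e -> exists k, 2 ^- k < e.
Proof.
move=> e0; exists (Num.bound e^-1); rewrite -[ltRHS]invrK ltf_pV2 ?posrE ?invr_gt0 ?exprn_gt0 //.
apply: (lt_trans (archi_boundP _)); first by rewrite invr_ge0 ltW.
by rewrite -natrX ltr_nat ltn_expl.
Qed.

(* [lebesgue_measure] is defined on all sets, as the outer measure. *)
Lemma le_lebesgue_outer (A B : set reals) :
  A `<=` B -> (lebesgue_measure A <= lebesgue_measure B)%E.
Proof. exact: (@le_outer_measure _ _ ((wlength (@idfun reals))^*)%mu). Qed.

(** Each [A n] has a measurable hull of the same outer measure. Intersecting the hulls from [n] on
    gives increasing measurable sets that still contain [A n] and are no larger in measure, and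
    continuity from below applies to these. *)
Lemma lebesgue_outer_continuous (A : nat -> set reals) (c : \bar reals) :
  (forall n, A n `<=` A n.+1) -> (c < lebesgue_measure (\bigcup_n A n))%E ->
  exists n, (c < lebesgue_measure (A n))%E.
Proof.
move=> incA; apply: contraPP => /forallNP h; apply/negP; rewrite -leNgt.
have {}h n : (lebesgue_measure (A n) <= c)%E by rewrite leNgt; apply/negP.
have monoA n k : A n `<=` A (n + k)%N.
  by elim: k => [|k IH]; rewrite ?addn0// addnS; apply: subset_trans IH _.
have /choice[H hH] : forall n, exists H : set (measurableTypeR reals),
    [/\ measurable H, A n `<=` H & lebesgue_measure H = lebesgue_measure (A n)].
  move=> n; have [G [oG AG mG]] := @outer_measure_Gdelta _ (A n).
  exists (\bigcap_i G i); split=> //.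
  by apply: bigcap_measurable => // k _; apply: measurable_realfun.open_measurable.
pose H' n : set (measurableTypeR reals) := \bigcap_k H (n + k)%N.
have mH' n : measurable (H' n).
  by apply: bigcap_measurable => // k _; have [] := hH (n + k)%N.
have AH' : \bigcup_n A n `<=` \bigcup_n H' n.
  move=> r [n _ Ar]; exists n => // k _; have [_ AH _] := hH (n + k)%N.
  exact/AH/monoA.
apply: (le_trans (le_lebesgue_outer AH')).
have cvH : lebesgue_measure (H' n) @[n --> \oo] --> lebesgue_measure (\bigcup_n H' n).
  apply: nondecreasing_cvg_mu => //; first exact: bigcup_measurable.
  move=> n m nm; apply/subsetPset => r Hr k _.
  by have := Hr (m - n + k)%N Logic.I; rewrite addnA subnKC.
rewrite -(cvg_lim _ cvH) //; apply: lime_le; first by apply/cvg_ex; eexists; exact: cvH.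
apply: nearW => n; apply: le_trans (h n).
have [_ _ <-] := hH n; apply: le_lebesgue_outer => r /(_ 0%N Logic.I).
by rewrite addn0.
Qed.

Fixpoint below (v : seq nat) : seq (seq nat) :=
  if v is m :: v' then [seq i :: u | i <- iota 0 m.+1, u <- below v'] else [:: [::]].

Lemma mem_below u v : (u \in below v) = all2 leq u v.
Proof.
elim: v u => [|m v IH] u; first by case: u.
have -> : below (m :: v) = [seq i :: u | i <- iota 0 m.+1, u <- below v] by [].
apply/allpairsP/idP => [[[a b] [ha hb ->]]|].
  by move: ha hb; rewrite mem_iota /= IH ltnS => -> ->.
case: u => [//|i u] /= /andP[im uv].
exists (i, u); split=> //=; last by rewrite IH.
by rewrite -[_ \in _]/(i \in iota 0 m.+1) mem_iota ltnS.
Qed.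

Lemma all2_leq_rcons u v i j : size u = size v ->
  all2 leq (rcons u i) (rcons v j) = all2 leq u v && (i <= j)%N.
Proof. by elim: u v => [|a u IH] [|b v] //= => [_|[/IH ->]]; rewrite ?andbT ?andbA. Qed.

Lemma all2_leq_take k u v : all2 leq u v -> all2 leq (take k u) (take k v).
Proof. by elim: u v k => [|a u IH] [|b v] [|k] //= /andP[-> /IH ->]. Qed.

Section SouslinMeasure.
Variables (T : baire -> seq nat -> Prop) (K : seq nat -> set reals).
Hypothesis bT : forall u, borel_baire (T^~ u).
Hypothesis cK : forall u, closed (K u).
Hypothesis K01 : forall u, K u `<=` `[0, 1].
Hypothesis T_rcons : forall x u i, T x (rcons u i) -> T x u.
Hypothesis K_rcons : forall u i, K (rcons u i) `<=` K u.

(** A finite union of closed sets, hence measurable, which depends on [x] only through the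
    membership of finitely many nodes in [T x]. *)
Let hull x (v : seq nat) : set reals := \bigcup_(u in [set u | u \in below v /\ T x u]) K u.

Let hullE x v : hull x v =
  \big[setU/set0]_(u <- below v) (if `[< T x u >] then K u else set0).
Proof.
rewrite -bigcup_seq; apply/seteqP; split=> [r [u [uv Tu] Ku]|r [u /= uv]].
  by exists u => //; rewrite asboolT.
by case: asboolP => // Tu Ku; exists u.
Qed.

Let measurable_K u : measurable (K u : set (measurableTypeR reals)).
Proof. exact: measurable_realfun.closed_measurable. Qed.

Let measurable_hull x v : measurable (hull x v : set (measurableTypeR reals)).
Proof.
rewrite hullE; apply: bigsetU_measurable => u _.
by case: asboolP => // _; exact: measurable0.
Qed.

Let hull_rcons x v j : hull x (rcons v j) `<=` hull x v.
Proof.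
move=> r [u [+ Tu] Ku]; rewrite mem_below.
case/lastP: u Tu Ku => [|u i] Tu Ku; first by case: v.
move=> h; exists u; last exact: K_rcons Ku.
split; last exact: T_rcons Tu.
have /eqP : size u == size v.
  by move: h; rewrite all2E !size_rcons eqSS => /andP[].
by move=> e; move: h; rewrite all2_leq_rcons // mem_below => /andP[].
Qed.

Let T_cat x u w : T x (u ++ w) -> T x u.
Proof.
elim/last_ind: w => [|w i IH]; first by rewrite cats0.
by rewrite -rcons_cat => /T_rcons.
Qed.

Let K_cat u w : K (u ++ w) `<=` K u.
Proof.
elim/last_ind: w => [|w i IH]; first by rewrite cats0.
by rewrite -rcons_cat; apply: subset_trans IH; apply: K_rcons.
Qed.

(* Konig's lemma: only finitely many [u] of each length are below [b]. *)
Let bigcap_hull x b : \bigcap_n hull x (mkseq b n) `<=` souslin T K x.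
Proof.
move=> r hr.
pose P u := [/\ all2 leq u (mkseq b (size u)), T x u & K u r].
have P_cat u w : P (u ++ w) -> P u.
  move=> [h Tu Ku]; split; [|exact: T_cat Tu|exact: K_cat Ku].
  have := all2_leq_take (size u) h; rewrite take_size_cat // take_mkseq size_cat.
  by rewrite (minn_idPl (leq_addr _ _)).
pose alive u := forall n, exists w, size w = n /\ P (u ++ w).
have step u : exists i, alive u -> alive (rcons u i).
  apply: contrapT => /forallNP nal.
  have al : alive u by have /not_implyP[] := nal 0%N.
  have /choice[m hm] : forall i, exists n, forall w, size w = n -> ~ P (rcons u i ++ w).
    move=> i; have /not_implyP[_ /existsNP[n hn]] := nal i; exists n => w wn Pw.
    by apply: hn; exists w.
  pose N := (\max_(i < (b (size u)).+1) m i)%N.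
  have [[|i w] [] // [wN] Pw] := al N.+1.
  have ib : (i <= b (size u))%N.
    have [/(all2_leq_take (size u).+1) + _ _] := Pw.
    rewrite take_mkseq size_cat -cat_rcons take_size_cat ?size_rcons //.
    rewrite (minn_idPl _) /=; last by rewrite addnS ltnS leq_addr.
    rewrite mkseq_rcons all2_leq_rcons ?size_mkseq // => /andP[] //.
  have mN : (m i <= N)%N.
    exact: (@leq_bigmax_cond _ xpredT (fun i : 'I_(b (size u)).+1 => m i) (Ordinal (ib : (i < _.+1)%N))).
  apply: (hm i (take (m i) w)); first by rewrite size_takel // wN.
  by apply: (P_cat _ (drop (m i) w)); rewrite -catA cat_take_drop cat_rcons.
have /choice[f hf] := step.
pose us := fix us n := if n is n'.+1 then rcons (us n') (f (us n')) else [::].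
pose y n := f (us n).
have usE n : us n = mkseq y n by elim: n => // n IH; rewrite mkseq_rcons -IH.
have al0 : alive [::].
  move=> n; have [u [] ] := hr n Logic.I; rewrite mem_below => h Tu Ku; exists u.
  have un : size u = n by move: h; rewrite all2E size_mkseq => /andP[/eqP].
  by split=> //; split=> //; rewrite un.
have aln n : alive (us n) by elim: n => // n IH; apply: hf.
exists y => n; rewrite -usE; have [w [/size0nil -> ]] := aln n 0%N.
by rewrite cats0 => -[].
Qed.

Let bounded_part x (v : seq nat) : set reals :=
  [set r | exists y, all2 leq (mkseq y (size v)) v /\
     forall n, T x (mkseq y n) /\ K (mkseq y n) r].

Let bounded_part_hull x v : bounded_part x v `<=` hull x v.
Proof.
move=> r [y [yv hy]]; have [Ty Ky] := hy (size v).
by exists (mkseq y (size v)) => //; split=> //; rewrite mem_below.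
Qed.

(** As [j] grows, bounding the next entry by [j] exhausts [bounded_part x v], and outer measure is
    continuous along this increasing union. *)
Let bounded_part_step x v c : (c < lebesgue_measure (bounded_part x v))%E ->
  exists j, (c < lebesgue_measure (bounded_part x (rcons v j)))%E.
Proof.
move=> h; apply: lebesgue_outer_continuous => [j r [y [yv hy]]|].
  exists y; split=> //; move: yv.
  rewrite !size_rcons mkseq_rcons !all2_leq_rcons ?size_mkseq // => /andP[-> yj] /=.
  exact: leqW.
apply: lt_le_trans h _; apply: le_lebesgue_outer => r [y [yv hy]].
exists (y (size v)) => //; exists y; split=> //.
by rewrite size_rcons mkseq_rcons all2_leq_rcons ?size_mkseq // yv leqnn.
Qed.

(** To find [b], the entries are bounded one after the other while the outer measure stays above
    [a + 2 ^- k]. Conversely the hulls decrease to a subset of the Souslin set, of measure at least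
    [a + 2 ^- k]. The margin is fixed in advance because a strict inequality need not survive the
    limit. *)
Let measure_gtP x (a : reals) : (a%:E < lebesgue_measure (souslin T K x))%E <->
  exists b k, forall n, ((a + 2 ^- k)%:E < lebesgue_measure (hull x (mkseq b n)))%E.
Proof.
split=> [h|[b [k hb]]].
  have [k hk] : exists k, ((a + 2 ^- k)%:E < lebesgue_measure (souslin T K x))%E.
    have le1 : (lebesgue_measure (souslin T K x) <= 1%:E)%E.
      have -> : 1%:E = lebesgue_measure (`[0, 1]%classic : set reals).
        by rewrite lebesgue_measure_itv /= lte_fin ltr01 sube0.
      apply: le_lebesgue_outer => r [y /(_ 0%N)[_ /K01]] //.
    case: (lebesgue_measure _) le1 h => [l| |]//= _; rewrite lte_fin => al.
    have [k hk] : exists k, 2 ^- k < l - a.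
      by apply: exists_expn_lt; rewrite subr_gt0.
    by exists k; rewrite lte_fin; lra.
  have /choice[f hf] : forall v, exists j,
      ((a + 2 ^- k)%:E < lebesgue_measure (bounded_part x v))%E ->
      ((a + 2 ^- k)%:E < lebesgue_measure (bounded_part x (rcons v j)))%E.
    move=> v; case: (pselect ((a + 2 ^- k)%:E < lebesgue_measure (bounded_part x v))%E) => [hv|n].
      by have [j hj] := bounded_part_step hv; exists j.
    by exists 0%N.
  pose vs := fix vs n := if n is n'.+1 then rcons (vs n') (f (vs n')) else [::].
  pose b n := f (vs n).
  have vsE n : vs n = mkseq b n by elim: n => // n IH; rewrite mkseq_rcons -IH.
  exists b, k => n; rewrite -vsE.
  apply: lt_le_trans (le_lebesgue_outer (@bounded_part_hull x (vs n))).
  elim: n => [|n IH]; last exact: hf.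
  apply: lt_le_trans hk _; apply: le_lebesgue_outer => r [y hy]; by exists y.
have hmono : {homo (fun n => hull x (mkseq b n)) : n m / (n <= m)%N >-> (m <= n)%O}.
  move=> n m /subnKC <-; apply/subsetPset; elim: (m - n)%N => [|j IH]; first by rewrite addn0.
  by rewrite addnS mkseq_rcons; apply: subset_trans IH; exact: hull_rcons.
have cv : lebesgue_measure (hull x (mkseq b n)) @[n --> \oo] -->
    lebesgue_measure (\bigcap_n hull x (mkseq b n)).
  apply: nonincreasing_cvg_mu => //; last exact: bigcap_measurable.
  apply: (@le_lt_trans _ _ 1%:E); last exact: ltry.
  have -> : 1%:E = lebesgue_measure (`[0, 1]%classic : set reals).
    by rewrite lebesgue_measure_itv /= lte_fin ltr01 sube0.
  by apply: le_lebesgue_outer => r [u _ /K01].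
apply: lt_le_trans (le_lebesgue_outer (@bigcap_hull x b)).
apply: (@lt_le_trans _ _ (a + 2 ^- k)%:E).
  by rewrite lte_fin ltrDl invr_gt0 exprn_gt0.
rewrite -(cvg_lim _ cv) //; apply: lime_ge; first by apply/cvg_ex; eexists; exact: cv.
by apply: nearW => n; apply/ltW.
Qed.

Lemma sigma11_lebesgue_gt (a : reals) :
  sigma11 (fun x => (a%:E < lebesgue_measure (souslin T K x))%E).
Proof.
(* A finite list [P] of nodes replaces the hull: the measure inequality then no longer mentions [x],
   and [x] enters only through the membership of the nodes in [T x]. *)
have : sigma11 (fun x => exists b, exists k, forall n, exists P : seq (seq nat),
    (exists v, mkseq b n = v /\ forall u, u \in P -> u \in below v /\ T x u) /\
    ((a + 2 ^- k)%:E < lebesgue_measure (\bigcup_(u in [set` P]) K u))%E).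
  apply: sigma11_existsB; apply: borel_sigma11; apply: borel_exists => k.
  apply: borel_forall => n; apply: borel_exists_count => P.
  apply: borel_and; last exact: borel_cst.
  apply: borel_exists_count => v; apply: borel_and.
    exact: (borel_preimage continuous_sndB (clopen_borel (mkseq_clopen n v))).
  apply: borel_forall_count => u; apply: borel_imp; first exact: borel_cst.
  apply: borel_and; first exact: borel_cst.
  exact: (borel_preimage continuous_fstB (bT u)).
apply: eq_sigma11 => x; rewrite measure_gtP; split=> -[b [k hb]]; exists b, k => n.
  have [P [[v [<- PT]] /lt_le_trans]] := hb n; apply; apply: le_lebesgue_outer.
  by move=> r [u /PT uT Ku]; exists u.
exists [seq u <- below (mkseq b n) | `[< T x u >]]; split.
  exists (mkseq b n); split=> // u; rewrite mem_filter => /andP[/asboolP Tu ub]; by split.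
apply: lt_le_trans (hb n) _; apply: le_lebesgue_outer => r [u [ub Tu] Ku].
by exists u => //=; rewrite mem_filter ub asboolT.
Qed.

End SouslinMeasure.

(** * The coin-tossing measure *)

Lemma cylP s (z : cantor_space) : cyl s z <-> Defs.prefix z (size s) = s.
Proof.
split=> [h|<- i]; last by rewrite size_mkseq => lt; rewrite nth_mkseq.
apply: (@eq_from_nth _ false); rewrite size_mkseq // => i lt.
by rewrite nth_mkseq // h.
Qed.

Lemma cyl_prefix (z : cantor_space) n : cyl (Defs.prefix z n) z.
Proof. by move=> i; rewrite size_mkseq => lt; rewrite nth_mkseq. Qed.

Lemma prefix_eq (z z' : cantor_space) n :
  Defs.prefix z n = Defs.prefix z' n <-> forall i, (i < n)%N -> z i = z' i.
Proof.
split=> [h i lt|h]; last by apply/eq_in_map => i; rewrite mem_iota => /h.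
by have := congr1 (nth false ^~ i) h; rewrite /= !nth_mkseq.
Qed.

Lemma size_prefix (z : cantor_space) n : size (Defs.prefix z n) = n.
Proof. exact: size_mkseq. Qed.

Lemma prefixS (z : cantor_space) n : Defs.prefix z n.+1 = rcons (Defs.prefix z n) (z n).
Proof. by rewrite /Defs.prefix /mkseq -addn1 iotaD map_cat cats1. Qed.

Lemma open_cylP (U : set cantor_space) : open U <->
  forall z, U z -> exists n, cyl (Defs.prefix z n) `<=` U.
Proof.
split=> [oU z Uz|h].
  apply: contrapT => /forallNP h.
  have /choice[f hf] : forall n, exists z' : cantor_space, cyl (Defs.prefix z n) z' /\ ~ U z'.
    move=> n; apply: contrapT => /forallNP h'; apply: (h n) => z' cz'.
    by apply: contrapT => nU; apply: (h' z').
  have fz : f @ \oo --> z.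
    apply/(@pointwise_cvgP nat bool (f @ \oo) z) => i.
    apply: cvg_near_cst; exists i.+1 => // n /= ni.
    have [/(_ i)] := hf n; rewrite size_mkseq => /(_ ni) -> _.
    by rewrite nth_mkseq.
  have [N _ /(_ N (leqnn N))] : \forall n \near \oo, U (f n).
    by apply: fz; apply: open_nbhs_nbhs.
  by have [] := hf N.
rewrite openE => z /h[n hn]; apply: filterS hn _.
elim: n => [|n IH].
  by apply: filterS filterT => z' _ i; rewrite size_prefix.
have nb : nbhs z [set z' : cantor_space | z' n = z n].
  apply: (@proj_continuous nat (fun=> bool) n z [set z n]).
  by rewrite nbhs_principalE.
apply: filterS (filterI IH nb) => z' [h1 h2] i; rewrite size_prefix ltnS leq_eqVlt.
case/predU1P => [->|lt]; first by rewrite nth_mkseq.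
by rewrite h1 ?size_prefix // !nth_mkseq // ltnW.
Qed.

Lemma open_cyl s : open (cyl s).
Proof.
apply/open_cylP => z /cylP sz; exists (size s) => z'; by rewrite sz.
Qed.

Lemma sum_geometric (m N : nat) :
  \sum_(k < N) 2 ^- (m + k).+1 = 2 ^- m - 2 ^- (m + N) :> reals.
Proof.
elim: N => [|N IH]; first by rewrite big_ord0 addn0 subrr.
rewrite big_ord_recr /= IH addnS exprS invfM; lra.
Qed.

Lemma sum_geometric_le (m N : nat) : \sum_(k < N) 2 ^- (m + k).+1 <= 2 ^- m :> reals.
Proof. by rewrite sum_geometric gerBl invr_ge0 exprn_ge0. Qed.

Local Definition cost (s : nat -> seq bool) : \bar reals :=
  (\sum_(0 <= k <oo) ((2 ^- size (s k) : reals)%:E))%E.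

Local Lemma cost_ge (s : nat -> seq bool) N : ((\sum_(k < N) (2 ^- size (s k)))%:E <= cost s)%E.
Proof.
rewrite -sumEFin -(big_mkord xpredT (fun k => (2 ^- size (s k))%:E)).
by apply: nneseries_lim_ge => k _ _; rewrite lee_fin invr_ge0 exprn_ge0.
Qed.

Local Lemma cost_le (s : nat -> seq bool) (c : reals) :
  (forall N, \sum_(k < N) (2 ^- size (s k)) <= c) -> (cost s <= c%:E)%E.
Proof.
move=> h; apply: lime_le.
  by apply: is_cvg_nneseries => k _ _; rewrite lee_fin invr_ge0 exprn_ge0.
by apply: nearW => N; rewrite big_mkord sumEFin lee_fin.
Qed.

Local Lemma inf_fin A : exists r : reals, 0 <= r /\
  ereal_inf [set cost s | s in [set s | A `<=` \bigcup_k cyl (s k)]] = r%:E.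
Proof.
set e := ereal_inf _.
have e0 : (0%:E <= e)%E.
  apply: le_ereal_inf_tmp => _ [s _ <-]; apply: le_trans (cost_ge s 0).
  by rewrite big_ord0.
have : (e <= 2%:E)%E.
  (* Covers are infinite sequences, so the whole space, given by the empty word at [k = 0], is
     padded with cylinders of measure 2^-k; the total cost is 2. *)
  apply: ereal_inf_le; exists (cost (fun k => nseq k false)).
    by exists (fun k => nseq k false) => //= z _; exists 0%N.
  apply: cost_le => N; case: N => [|N]; first by rewrite big_ord0.
  rewrite big_ord_recl /= expr0 invr1 -[leRHS]/(1 + 1) lerD2l.
  have := sum_geometric_le 0 N; rewrite expr0 invr1; apply: le_trans.
  by apply: ler_sum => k _; rewrite size_nseq.
case: e e0 => [r| |] //; rewrite lee_fin => r0 _; by exists r.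
Qed.

Lemma mu_ge0 A : 0 <= mu A.
Proof. by rewrite /mu; have [r [r0 ->]] := inf_fin A. Qed.

Lemma mu_ltP (A : set cantor_space) q : mu A < q <-> exists (s : nat -> seq bool) c, [/\ c < q,
  A `<=` \bigcup_k cyl (s k) & forall N, \sum_(k < N) (2 ^- size (s k)) <= c].
Proof.
rewrite /mu; have [r [r0 er]] := inf_fin A; rewrite er /=.
split=> [rq|[s [c [cq As sc]]]].
  have := @ereal_inf_lt _ [set cost s | s in [set s | A `<=` \bigcup_k cyl (s k)]] q%:E.
  rewrite er lte_fin => /(_ rq)[_ [s As <-]] sq.
  have cfin : cost s \is a fin_num.
    rewrite ge0_fin_numE; first exact: lt_trans sq (ltry _).
    by apply: le_trans (cost_ge s 0); rewrite big_ord0.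
  exists s, (fine (cost s)); split=> // [|N]; first by rewrite -lte_fin fineK.
  by rewrite -lee_fin fineK //; exact: cost_ge.
apply: le_lt_trans cq; rewrite -lee_fin -er; apply: ereal_inf_le.
exists (cost s); first by exists s.
exact: cost_le.
Qed.

Lemma le_mu (A B : set cantor_space) : A `<=` B -> mu A <= mu B.
Proof.
move=> AB; rewrite leNgt; apply/negP => /mu_ltP[s [c [cA Bs sc]]].
have : mu A < mu A by apply/mu_ltP; exists s, c; split=> //; apply: subset_trans Bs.
by rewrite ltxx.
Qed.

Lemma mu_le_cyl (A : set cantor_space) s : A `<=` cyl s -> mu A <= 2 ^- size s.
Proof.
move=> As; rewrite leNgt; apply/negP => h.
have [|m hm] := @exists_expn_lt (mu A - 2 ^- size s); first by rewrite subr_gt0.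
have : mu A < mu A.
  apply/mu_ltP; exists (fun k => if k is k'.+1 then nseq (m + k').+1 false else s).
  exists (2 ^- size s + 2 ^- m); split=> [|z /As sz|N]; first by lra.
    by exists 0%N.
  case: N => [|N]; first by rewrite big_ord0 addr_ge0 // invr_ge0 exprn_ge0.
  rewrite big_ord_recl /= lerD2l; apply: le_trans (sum_geometric_le m N).
  by apply: ler_sum => k _; rewrite /= size_nseq.
by rewrite ltxx.
Qed.

Lemma mu_set0 : mu set0 = 0.
Proof.
apply/eqP; rewrite eq_le mu_ge0 andbT leNgt; apply/negP => /exists_expn_lt[n].
by rewrite ltNge (le_trans (@mu_le_cyl set0 (nseq n false) _)) // size_nseq.
Qed.

Local Lemma sum_uniq_sub (I : eqType) (s t : seq I) (F : I -> reals) : (forall i, 0 <= F i) ->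
  uniq s -> {subset s <= t} -> \sum_(i <- s) F i <= \sum_(i <- t) F i.
Proof.
move=> F0 us st.
apply: (@le_trans _ _ (\sum_(i <- undup t) F i)); last first.
  elim: t {st} => //= a t IH; rewrite [leRHS]big_cons; case: ifP => _.
    by apply: le_trans IH _; rewrite lerDr.
  by rewrite big_cons lerD2l.
rewrite [leRHS](bigID (mem s)) /= -[leLHS]addr0 lerD ?sumr_ge0 //.
rewrite -[leRHS]big_filter le_eqVlt; apply/orP; left; apply/eqP; apply: perm_big.
apply: uniq_perm => //; first by rewrite filter_uniq // undup_uniq.
by move=> i; rewrite mem_filter mem_undup; apply/idP/andP => [si|[]//]; split=> //; exact: st.
Qed.

Lemma mu_bigcup_le (A : nat -> set cantor_space) (e : nat -> reals) c :
  (forall k, mu (A k) <= e k) -> (forall N, \sum_(k < N) e k <= c) ->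
  mu (\bigcup_k A k) <= c.
Proof.
move=> Ae ec; rewrite leNgt; apply/negP => h.
have [|m hm] := @exists_expn_lt (mu (\bigcup_k A k) - c); first by rewrite subr_gt0.
have /choice[s /choice[d hs]] : forall k, exists (s : nat -> seq bool) d, [/\ d < e k + 2 ^- (m + k).+1,
    A k `<=` \bigcup_i cyl (s i) & forall N, \sum_(i < N) (2 ^- size (s i)) <= d].
  move=> k; apply/mu_ltP; apply: le_lt_trans (Ae k) _.
  by rewrite ltrDl invr_gt0 exprn_gt0.
have : ([set: nat] #= [set: nat * nat])%card by rewrite card_eq_sym; exact: card_nat2.
move=> /pcard_eqP/bijPex[g [_ gi gs]].
have ginj : injective g by move=> i j; apply: gi; rewrite inE.
suff : mu (\bigcup_k A k) < mu (\bigcup_k A k) by rewrite ltxx.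
apply/mu_ltP; exists (fun n => s (g n).1 (g n).2), (c + 2 ^- m); split=> [|z [k _ Az]|N].
- lra.
- have [_ /(_ z Az)[i _ szi] _] := hs k.
  have [n _ gn] := gs (k, i) Logic.I; exists n => //; by rewrite gn.
(* The first [N] cylinders of the merged cover have their double indices in an [M] by [M] square,
   over which the sum is estimated row by row. *)
have [M gM] : exists M, forall n, (n < N)%N -> ((g n).1 < M)%N /\ ((g n).2 < M)%N.
  exists (\max_(n < N) maxn (g n).1 (g n).2).+1 => n nN.
  have := @leq_bigmax_cond _ xpredT (fun n : 'I_N => maxn (g n).1 (g n).2) (Ordinal nN).
  by rewrite /= geq_max => /(_ isT)/andP[? ?]; split; rewrite ltnS.
pose F (p : nat * nat) : reals := 2 ^- size (s p.1 p.2).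
apply: (@le_trans _ _ (\sum_(p <- [seq (i, j) | i <- iota 0 M, j <- iota 0 M]) F p)).
  rewrite -(big_mkord xpredT (fun n => F (g n))) -(big_map g xpredT F).
  apply: sum_uniq_sub => [p||p].
  - by rewrite invr_ge0 exprn_ge0.
  - by rewrite map_inj_uniq ?iota_uniq.
  - move=> /mapP[n]; rewrite mem_index_iota /= => nN ->.
    have [h1 h2] := gM n nN.
    by rewrite [g n]surjective_pairing; apply: allpairs_f; rewrite mem_iota.
rewrite big_allpairs_dep /=.
apply: (@le_trans _ _ (\sum_(i < M) (e i + 2 ^- (m + i).+1))).
  rewrite -(big_mkord xpredT (fun i => e i + 2 ^- (m + i).+1)) /index_iota subn0.
  apply: ler_sum => i _; have [/ltW di _ hd] := hs i; apply: le_trans di.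
  apply: le_trans (hd M); rewrite -(big_mkord xpredT (fun j => 2 ^- size (s i j))).
  by rewrite /index_iota subn0.
by rewrite big_split lerD ?sum_geometric_le.
Qed.

Lemma le_muU (A B : set cantor_space) : mu (A `|` B) <= mu A + mu B.
Proof.
pose e k := if k is k'.+1 then if k' is _.+1 then 0 else mu B else mu A.
pose C k := if k is k'.+1 then if k' is _.+1 then set0 else B else A.
apply: le_trans (@mu_bigcup_le C e _ _ _).
- by apply: le_mu => z [Az|Bz]; [exists 0%N|exists 1%N].
- by case=> [|[|k]] //=; rewrite mu_set0.
- case=> [|[|N]]; rewrite ?big_ord0 ?addr_ge0 ?mu_ge0 // big_ord_recl /=.
    by rewrite big_ord0 lerD2l mu_ge0.
  by rewrite big_ord_recl /= big1 ?addr0.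
Qed.

Definition symdiff (A B : set cantor_space) := (A `\` B) `|` (B `\` A).

Lemma symdiffC A B : symdiff A B = symdiff B A.
Proof. by rewrite /symdiff setUC. Qed.

Lemma symdiffxx A : symdiff A A = set0.
Proof. by rewrite /symdiff setDv setU0. Qed.

Lemma symdiff_trans A B C : symdiff A C `<=` symdiff A B `|` symdiff B C.
Proof.
move=> z [[Az Cz]|[Cz Az]]; case: (pselect (B z)) => Bz.
- by right; left.
- by left; left.
- by left; right.
- by right; right.
Qed.

Lemma le_mu_symdiff A B C : mu (symdiff A C) <= mu (symdiff A B) + mu (symdiff B C).
Proof. by apply: le_trans (le_muU _ _); apply/le_mu/symdiff_trans. Qed.

Lemma le_mu_cyl_symdiff A B s : mu (B `&` cyl s) <= mu (A `&` cyl s) + mu (symdiff A B).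
Proof.
apply: le_trans (le_muU _ _); apply: le_mu => z [Bz sz].
by case: (pselect (A z)) => Az; [left|right; right].
Qed.

(** * Sets determined by finitely many digits *)

Definition determined n (D : set cantor_space) : Prop :=
  forall z z' : cantor_space, (forall i, (i < n)%N -> z i = z' i) -> D z -> D z'.

Definition consC (b : bool) (z : cantor_space) : cantor_space :=
  fun n => if n is n'.+1 then z n' else b.

(* The coin-tossing measure of a set determined by the first [n] digits. *)
Fixpoint level_measure n (D : set cantor_space) : reals :=
  if n is n'.+1 then
    (level_measure n' [set z | D (consC false z)] + level_measure n' [set z | D (consC true z)]) / 2
  else if `[< exists z, D z >] then 1 else 0.

Lemma determined_consC n D b : determined n.+1 D -> determined n [set z | D (consC b z)].
Proof. by move=> dD z z' zz'; apply: dD => -[|i] //=; exact: zz'. Qed.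

Lemma determinedW n m D : (n <= m)%N -> determined n D -> determined m D.
Proof. by move=> nm dD z z' zz'; apply: dD => i lt; apply: zz'; apply: leq_trans nm. Qed.

Lemma level_measure_ge0 n D : 0 <= level_measure n D.
Proof.
elim: n D => [|n IH] D /=; first by case: asboolP.
by rewrite divr_ge0 ?addr_ge0.
Qed.

Lemma level_measure_le1 n D : level_measure n D <= 1.
Proof.
elim: n D => [|n IH] D /=; first by case: asboolP.
by have := IH [set z | D (consC false z)]; have := IH [set z | D (consC true z)]; lra.
Qed.

Lemma level_measureS n D : determined n D -> level_measure n.+1 D = level_measure n D.
Proof.
elim: n D => [|n IH] D dD; last first.
  rewrite -[LHS]/((level_measure n.+1 _ + level_measure n.+1 _) / 2).
  by rewrite (IH _ (@determined_consC _ _ false dD)) (IH _ (@determined_consC _ _ true dD)).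
rewrite /=; have e b : (exists z, D (consC b z)) <-> exists z, D z.
  by split=> -[z Dz]; [exists (consC b z)|exists z; apply: dD Dz].
by rewrite !(asbool_equiv_eq (e _)); case: asboolP => _; lra.
Qed.

Lemma level_measureW n m D : (n <= m)%N -> determined n D ->
  level_measure m D = level_measure n D.
Proof.
move=> /subnKC <- dD; elim: (m - n)%N => [|k IH]; first by rewrite addn0.
by rewrite addnS level_measureS //; apply: determinedW dD; apply: leq_addr.
Qed.

(** Subadditivity of an outer measure gives no bound on a sum over disjoint sets. The explicit level
    measure does, and this keeps the total mass of the disjoint pieces in [approximable_bigcup] at
    most 1. *)
Lemma level_measureU n D E : determined n D -> determined n E -> D `&` E = set0 ->
  level_measure n D + level_measure n E <= level_measure n (D `|` E).
Proof.
elim: n D E => [|n IH] D E dD dE DE /=.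
  case: asboolP => [[z Dz]|nD]; case: asboolP => [[z' Ez']|nE].
  - by have : (D `&` E) z; [split=> //; apply: dE Ez'|rewrite DE].
  - by rewrite asboolT ?addr0 //; exists z; left.
  - by rewrite asboolT ?add0r //; exists z'; right.
  - by rewrite asboolF ?add0r // => -[z [Dz|Ez]]; [apply: nD|apply: nE]; exists z.
have h b := IH _ _ (@determined_consC _ _ b dD) (@determined_consC _ _ b dE).
have DEb b : [set z | D (consC b z)] `&` [set z | E (consC b z)] = set0.
  by rewrite -subset0 => z [Dz Ez]; have : (D `&` E) (consC b z) by []; rewrite DE.
have := h true (DEb true); have := h false (DEb false).
rewrite /setU /=; lra.
Qed.

Local Lemma mu_level_cyl n s D : determined n D ->
  mu [set z | cyl s z /\ D (fun i => z (size s + i)%N)] <= 2 ^- size s * level_measure n D.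
Proof.
elim: n s D => [|n IH] s D dD /=.
  case: asboolP => [_|nD]; first by rewrite mulr1; apply: mu_le_cyl => z [].
  rewrite mulr0 (_ : [set z | _] = set0) ?mu_set0 // -subset0 => z [_ Dz].
  by apply: nD; exists (fun i => z (size s + i)%N).
have := IH (rcons s false) _ (@determined_consC _ _ false dD).
have := IH (rcons s true) _ (@determined_consC _ _ true dD).
rewrite !size_rcons exprS invfM => h1 h0.
set L0 := level_measure n [set z | D (consC false z)] in h0 *.
set L1 := level_measure n [set z | D (consC true z)] in h1 *.
have -> : 2 ^- size s * ((L0 + L1) / 2) =
  2^-1 * 2 ^- size s * L0 + 2^-1 * 2 ^- size s * L1 :> reals by lra.
apply: le_trans (lerD h0 h1); apply: le_trans (le_muU _ _).
apply: le_mu => z [/cylP sz Dz].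
have cz : cyl (rcons s (z (size s))) z.
  by apply/cylP; rewrite size_rcons prefixS sz.
have Dz' : D (consC (z (size s)) (fun i => z ((size s).+1 + i)%N)).
  by apply: dD Dz => -[|i] _ /=; rewrite ?addn0 // addnS.
by case: (z (size s)) cz Dz' => cz Dz'; [right|left]; split.
Qed.

Lemma mu_le_level n D : determined n D -> mu D <= level_measure n D.
Proof.
move=> dD; have := @mu_level_cyl n [::] D dD; rewrite expr0 invr1 mul1r => h.
by apply: le_trans h; apply: le_mu.
Qed.

(** * MALG and K as images of Baire space *)

Lemma nonneg_series_tail (w : nat -> reals) c e : (forall k, 0 <= w k) ->
  (forall N, \sum_(k < N) w k <= c) -> 0 < e ->
  exists N, forall M, \sum_(k < M) w (N + k)%N <= e.
Proof.
move=> w0 wc e0; pose S := [set \sum_(k < N) w k | N in [set: nat]].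
have hS : has_sup S.
  by split; [exists (\sum_(k < 0) w k), 0%N|exists c => _ [N _ <-]].
have [_ [N _ <-] hN] := sup_adherent e0 hS; exists N => M.
have : \sum_(k < N + M) w k <= sup S by apply: ub_le_sup; [case: hS|exists (N + M)%N].
by rewrite big_split_ord /=; lra.
Qed.

Definition approximable (A : set cantor_space) : Prop :=
  forall e : reals, 0 < e -> exists n D, determined n D /\ mu (symdiff A D) < e.

Lemma determined_approximable n D : determined n D -> approximable D.
Proof. by move=> dD e e0; exists n, D; rewrite symdiffxx mu_set0. Qed.

Lemma approximableC A : approximable A -> approximable (~` A).
Proof.
move=> hA e /hA[n [D [dD h]]]; exists n, (~` D); split.
  by move=> z z' zz' nD Dz'; apply: nD; apply: dD Dz' => i lt; rewrite zz'.
suff -> : symdiff (~` A) (~` D) = symdiff A D by [].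
by rewrite /symdiff setUC; congr (_ `|` _); apply/seteqP; split=> z [a b]; split=> //; apply: contrapT.
Qed.

(** The errors between [A k] and [D k] add up to at most e/2. The disjoint pieces [F k] have level
    measures of sum at most 1, so cutting the union of the [D k] at a suitable [N] costs a tail of
    at most e/4. *)
Lemma approximable_bigcup (A : nat -> set cantor_space) :
  (forall k, approximable (A k)) -> approximable (\bigcup_k A k).
Proof.
move=> hA e e0.
have /choice[n /choice[D hD]] : forall k, exists n D,
    determined n D /\ mu (symdiff (A k) D) < e / 2 * 2 ^- k.+1.
  by move=> k; apply: hA; rewrite mulr_gt0 ?invr_gt0 ?exprn_gt0 // divr_gt0.
(* A level, nondecreasing in [k], at which [D 0], ..., [D k] are all determined. *)
pose n' k := (\max_(j < k.+1) n j)%N.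
pose F k := D k `\` \bigcup_(j in `I_k) D j.
have n_le j k : (j <= k)%N -> (n j <= n' k)%N.
  move=> jk; exact: (@leq_bigmax_cond _ xpredT (fun j : 'I_k.+1 => n j) (Ordinal (jk : (j < k.+1)%N))).
have dDk j k : (j <= k)%N -> determined (n' k) (D j).
  by move=> jk; apply: determinedW (n_le _ _ jk) _; have [] := hD j.
have dF k : determined (n' k) (F k).
  move=> z z' zz' [Dz nz]; split; first exact: dDk (leqnn k) _ _ zz' Dz.
  move=> [j jk Djz']; apply: nz; exists j => //.
  by apply: dDk (ltnW jk) _ _ _ Djz' => i lt; rewrite zz'.
have n'W j k : (j <= k)%N -> (n' j <= n' k)%N.
  move=> jk; apply/bigmax_leqP => i _; apply: n_le; apply: leq_trans jk; rewrite -ltnS; exact: ltn_ord.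
pose w k := level_measure (n' k) (F k).
have dE N : determined (n' N) (\bigcup_(j in `I_N) D j).
  by move=> z z' zz' [j jN Dz]; exists j => //; exact: dDk (ltnW jN) _ _ zz' Dz.
have sumw N : \sum_(k < N) w k <= level_measure (n' N) (\bigcup_(j in `I_N) D j).
  elim: N => [|N IH]; first by rewrite big_ord0 level_measure_ge0.
  rewrite big_ord_recr /=; set E := \bigcup_(j in `I_N) D j in IH.
  have dEN : determined (n' N.+1) E by apply: determinedW (n'W _ _ (leqnSn N)) (dE N).
  have dFN : determined (n' N.+1) (F N) by apply: determinedW (n'W _ _ (leqnSn N)) (dF N).
  rewrite /w -(level_measureW (n'W _ _ (leqnSn N)) (dF N)).
  apply: (@le_trans _ _ (level_measure (n' N.+1) E + level_measure (n' N.+1) (F N))).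
    by rewrite lerD2r (level_measureW (n'W _ _ (leqnSn N)) (dE N)).
  apply: le_trans (level_measureU dEN dFN _) _; first by rewrite -subset0 => z [Ez [_]].
  rewrite le_eqVlt; apply/orP; left; apply/eqP; congr level_measure.
  apply/seteqP; split=> [z [[j jN Dz]|[Dz _]]|z [j]].
  - by exists j => //=; rewrite ltnW.
  - by exists N => /=.
  - rewrite /= ltnS leq_eqVlt => /predU1P[->|jN] Dz; last by left; exists j.
    by case: (pselect (E z)) => Ez; [left|right].
have [N hN] : exists N, forall M, \sum_(k < M) w (N + k)%N <= e / 4.
  apply: (@nonneg_series_tail _ 1); last by rewrite divr_gt0.
    by move=> k; apply: level_measure_ge0.
  by move=> N; apply: le_trans (sumw N) (level_measure_le1 _ _).
exists (n' N), (\bigcup_(j in `I_N) D j); split=> //.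
apply: (@le_lt_trans _ _ (e / 2 + e / 4)); last by lra.
apply: (@le_trans _ _ (mu (\bigcup_k symdiff (A k) (D k)) + mu (\bigcup_k F (N + k)%N))).
  apply: le_trans (le_muU _ _); apply: le_mu => z [[[k _ Az] nE]|[[k kN Dz] nA]]; last first.
    by left; exists k => //; right; split=> // Az; apply: nA; exists k.
  case: (pselect (D k z)) => [Dz|nD]; last by left; exists k => //; left.
  right; have ex : exists j, `[< D j z >] by exists k; apply/asboolP.
  case: (ex_minnP ex) => j /asboolP Dj minj.
  have Nj : (N <= j)%N by rewrite leqNgt; apply/negP => jN; apply: nE; exists j.
  exists (j - N)%N => //; rewrite subnKC //; split=> // -[i /= ij Di].
  by have := minj i (asboolT Di); rewrite leqNgt ij.
apply: lerD.
  apply: (@mu_bigcup_le _ (fun k => e / 2 * 2 ^- k.+1)) => [k|M]; first by have [_ /ltW] := hD k.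
  rewrite -mulr_sumr -[leRHS]mulr1 ler_wpM2l ?divr_ge0 ?(ltW e0) //.
  by apply: le_trans (sum_geometric_le 0 M) _; rewrite expr0 invr1.
apply: (@mu_bigcup_le _ (fun k => w (N + k)%N)) => // k; exact: mu_le_level.
Qed.

Lemma determined_cyl s : determined (size s) (cyl s).
Proof. by move=> z z' zz' sz i lt; rewrite -zz' // sz. Qed.

Lemma borel_approximable A : Defs.borel A -> approximable A.
Proof.
suff : <<s @open cantor_space >> `<=` approximable by apply.
apply: smallest_sub => [|U /open_cylP oU].
  split; first exact: (@determined_approximable 0).
    by move=> B hB; rewrite setTD; apply: approximableC.
  exact: approximable_bigcup.
have -> : U = \bigcup_n (if @unpickle (seq bool) n is Some s then
    if `[< cyl s `<=` U >] then cyl s else set0 else set0).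
  apply/seteqP; split=> [z Uz|z [n _]].
    have [n hn] := oU z Uz; exists (pickle (Defs.prefix z n)) => //.
    by rewrite pickleK asboolT //; apply: cyl_prefix.
  by case: (unpickle n) => // s; case: asboolP => // sU sz; apply: sU.
apply: approximable_bigcup => n.
have ap0 : approximable set0 by exact: (@determined_approximable 0).
case: asboolP => _; last exact: ap0.
exact: determined_approximable (@determined_cyl _).
Qed.

Definition clopen_code (c : nat) : set cantor_space :=
  let p := odflt (0%N, [::]) (unpickle c : option (nat * seq (seq bool))) in
  [set z | Defs.prefix z p.1 \in p.2].

Lemma borel_clopen_code c : Defs.borel (clopen_code c).
Proof.
apply: sub_sigma_algebra; rewrite /clopen_code; move: (odflt _ _) => [n B] /=.
apply/open_cylP => z zB; exists n => z' /cylP; rewrite size_prefix => e.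
by rewrite /= e.
Qed.

Lemma clopen_codeP n D : determined n D -> exists c, clopen_code c = D.
Proof.
move=> dD; pose B := [seq tval t |
  t <- [seq t <- enum {: n.-tuple bool} | `[< exists z, D z /\ Defs.prefix z n = tval t >]]].
exists (pickle (n, B)); rewrite /clopen_code pickleK /=; apply/seteqP; split=> z /=.
  move=> /mapP[t]; rewrite mem_filter => /andP[/asboolP[z' [Dz' z't]] _] zt.
  by apply: dD Dz'; apply/prefix_eq; rewrite z't zt.
move=> Dz; apply/mapP; have st : size (Defs.prefix z n) == n by rewrite size_prefix.
exists (Tuple st) => //; rewrite mem_filter mem_enum andbT; apply/asboolP.
by exists z.
Qed.

Lemma parametrizes_closed (X : space) (C : baire -> Prop) (f : baire -> pt X) x0 :
  closed_baire C -> C x0 ->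
  (forall x n, C x -> exists m, forall y, C y -> agree m x y -> near n (f x) (f y)) ->
  (forall a, exists x, C x /\ eqv (f x) a) -> exists g, @parametrizes X g.
Proof.
move=> cC Cx0 cf sf; have [r [cr Cr rC]] := closed_retract cC Cx0.
exists (f \o r); split=> [x n|a].
  have [m hm] := cf (r x) n (Cr x); have [k hk] := cr x m.
  by exists k => y /hk/hm; apply.
by have [x [Cx xa]] := sf a; exists x; rewrite /= rC.
Qed.

(** The upper limit is a Borel set for every code, convergent or not; for fast codes it represents
    the limit in the measure algebra. *)
Local Definition limsup_code (x : baire) : set cantor_space :=
  \bigcap_n \bigcup_k clopen_code (x (n + k)%N).

Local Lemma borel_limsup x : Defs.borel (limsup_code x).
Proof.
rewrite /limsup_code -[\bigcap_n _]setCK setC_bigcap; apply: sigma_algebraC.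
apply: sigma_algebra_bigcup => n; apply: sigma_algebraC.
apply: sigma_algebra_bigcup => k; exact: borel_clopen_code.
Qed.

Local Definition fast (x : baire) : Prop :=
  forall k, mu (symdiff (clopen_code (x k)) (clopen_code (x k.+1))) <= 2 ^- k.

(** A point on which set number [k] and the upper limit disagree must change sides between two
    consecutive sets from [k] on, and these symmetric differences have measures 2^-k, 2^-(k+1), and
    so on. *)
Local Lemma fast_limsup x k : fast x ->
  mu (symdiff (clopen_code (x k)) (limsup_code x)) <= 2 * 2 ^- k.
Proof.
move=> fx; pose C j := clopen_code (x j).
have step z j i : C j z <> C (j + i)%N z ->
    exists l, symdiff (C (j + l)%N) (C (j + l).+1) z.
  move=> ne; apply: contrapT => /forallNP h; apply: ne.
  elim: i => [|i ->]; first by rewrite addn0.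
  have := h i; rewrite addnS => nsym; apply/propext; split=> hz.
    by apply: contrapT => nz; apply: nsym; left.
  by apply: contrapT => nz; apply: nsym; right.
apply: (@le_trans _ _ (mu (\bigcup_l symdiff (C (k + l)%N) (C (k + l).+1)))).
  apply: le_mu => z [[Cz nL]|[Lz nC]].
    have /existsNP[n /not_implyP[_ nn]] := nL.
    have [|l hl] := @step z k n; last by exists l.
    move=> e; apply: nn; exists k => //; rewrite addnC -/(C _) -e //.
  have [i _ Ci] := Lz k Logic.I.
  have [|l hl] := @step z k i; last by exists l.
  by move=> e; apply: nC; rewrite -/(C k) e.
apply: (@mu_bigcup_le _ (fun l => 2 * 2 ^- (k + l).+1)) => [l|N].
  by rewrite exprS invfM mulrA divff // mul1r; apply: fx.
by rewrite -mulr_sumr ler_wpM2l // sum_geometric_le.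
Qed.

Lemma MALG_parametrized : exists f, @parametrizes MALG f.
Proof.
apply: (@parametrizes_closed MALG fast (fun x => exist _ (limsup_code x) (borel_limsup x)) (fun=> 0%N)).
- apply: closed_forall => k.
  have [_] : clopen_baire (fun x => mu (symdiff (clopen_code (x k)) (clopen_code (x k.+1))) <= 2 ^- k).
    by apply: (@uniform_clopen _ k.+2) => x y xy; rewrite !xy.
  exact.
- by move=> k; rewrite symdiffxx mu_set0 invr_ge0 exprn_ge0.
(* Agreement below [n + 4] gives a common clopen set number [n + 3]. Both limits are within 2 *
   2^-(n+3) of it, hence within 2^-(n+1) of each other. *)
- move=> x n fx; exists n.+4 => y fy xy; rewrite /near /= -/(symdiff _ _).
  apply: le_lt_trans (le_mu_symdiff _ (clopen_code (x n.+3)) _) _.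
  rewrite symdiffC; have h1 := @fast_limsup x n.+3 fx.
  have h2 := @fast_limsup y n.+3 fy; rewrite xy // in h2.
  apply: le_lt_trans (lerD h1 h2) _; rewrite !exprS !invfM.
  have : 0 < 2 ^- n :> reals by rewrite invr_gt0 exprn_gt0.
  by lra.
- move=> [A bA].
  (* Error 2^-(k+1) makes consecutive sets differ by at most 3/4 of 2^-k, so the code is fast. *)
  have /choice[c hc] : forall k : nat, exists c, mu (symdiff A (clopen_code c)) < 2 ^- k.+1.
    move=> k; have [|n [D [dD hD]]] := borel_approximable bA (e := 2 ^- k.+1).
      by rewrite invr_gt0 exprn_gt0.
    by have [c cD] := clopen_codeP dD; exists c; rewrite cD.
  have fc : fast c.
    move=> k; apply: le_trans (le_mu_symdiff _ A _) _; rewrite (symdiffC _ A).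
    have := hc k; have := hc k.+1; rewrite !exprS !invfM.
    have : 0 < 2 ^- k :> reals by rewrite invr_gt0 exprn_gt0.
    by lra.
  exists c; split=> // n; rewrite /near /= -/(symdiff _ _).
  apply: le_lt_trans (le_mu_symdiff _ (clopen_code (c n.+2)) _) _.
  rewrite symdiffC (symdiffC _ A); have := @fast_limsup c n.+2 fc; have := hc n.+2.
  rewrite !exprS !invfM.
  have : 0 < 2 ^- n :> reals by rewrite invr_gt0 exprn_gt0.
  by lra.
Qed.

(* Compact sets correspond to pruned binary trees. *)
Local Definition pruned (x : baire) : Prop := forall s : seq bool,
  x (pickle s) = 0%N <-> exists b, x (pickle (rcons s b)) = 0%N.

(** The value 0 marks the nodes of the tree. The empty tree is pruned as well and codes the empty
    compact set. *)
Local Definition branches (x : baire) : set cantor_space :=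
  [set z | forall n, x (pickle (Defs.prefix z n)) = 0%N].

Local Lemma branches_compact x : compact (branches x).
Proof.
apply: (@subclosed_compact _ _ [set: cantor_space]) => //; last exact: cantor_space_compact.
rewrite -[branches x]setCK; apply: open_closedC; apply/open_cylP => z /existsNP[n nz].
exists n => z' /cylP; rewrite size_prefix => e /(_ n).
by rewrite e.
Qed.

Local Lemma take_prefix (z : cantor_space) k n : (k <= n)%N -> take k (Defs.prefix z n) = Defs.prefix z k.
Proof. by move=> kn; rewrite /Defs.prefix /mkseq -map_take take_iota (minn_idPl kn). Qed.

Local Lemma branches_meet x s : pruned x ->
  (exists z, branches x z /\ cyl s z) <-> x (pickle s) = 0%N.
Proof.
move=> px; split=> [[z [bz /cylP <-]]//|xs].
have x_take n : x (pickle (take n s)) = 0%N.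
  have : forall k, x (pickle (take (size s - k)%N s)) = 0%N.
    elim=> [|k IH]; first by rewrite subn0 take_size.
    have [ks|sk] := ltnP k (size s); last by rewrite (eqP (leqW sk)); rewrite (eqP sk) in IH.
    apply/px; exists (nth false s (size s - k.+1)).
    rewrite -take_nth; last by rewrite -subSn // subSS leq_subr.
    by rewrite -subSn // subSS.
  move=> h; have [ns|/ltnW sn] := leqP n (size s); last by rewrite take_oversize.
  by rewrite -(subKn ns).
have /choice[f hf] : forall t : seq bool, exists b,
    x (pickle t) = 0%N -> x (pickle (rcons t b)) = 0%N.
  move=> t; case: (pselect (x (pickle t) = 0%N)) => [/px[b hb]|]; first by exists b.
  by exists false.
pose us := fix us n := if n is n'.+1 then rcons (us n') (f (us n')) else s.
have xus n : x (pickle (us n)) = 0%N by elim: n => // n IH; apply: hf.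
have sus n : size (us n) = (size s + n)%N.
  by elim: n => [|n IH]; rewrite ?addn0 //= size_rcons IH addnS.
pose z : cantor_space := fun i => nth false (us i.+1) i.
have zus n : Defs.prefix z (size s + n) = us n.
  have nth_us m k i : (i < size s + m)%N -> nth false (us (m + k)%N) i = nth false (us m) i.
    move=> lt; elim: k => [|k IH]; first by rewrite addn0.
    by rewrite addnS /= nth_rcons sus addnA ltn_addr.
  apply: (@eq_from_nth _ false); rewrite size_prefix ?sus // => i lt.
  rewrite nth_mkseq // /z; have [ni|i_n] := leqP n i.+1.
    by rewrite -(subnKC ni) nth_us.
  by rewrite -(subnKC (ltnW i_n)) nth_us // ltn_addl.
exists z; split; last by apply/cylP; have := zus 0%N; rewrite addn0.
move=> n; have [ns|/ltnW sn] := leqP n (size s).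
  by rewrite -(take_prefix z ns) -[size s]addn0 zus.
by rewrite -(subnKC sn) zus.
Qed.

Lemma Kspace_parametrized : exists f, @parametrizes Kspace f.
Proof.
apply: (@parametrizes_closed Kspace pruned
  (fun x => exist compact (branches x) (@branches_compact x)) (fun=> 0%N)).
- apply: closed_forall => s.
  have [_] : clopen_baire (fun x : baire => x (pickle s) = 0%N <-> exists b, x (pickle (rcons s b)) = 0%N).
    apply: (@uniform_clopen _ (maxn (pickle s) (maxn (pickle (rcons s true)) (pickle (rcons s false)))).+1).
    move=> x y xy.
    rewrite xy ?ltnS ?leq_maxl // => ->; split=> -[b]; exists b.
      by rewrite xy // ltnS !leq_max; case: b {p}; rewrite leqnn ?orbT.
    by rewrite -xy // ltnS !leq_max; case: b {p}; rewrite leqnn ?orbT.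
  exact.
- by move=> s; split=> // _; exists true.
- move=> x n px; exists (\max_(t : n.-tuple bool) (pickle (tval t)).+1)%N => y py xy s sn /=.
  have st : size s == n by rewrite sn.
  rewrite !branches_meet // xy //.
  exact: (@leq_bigmax_cond _ xpredT (fun t : n.-tuple bool => (pickle (tval t)).+1) (Tuple st)).
- move=> [C cC]; pose x : baire := fun k => if @unpickle (seq bool) k is Some s then
    ~~ `[< exists z, C z /\ cyl s z >] : nat else 0%N.
  have xP s : x (pickle s) = 0%N <-> exists z, C z /\ cyl s z.
    by rewrite /x pickleK; case: asboolP.
  have px : pruned x.
    move=> s; rewrite xP; split=> [[z [Cz /cylP sz]]|[b /xP[z [Cz /cylP sz]]]].
      exists (z (size s)); apply/xP; exists z; split=> //; apply/cylP.
      by rewrite size_rcons prefixS sz.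
    exists z; split=> //; apply/cylP; move: sz; rewrite size_rcons prefixS => /rcons_inj[].
    by [].
  exists x; split=> // n s sn /=.
  by rewrite branches_meet // xP.
Qed.

(** * Upper semicontinuity of the measure inside a cylinder *)

Lemma mu_cyl_near_MALG (a : pt MALG) s q : mu (sval a `&` cyl s) < q ->
  exists n, forall b : pt MALG, near n a b -> mu (sval b `&` cyl s) < q.
Proof.
move=> h; have [|n hn] := @exists_expn_lt (q - mu (sval a `&` cyl s)); first by rewrite subr_gt0.
exists n => c; rewrite /near /= -/(symdiff _ _) => ac.
apply: le_lt_trans (le_mu_cyl_symdiff (sval a) _ _) _; lra.
Qed.

(** By compactness, finitely many cylinders of a cheap cover suffice. A compact set with the same
    words on a level beyond the lengths of [s] and of these cylinders is covered, inside [cyl s], by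
    the same cylinders. *)
Lemma mu_cyl_near_Kspace (a : pt Kspace) s q : mu (sval a `&` cyl s) < q ->
  exists n, forall b : pt Kspace, near n a b -> mu (sval b `&` cyl s) < q.
Proof.
move=> /mu_ltP[t [c [cq ct tc]]]; case: a ct => C cC /= ct.
have : compact (C `&` cyl s).
  apply: compact_closedI => //; rewrite -[cyl s]setCK; apply: open_closedC.
  apply/open_cylP => z nz; exists (size s) => z' /cylP; rewrite size_prefix => e.
  by move: nz => /=; rewrite /setC /= !cylP e.
rewrite compact_cover => /(_ nat setT (fun k => cyl (t k)))[k _|z /ct[k _ tz]|D _ ctD].
- exact: open_cyl.
- by exists k.
pose n := (maxn (size s) (\max_(k <- finmap.enum_fset D) size (t k)))%N.
exists n => -[C' cC'] near_n; apply/mu_ltP; exists t, c; split=> //= z [C'z sz].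
have [z' [Cz' /cylP]] : exists z', C z' /\ cyl (Defs.prefix z n) z'.
  apply/(near_n (Defs.prefix z n) (size_prefix _ _)); exists z; split=> //; exact: cyl_prefix.
rewrite size_prefix => /prefix_eq zz'.
have sz' : cyl s z'.
  by move=> i lt; rewrite zz' ?sz // (leq_trans lt) // leq_maxl.
have [k Dk tz'] := ctD z' (conj Cz' sz'); exists k => // i lt; rewrite -zz' ?tz' //.
apply: leq_trans lt _; apply: leq_trans (leq_maxr _ _).
by apply: (@leq_bigmax_seq nat (finmap.enum_fset D) xpredT (fun k => size (t k))) => //; exact: Dk.
Qed.

(** * Codes of density values *)

Lemma exp2N_gt0 n : 0 < 2 ^- n :> reals.
Proof. by rewrite invr_gt0 exprn_gt0. Qed.

Lemma ler_addexp2N (a b c : reals) : 0 <= c -> (forall k, a <= b + c * 2 ^- k) -> a <= b.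
Proof.
move=> c0 h; rewrite leNgt; apply/negP => ba.
have [|k hk] := @exists_expn_lt ((a - b) / (c + 1)); first by rewrite divr_gt0; lra.
have := h k; have := exp2N_gt0 k; move: hk; rewrite ltr_pdivlMr; last by lra.
by lra.
Qed.

Lemma cvg_exp2N (u : nat -> reals) (r : reals) : (u @ \oo --> r) <->
  forall k, exists N, forall n, (N <= n)%N -> `|u n - r| <= 2 ^- k.
Proof.
have cvgP : (u @ \oo --> r) <->
    forall e : reals, 0 < e -> \forall n \near \oo, `|r - u n| <= e.
  exact: (@cvgrPdist_le reals reals^o nat \oo _ u r).
split=> [/(iffLR cvgP) h k|h].
  have [N _ hN] := h _ (exp2N_gt0 k); exists N => n Nn.
  by rewrite distrC; apply: hN.
apply: (iffRL cvgP) => e e0; have [k hk] := exists_expn_lt e0; have [N hN] := h k.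
exists N => // n /= Nn; rewrite distrC; exact: le_trans (hN n Nn) (ltW hk).
Qed.

(** Together with [dyadic_cvg] this expresses convergence by natural numbers only, with no
    quantifier over the limit; it makes the existence of a density Borel and lets a sequence of
    integers code its value. *)
Lemma cvg_dyadic (u : nat -> reals) (r : reals) : 0 <= r -> u @ \oo --> r ->
  forall k, exists N c, forall n, (N <= n)%N -> `|u n - c%:R * 2 ^- k| <= 2 ^- k.
Proof.
move=> r0 /cvg_exp2N h k; have k0 := exp2N_gt0 k.
have r2 : 0 <= r * 2 ^+ k by rewrite mulr_ge0 // exprn_ge0.
pose c := Num.trunc (r * 2 ^+ k).
have [c1 c2] : c%:R * 2 ^- k <= r /\ r < c%:R * 2 ^- k + 2 ^- k.
  have /andP[h1 h2] := truncn_itv r2.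
  have k2 : 0 < 2 ^+ k :> reals by rewrite exprn_gt0.
  split; first by rewrite ler_pdivrMr.
  by rewrite -[X in _ + X]mul1r -mulrDl ltr_pdivlMr // natr1.
(* Rounding down leaves a positive gap between [r] and the upper end of the allowed interval;
   precision 2^-l stays inside it. *)
have [|l hl] := @exists_expn_lt (c%:R * 2 ^- k + 2 ^- k - r); first by rewrite subr_gt0.
have [N hN] := h l; have [M hM] := h k; exists (maxn N M), c => n.
rewrite geq_max => /andP[/hN h1 /hM h2].
by move: h1 h2; rewrite !ler_norml; lra.
Qed.

Lemma dyadic_cvg (u : nat -> reals) (N c : nat -> nat) :
  (forall k n, (N k <= n)%N -> `|u n - (c k)%:R * 2 ^- k| <= 2 ^- k) ->
  exists r : reals, u @ \oo --> r /\ forall k, `|r - (c k)%:R * 2 ^- k| <= 2 ^- k.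
Proof.
move=> h; pose lo k : reals := (c k)%:R * 2 ^- k - 2 ^- k.
have lohi k l : lo k <= (c l)%:R * 2 ^- l + 2 ^- l.
  have := h k (maxn (N k) (N l)) (leq_maxl _ _).
  have := h l (maxn (N k) (N l)) (leq_maxr _ _).
  by rewrite /lo !ler_norml; lra.
pose S := [set lo k | k in [set: nat]].
have S0 : S !=set0 by exists (lo 0%N), 0%N.
have hS : has_sup S by split=> //; exists ((c 0%N)%:R * 2 ^- 0 + 2 ^- 0) => _ [k _ <-].
have hk k : `|sup S - (c k)%:R * 2 ^- k| <= 2 ^- k.
  have h1 : lo k <= sup S by apply: ub_le_sup; [case: hS|exists k].
  have h2 : sup S <= (c k)%:R * 2 ^- k + 2 ^- k by apply: ge_sup => // _ [l _ <-].
  by move: h1 h2; rewrite /lo ler_norml; lra.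
exists (sup S); split=> //; apply/cvg_exp2N => k; exists (N k.+1) => n /h.
by have := hk k.+1; rewrite !exprS !invfM !ler_norml; lra.
Qed.

Definition zof (y : baire) : cantor_space := fun n => y n != 0%N.

Lemma zof_surj z : exists y, zof y = z.
Proof. by exists (fun n => z n : nat); apply/funext => n; rewrite /zof eqb0 negbK. Qed.

Definition density_ratio (A : set cantor_space) (z : cantor_space) (n : nat) : reals :=
  mu (A `&` cyl (Defs.prefix z n)) / 2 ^- n.

Lemma density_ratio_ge0 A z n : 0 <= density_ratio A z n.
Proof. by rewrite /density_ratio divr_ge0 ?mu_ge0 // ltW // exp2N_gt0. Qed.

Lemma density_ratio_le1 A z n : density_ratio A z n <= 1.
Proof.
rewrite /density_ratio ler_pdivrMr ?exp2N_gt0 // mul1r -{2}(size_prefix z n).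
by apply: mu_le_cyl => ? [].
Qed.

Lemma densE A z r : dens A z r = (density_ratio A z @ \oo --> r).
Proof. by []. Qed.

Lemma dens_unique A z r r' : dens A z r -> dens A z r' -> r = r'.
Proof.
move=> /cvg_exp2N h /cvg_exp2N h'.
have d k : `|r - r'| <= 2 * 2 ^- k.
  have [N hN] := h k; have [N' hN'] := h' k.
  have := hN (maxn N N') (leq_maxl _ _); have := hN' (maxn N N') (leq_maxr _ _).
  by rewrite !ler_norml; lra.
apply/eqP; rewrite eq_le; apply/andP; split; apply: (@ler_addexp2N _ _ 2) => // k;
  by have := d k; rewrite ler_norml; lra.
Qed.

Lemma dens01 A z r : dens A z r -> 0 <= r <= 1.
Proof.
move=> h; apply/andP; split.
  by apply: (cvgr_to_ge h); apply: nearW => n; apply: density_ratio_ge0.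
by apply: (cvgr_to_le h); apply: nearW => n; apply: density_ratio_le1.
Qed.

(* A code [y] of a point and of its density: the digits of the point are the [y (2 i)], the
   number [y 1] says that the density lies in [[2^-j, 1 - 2^-j]], and [y (2 k + 3)] gives [N] and
   [c] such that the ratio is within [2^-k] of [c 2^-k] from [N] on. *)
Definition code_digits (u : seq nat) n : seq bool := mkseq (fun i => nth 0%N u i.*2 != 0%N) n.
Definition code_approx (u : seq nat) k : nat * nat :=
  odflt (0%N, 0%N) (unpickle (nth 0%N u k.*2.+3)).

Definition code_tree (A : baire -> set cantor_space) (x : baire) (u : seq nat) : Prop :=
  forall k n, (n.*2 <= size u)%N /\ (k.*2.+3 < size u)%N /\ ((code_approx u k).1 <= n)%N ->
    `|mu (A x `&` cyl (code_digits u n)) / 2 ^- n - (code_approx u k).2%:R * 2 ^- k| <= 2 ^- k.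

(** The values compatible with the finite code [u]. With [inner], the open condition 0 < r < 1
    becomes closed because the code names a compact subinterval. Placing that bound under the
    condition on [k] ensures that entry 1 is consulted only once it belongs to [u]. *)
Definition code_limit (inner : bool) (u : seq nat) : set reals :=
  [set r | 0 <= r <= 1 /\
    forall k, (k.*2.+3 < size u)%N -> `|r - (code_approx u k).2%:R * 2 ^- k| <= 2 ^- k /\
      (inner -> 2 ^- (nth 0%N u 1) <= r <= 1 - 2 ^- (nth 0%N u 1))].

Definition code_point (y : baire) : cantor_space := fun i => y i.*2 != 0%N.
Definition code_dyadic (y : baire) k : nat * nat := odflt (0%N, 0%N) (unpickle (y k.*2.+3)).

Lemma code_digits_mkseq y m n : (n.*2 <= m)%N ->
  code_digits (mkseq y m) n = Defs.prefix (code_point y) n.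
Proof.
move=> nm; apply/eq_in_map => i; rewrite mem_iota => /andP[_ i_n].
rewrite nth_mkseq //; apply: leq_trans nm; by rewrite ltn_double.
Qed.

Lemma code_approx_mkseq y m k : (k.*2.+3 < m)%N -> code_approx (mkseq y m) k = code_dyadic y k.
Proof. by move=> km; rewrite /code_approx nth_mkseq. Qed.

Lemma code_treeP A x y : body (code_tree A x) y <->
  forall k n, ((code_dyadic y k).1 <= n)%N ->
    `|density_ratio (A x) (code_point y) n - (code_dyadic y k).2%:R * 2 ^- k| <= 2 ^- k.
Proof.
split=> [h k n kn|h m k n [nm [km]]].
  have nm : (n.*2 <= maxn n.*2 k.*2.+4)%N by exact: leq_maxl.
  have km : (k.*2.+3 < maxn n.*2 k.*2.+4)%N by exact: leq_maxr.
  have := h (maxn n.*2 k.*2.+4) k n; rewrite size_mkseq code_digits_mkseq // code_approx_mkseq //.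
  exact.
rewrite !size_mkseq in nm km *; rewrite code_approx_mkseq // code_digits_mkseq // => /h.
exact.
Qed.

Lemma code_limitP b y r : (forall n, code_limit b (mkseq y n) r) <->
  0 <= r <= 1 /\ forall k, `|r - (code_dyadic y k).2%:R * 2 ^- k| <= 2 ^- k /\
      (b -> 2 ^- (y 1%N) <= r <= 1 - 2 ^- (y 1%N)).
Proof.
split=> [h|[r01 h] n].
  split=> [|k]; first by have [] := h 0%N.
  have [_ /(_ k)] := h k.*2.+4; rewrite size_mkseq code_approx_mkseq // nth_mkseq //.
  exact.
split=> // k; rewrite size_mkseq => kn; rewrite code_approx_mkseq // nth_mkseq ?(leq_trans _ kn) //.
Qed.

(** No common point of the sets is assumed. The tree condition alone makes the ratios converge to
    some [r], the compatible values of longer and longer prefixes approach [r], and the closed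
    bounds pass to the limit. *)
Lemma code_sound A x b y : body (code_tree A x) y -> (forall n, code_limit b (mkseq y n) !=set0) ->
  exists r, [/\ dens (A x) (code_point y) r, (forall n, code_limit b (mkseq y n) r) &
     b -> 0 < r < 1].
Proof.
move=> /code_treeP h ne; have [r [dr rk]] := dyadic_cvg h.
have lim_r : 0 <= r <= 1 /\ forall k, `|r - (code_dyadic y k).2%:R * 2 ^- k| <= 2 ^- k /\
      (b -> 2 ^- (y 1%N) <= r <= 1 - 2 ^- (y 1%N)).
  split; first exact: dens01 dr.
  move=> k; split=> // bT.
  have near_r l : exists s, 2 ^- (y 1%N) <= s <= 1 - 2 ^- (y 1%N) /\ `|s - r| <= 2 * 2 ^- l.
    have [s [_ /(_ l)]] := ne l.*2.+4; rewrite size_mkseq code_approx_mkseq // nth_mkseq //.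
    move=> /(_ (leqnn _))[s1 /(_ bT) s2]; exists s; split=> //.
    by move: s1 (rk l); rewrite !ler_norml; lra.
  apply/andP; split; apply: (@ler_addexp2N _ _ 2) => // l; have [s [s1]] := near_r l;
    rewrite ler_norml; lra.
exists r; split=> //; first exact/code_limitP.
move=> bT; have [_ /(_ 0%N)[_ /(_ bT)]] := lim_r; have := exp2N_gt0 (y 1%N); lra.
Qed.

Lemma code_complete A x (b : bool) z r : dens (A x) z r -> (b -> 0 < r < 1) ->
  exists y, [/\ code_point y = z, body (code_tree A x) y & forall n, code_limit b (mkseq y n) r].
Proof.
move=> dr br; have r01 := dens01 dr; have /andP[r0 _] := r01.
have /choice[N /choice[c hc]] := cvg_dyadic r0 dr.
have [j hj] : exists j, b -> 2 ^- j <= r <= 1 - 2 ^- j.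
  case: b br => [/(_ isT) r01'|_]; last by exists 0%N.
  have [|j hj] := @exists_expn_lt r; first by lra.
  have [|l hl] := @exists_expn_lt (1 - r); first by lra.
  have le m n : 2 ^- (m + n) <= 2 ^- m :> reals.
    by rewrite lef_pV2 ?posrE ?exprn_gt0 // ler_weXn2l ?leq_addr // ler1n.
  exists (j + l)%N => _; have := le j l; have := le l j; rewrite addnC; lra.
pose y n := if odd n then (if n is n'.+3 then pickle (N n'./2, c n'./2) else j) else (z n./2 : nat).
have yz : code_point y = z by apply/funext => i; rewrite /code_point /y odd_double doubleK eqb0 negbK.
have yd k : code_dyadic y k = (N k, c k).
  by rewrite /code_dyadic /y /= odd_double /= doubleK pickleK.
have ty : body (code_tree A x) y.
  by apply/code_treeP => k n; rewrite yd yz; apply: hc.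
exists y; split=> //; apply/code_limitP; split=> // k; rewrite yd; split=> //.
apply: (@ler_addexp2N _ _ 1) => // l.
have [M hM] := (cvg_exp2N _ _).1 dr l.
have := hc k (maxn M (N k)) (leq_maxr _ _); have := hM (maxn M (N k)) (leq_maxl _ _).
by rewrite !ler_norml -/(density_ratio _ _ _) mul1r; lra.
Qed.

Lemma code_tree_rcons A x u i : code_tree A x (rcons u i) -> code_tree A x u.
Proof.
move=> h k n [nu [ku kn]].
have ap : code_approx (rcons u i) k = code_approx u k by rewrite /code_approx nth_rcons ku.
have dg : code_digits (rcons u i) n = code_digits u n.
  apply/eq_in_map => l; rewrite mem_iota => /andP[_ ln]; rewrite nth_rcons ifT //.
  by apply: leq_trans nu; rewrite ltn_double.
by have := h k n; rewrite ap dg size_rcons; apply; rewrite !leqW.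
Qed.

Lemma code_limit_rcons b u i : code_limit b (rcons u i) `<=` code_limit b u.
Proof.
move=> r [r01 h]; split=> // k ku; have := h k; rewrite size_rcons leqW // => /(_ isT).
by rewrite /code_approx !nth_rcons ku (leq_trans _ ku).
Qed.

Lemma code_limit01 b u : code_limit b u `<=` `[0, 1].
Proof. by move=> r [r01 _]; rewrite /= in_itv. Qed.

Lemma closed_code_limit b u : closed (code_limit b u).
Proof.
have -> : code_limit b u = `[0, 1] `&` \bigcap_k [set r | (k.*2.+3 < size u)%N ->
    `[(code_approx u k).2%:R * 2 ^- k - 2 ^- k, (code_approx u k).2%:R * 2 ^- k + 2 ^- k]%classic r /\
    (b -> `[2 ^- (nth 0%N u 1), 1 - 2 ^- (nth 0%N u 1)]%classic r)].
  apply/seteqP; split=> [r [r01 h]|r [r01 h]].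
    split; first by rewrite /= in_itv.
    move=> k _ ku; have [h1 h2] := h k ku; rewrite /= !in_itv /=; split=> //.
    by move: h1; rewrite ler_norml; lra.
  rewrite /= in_itv /= in r01; split=> // k ku; have [] := h k Logic.I ku.
  by rewrite /= !in_itv /= => h1 h2; split=> //; move: h1; rewrite ler_norml; lra.
apply: closedI; first exact: interval_closed.
apply: closed_bigI => k _; case: (ltnP k.*2.+3 (size u)) => ku; last first.
  by rewrite (_ : mkset _ = setT); [exact: closedT|apply/seteqP; split].
pose c : reals := (code_approx u k).2%:R * 2 ^- k.
pose I : set reals := `[c - 2 ^- k, c + 2 ^- k]%classic.
case: b => /=.
  rewrite (_ : mkset _ = I `&` (`[2 ^- (nth 0%N u 1), 1 - 2 ^- (nth 0%N u 1)]%classic : set reals)).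
    by apply: closedI; exact: interval_closed.
  by apply/seteqP; split=> r /= => [/(_ isT)[h1 /(_ isT)]|[]].
rewrite (_ : mkset _ = I); first exact: interval_closed.
by apply/seteqP; split=> r /= => [/(_ isT)[]|].
Qed.

Lemma code_limit_dist b y n k r s : (k.*2.+3 < n)%N -> code_limit b (mkseq y n) r ->
  code_limit b (mkseq y n) s -> `|r - s| <= 2 * 2 ^- k.
Proof.
move=> kn [_ /(_ k)] + [_ /(_ k)]; rewrite size_mkseq => /(_ kn)[+ _] /(_ kn)[+ _].
by rewrite !ler_norml; lra.
Qed.

(** * The classes of the theorem *)

Lemma card_not_le_II (V : pointedType) (S : set V) n :
  ~ (S #<= `I_n)%card <-> (`I_n.+1 #<= S)%card.
Proof.
split=> [/card_not_leP[Y [SY dY]]|nS Sn]; last first.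
  by have := card_le_trans nS Sn; rewrite card_le_II ltnn.
apply/pcard_leP; rewrite injfunPex; exists Y => // i j /[!inE]/= iN jN e.
case: (ltngtP i j) => // ij; exfalso; first exact: dY ij jN e.
exact: dY ij iN (esym e).
Qed.

(** * Counting the points of Borel sections *)

Section BorelSections.
Variable R : baire -> set cantor_space.
Hypothesis bR : borel_baire (fun v => R (fstB v) (zof (sndB v))).

(** A point of the section is coded by its binary digits and the unique witness of an injective
    projection. Since [zof] identifies all nonzero entries, entries are restricted to 0 and 1 so
    that each point has a single code. *)
Lemma sigma11_not_card_section k : sigma11 (fun x => ~ card_sat k (R x)).
Proof.
have [[C cC hC] _] := bR.
pose F (v : baire) := C (pairB (pairB (fstB v) (fstB (sndB v))) (sndB (sndB v))) /\
  forall n, (fstB (sndB v) n <= 1)%N.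
have cF : closed_baire F.
  apply: closed_and.
    apply: (@closed_preimage
      (fun v => pairB (pairB (fstB v) (fstB (sndB v))) (sndB (sndB v)))) => //.
    by cont.
  apply: closed_forall => n.
  have [_] : clopen_baire (fun v => (fstB (sndB v) n <= 1)%N).
    by apply: (@uniform_clopen _ n.*2.*2.+2) => v w vw; rewrite /fstB /sndB vw // doubleS.
  exact.
(* A node [u] is kept when the product of the cylinders of [x] and of [u] meets [F]. This is clopen
   in [x], and closedness of [F] makes the branches exactly the section of [F] at [x]. *)
pose T x (u : seq nat) := exists x' y', [/\ agree (size u) x x', mkseq y' (size u) = u & F (pairB x' y')].
have bT u : borel_baire (T^~ u).
  apply: clopen_borel; apply: (@uniform_clopen _ (size u)) => x y xy [x' [y' [xx' y'u Fx'y']]].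
  by exists x', y'; split=> //; apply: agree_trans (agree_sym xy) xx'.
have TF x y : body (T x) y <-> F (pairB x y).
  split=> [h|Fxy n]; last by exists x, y; rewrite size_mkseq.
  apply: contrapT => /cF[m hm]; have [x' [y' []]] := h m.
  rewrite size_mkseq => xx' /agree_mkseq yy' /(hm (pairB x' y')); apply.
  move=> i im; have i2 : (i./2 < m)%N.
    by apply: leq_ltn_trans im; rewrite leq_half_double -addnn -addSn leq_addl.
  by rewrite /pairB; case: odd; [exact: yy'|exact: xx'].
have RF x y : F (pairB x y) -> R x (zof (fstB y)).
  rewrite /F fst_pairB snd_pairB => -[Cy _].
  have [[_ h] _] := hC (pairB x (fstB y)); rewrite fst_pairB snd_pairB in h.
  by apply: h; exists (sndB y).
pose g y := zof (fstB y).
have -> : (fun x => ~ card_sat k (R x)) = (fun x => ~ card_sat k (g @` body (T x))).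
  apply/funext => x; congr (~ card_sat k _); apply/seteqP; split=> [z Rz|_ [y /TF/RF Ry <-]//].
  pose zn : baire := fun n => z n : nat.
  have zE : zof zn = z by apply/funext => n; rewrite /zof /zn eqb0 negbK.
  have [[h _] _] := hC (pairB x zn); rewrite fst_pairB snd_pairB zE in h.
  have [w Cw] := h Rz; exists (pairB zn w); last by rewrite /g fst_pairB.
  apply/TF; rewrite /F fst_pairB snd_pairB fst_pairB snd_pairB; split=> // n.
  by rewrite /zn; case: (z n).
pose apart (u v : seq nat) := exists i, [/\ (i.*2 < size u)%N, (i.*2 < size v)%N &
  (nth 0%N u i.*2 != 0%N) <> (nth 0%N v i.*2 != 0%N)].
apply: (@sigma11_not_card_sat _ T g apart) => // [x y y' _ _|x y y' /TF Fy /TF Fy' e].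
  split=> [ne|[n [i []]]].
    have /existsNP[i ne'] : ~ forall i, g y i = g y' i by move=> e; apply: ne; apply/funext.
    by exists i.*2.+1, i; rewrite !size_mkseq !nth_mkseq.
  rewrite !size_mkseq => lt _ + e; rewrite !nth_mkseq //; apply.
  exact: (congr1 (fun z : cantor_space => z i) e).
have e1 : fstB y = fstB y'.
  apply/funext => n; have := congr1 (fun z : cantor_space => z n) e; rewrite /g /zof.
  move: Fy Fy' => [_ /(_ n)] + [_ /(_ n)]; rewrite !snd_pairB.
  by case: (fstB y n) (fstB y' n) => [|[|]] // [|[|]].
rewrite -(pair_fst_snd y) -(pair_fst_snd y') e1; congr pairB.
move: Fy Fy' => [+ _] [+ _]; rewrite !fst_pairB !snd_pairB e1.
by have [_ u] := hC (pairB x (fstB y')); apply: u.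
Qed.

End BorelSections.

(** * Complexity of densities and of their range *)

Section Density.
Variable A : baire -> set cantor_space.
Hypothesis oA : forall s q, open_baire (fun x => mu (A x `&` cyl s) < q).

Let borel_mu_dist s n a e :
  borel_baire (fun x => `|mu (A x `&` cyl s) / 2 ^- n - a| <= e).
Proof.
have ble q : borel_baire (fun x => mu (A x `&` cyl s) <= q).
  have : borel_baire (fun x => forall k, mu (A x `&` cyl s) < q + 2 ^- k).
    by apply: borel_forall => k; apply: open_borel.
  apply: eq_borel => x; split=> [h|h k]; last by have := exp2N_gt0 k; lra.
  by apply: (@ler_addexp2N _ _ 1) => // k; rewrite mul1r ltW.
have : borel_baire (fun x => mu (A x `&` cyl s) <= (a + e) * 2 ^- n /\
    ~ mu (A x `&` cyl s) < (a - e) * 2 ^- n).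
  by apply: borel_and => //; apply: borel_not; apply: open_borel.
apply: eq_borel => x; rewrite ler_norml lerBlDr lerBrDr ler_pdivrMr ?ler_pdivlMr ?exp2N_gt0 //.
rewrite (addrC e) (addrC (- e)); split=> [[-> /negP]|/andP[h ->]]; first by rewrite -leNgt andbT.
by split=> //; apply/negP; rewrite -leNgt.
Qed.

Let borel_ratio_dist (h k : baire -> baire) n a e :
  continuous_baire h -> continuous_baire k ->
  borel_baire (fun v => `|density_ratio (A (h v)) (zof (k v)) n - a| <= e).
Proof.
move=> ch ck.
have : borel_baire (fun v => exists s, Defs.prefix (zof (k v)) n = s /\
    `|mu (A (h v) `&` cyl s) / 2 ^- n - a| <= e).
  apply: borel_exists_count => s; apply: borel_and; last exact: (borel_preimage ch (borel_mu_dist s n a e)).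
  apply: (@borel_preimage k (fun y => Defs.prefix (zof y) n = s)) => //; apply: clopen_borel.
  apply: (@uniform_clopen _ n) => x y xy <-; apply/prefix_eq => i lt.
  by rewrite /zof xy.
by apply: eq_borel => v; split=> [[s [<-]]//|e']; exists (Defs.prefix (zof (k v)) n).
Qed.

Lemma borel_has_density (h k : baire -> baire) : continuous_baire h -> continuous_baire k ->
  borel_baire (fun v => exists r, dens (A (h v)) (zof (k v)) r).
Proof.
move=> ch ck.
have : borel_baire (fun v => forall l, exists N c, forall n, (N <= n)%N ->
    `|density_ratio (A (h v)) (zof (k v)) n - c%:R * 2 ^- l| <= 2 ^- l).
  apply: borel_forall => l; apply: borel_exists => N; apply: borel_exists => c.
  apply: borel_forall => n; apply: borel_imp; first exact: borel_cst.
  exact: borel_ratio_dist.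
apply: eq_borel => v; split=> [/choice[N /choice[c hc]]|[r dr]].
  by have [r [dr _]] := dyadic_cvg hc; exists r.
by have /andP[r0 _] := dens01 dr; apply: cvg_dyadic dr.
Qed.

Lemma borel_Blur : borel_baire (fun v => Blur (A (fstB v)) (zof (sndB v))).
Proof. by apply: borel_not; apply: borel_has_density; cont. Qed.

Lemma borel_Sharp : borel_baire (fun v => Sharp (A (fstB v)) (zof (sndB v))).
Proof.
(* The last inequality confines the ratio to the interval from 2^-j to 1 - 2^-j, a closed condition
   that keeps the limit away from 0 and 1. *)
have : borel_baire (fun v => (exists r, dens (A (fstB v)) (zof (sndB v)) r) /\
   exists j N, forall n, (N <= n)%N ->
     `|density_ratio (A (fstB v)) (zof (sndB v)) n - 2^-1| <= 2^-1 - 2 ^- j).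
  apply: borel_and; first by apply: borel_has_density; cont.
  apply: borel_exists => j; apply: borel_exists => N; apply: borel_forall => n.
  by apply: borel_imp; [exact: borel_cst|apply: borel_ratio_dist; cont].
apply: eq_borel => v; split=> [[[r dr] [j [N hN]]]|[r [dr r01]]].
  have rj k : `|r - 2^-1| <= 2^-1 - 2 ^- j + 1 * 2 ^- k.
    have [M hM] := (cvg_exp2N _ _).1 dr k.
    have := hM (maxn M N) (leq_maxl _ _); have := hN (maxn M N) (leq_maxr _ _).
    by rewrite !ler_norml -/(density_ratio _ _ _); lra.
  exists r; split=> //; have := @ler_addexp2N _ _ 1 ler01 rj; have := exp2N_gt0 j.
  by rewrite ler_norml; lra.
split; first by exists r.
have [|j hj] := @exists_expn_lt (Num.min r (1 - r)); first by rewrite lt_min; lra.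
move: hj; rewrite lt_min => /andP[j1 j2].
have [|l hl] := @exists_expn_lt (Num.min (r - 2 ^- j) (1 - r - 2 ^- j)); first by rewrite lt_min; lra.
move: hl; rewrite lt_min => /andP[l1 l2].
exists j; have [N hN] := (cvg_exp2N _ _).1 dr l; exists N => n /hN.
by rewrite !ler_norml -/(density_ratio _ _ _); lra.
Qed.

Let borel_code_tree u : borel_baire (fun x => code_tree A x u).
Proof.
apply: borel_forall => k; apply: borel_forall => n; apply: borel_imp; first exact: borel_cst.
exact: borel_mu_dist.
Qed.

(** The nonemptiness clause is a condition on [u] alone. It discards inconsistent codes, so that
    every branch has a value. *)
Definition density_tree (b : bool) x (u : seq nat) := code_tree A x u /\ code_limit b u !=set0.

Lemma borel_density_tree b u : borel_baire (fun x => density_tree b x u).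
Proof. by apply: borel_and => //; exact: borel_cst. Qed.

Definition apart b (u v : seq nat) : Prop := code_limit b u `&` code_limit b v = set0.

Definition coded_density b (y : baire) : reals :=
  xget 0 [set r | forall n, code_limit b (mkseq y n) r].

Lemma code_limit_unique b y r s : (forall n, code_limit b (mkseq y n) r) ->
  (forall n, code_limit b (mkseq y n) s) -> r = s.
Proof.
move=> hr hs; have d k := code_limit_dist (leqnn k.*2.+4) (hr k.*2.+4) (hs k.*2.+4).
apply/eqP; rewrite eq_le; apply/andP; split; apply: (@ler_addexp2N _ _ 2) => // k;
  by have := d k; rewrite ler_norml; lra.
Qed.

Lemma coded_densityP b x y : body (density_tree b x) y ->
  [/\ dens (A x) (zof (fstB y)) (coded_density b y), b -> 0 < coded_density b y < 1 &
    forall n, code_limit b (mkseq y n) (coded_density b y)].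
Proof.
move=> h; have [|n|r [dr lr br]] := @code_sound A x b y.
- by move=> n; have [] := h n.
- by have [] := h n.
have rE : coded_density b y = r.
  apply: (code_limit_unique _ lr).
  exact: (@xgetPex _ 0 [set r | forall n, code_limit b (mkseq y n) r] (ex_intro _ r lr)).
by rewrite rE.
Qed.

Lemma coded_density_complete (b : bool) x z r : dens (A x) z r -> (b -> 0 < r < 1) ->
  exists y, [/\ body (density_tree b x) y, zof (fstB y) = z & coded_density b y = r].
Proof.
move=> dr br; have [y [yz Ty ly]] := code_complete dr br; exists y.
have By : body (density_tree b x) y by move=> n; split=> //; exists r.
split=> //; have [_ _ ly'] := coded_densityP By.
exact: code_limit_unique ly' ly.
Qed.

Lemma apartP b x x' y y' : body (density_tree b x) y -> body (density_tree b x') y' ->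
  coded_density b y <> coded_density b y' <-> exists n, apart b (mkseq y n) (mkseq y' n).
Proof.
move=> /coded_densityP[_ _ ly] /coded_densityP[_ _ ly']; split=> [|[n an] e]; last first.
  by have : (code_limit b (mkseq y n) `&` code_limit b (mkseq y' n)) (coded_density b y);
    [split; rewrite // e|rewrite an].
apply: contra_notP => /forallNP h.
(* A prefix of length 2k + 4 determines the value up to 2 * 2^-k; a point common to both sets
   therefore leaves a distance of at most 4 * 2^-k. *)
have d k : `|coded_density b y - coded_density b y'| <= 4 * 2 ^- k.
  have /eqP/set0P[s [s1 s2]] := h k.*2.+4.
  have := code_limit_dist (leqnn _) (ly k.*2.+4) s1.
  have := code_limit_dist (leqnn _) (ly' k.*2.+4) s2.
  by rewrite !ler_norml; lra.
apply/eqP; rewrite eq_le; apply/andP; split; apply: (@ler_addexp2N _ _ 4) => // k;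
  by have := d k; rewrite ler_norml; lra.
Qed.

Definition ran_dens (b : bool) x : set reals :=
  [set r | exists z, dens (A x) z r /\ (b -> 0 < r < 1)].

Lemma ran_densE b x : ran_dens b x = coded_density b @` body (density_tree b x).
Proof.
apply/seteqP; split=> [r [z [dr br]]|_ [y /coded_densityP[dy hy _] <-]].
  by have [y [Ty _ <-]] := coded_density_complete dr br; exists y.
by exists (zof (fstB y)).
Qed.

Lemma ran_dens_souslin b x : ran_dens b x = souslin (code_tree A) (code_limit b) x.
Proof.
apply/seteqP; split=> [r [z [dr br]]|r [y hy]].
  by have [y [_ Ty ly]] := code_complete dr br; exists y => n; split.
have Ty : body (density_tree b x) y by move=> n; have [? ?] := hy n; split=> //; exists r.
have [dy by' ly] := coded_densityP Ty.
have <- : coded_density b y = r by apply: code_limit_unique ly _ => n; have [] := hy n.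
by exists (zof (fstB y)).
Qed.

Lemma ranDE x : ranD (A x) = ran_dens false x.
Proof. by apply/seteqP; split=> r [z]; [move=> dz; exists z|case=> dz _; exists z]. Qed.

Lemma ran01E x : ran01 (A x) = ran_dens true x.
Proof.
by apply/seteqP; split=> [r [[z dz] r01]|r [z [dz /(_ isT) r01]]]; [exists z|split=> //; exists z].
Qed.

Lemma sigma11_ran01_not_le n : sigma11 (fun x => ~ (ran01 (A x) #<= `I_n)%card).
Proof.
have := @sigma11_card_not_le _ _ (coded_density true) _ (borel_density_tree true)
  (fun x => @apartP true x x) n.
by apply: eq_sigma11 => x; rewrite ran01E ran_densE.
Qed.

Lemma sigma11_ran01_infinite : sigma11 (fun x => ~ finite_set (ran01 (A x))).
Proof.
have := @sigma11_infinite _ _ (coded_density true) _ (borel_density_tree true)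
  (fun x => @apartP true x x).
by apply: eq_sigma11 => x; rewrite ran01E ran_densE.
Qed.

Lemma sigma11_ran01_uncountable : sigma11 (fun x => ~ countable (ran01 (A x))).
Proof.
have := @sigma11_uncountable _ _ (coded_density true) _ (borel_density_tree true)
  (fun x => @apartP true x x).
by apply: eq_sigma11 => x; rewrite ran01E ran_densE.
Qed.

Let borel_bodyc b (h k : baire -> baire) : continuous_baire h -> continuous_baire k ->
  borel_baire (fun v => body (density_tree b (h v)) (k v)).
Proof. by apply: borel_body; exact: borel_density_tree. Qed.

Let borel_apartc b (h k : baire -> baire) : continuous_baire h -> continuous_baire k ->
  borel_baire (fun v => exists n, apart b (mkseq (h v) n) (mkseq (k v) n)).
Proof. exact: borel_apart. Qed.

Let borel_zof_eq (h k : baire -> baire) : continuous_baire h -> continuous_baire k ->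
  borel_baire (fun v => zof (h v) = zof (k v)).
Proof.
move=> ch ck.
have : borel_baire (fun v => forall i, exists c d, (h v i = c /\ k v i = d) /\ (c != 0%N) = (d != 0%N)).
  apply: borel_forall => i; apply: borel_exists => c; apply: borel_exists => d.
  apply: borel_and; last exact: borel_cst.
  apply: borel_and; first exact: (borel_preimage ch (clopen_borel (eq_coord_clopen i c))).
  exact: (borel_preimage ck (clopen_borel (eq_coord_clopen i d))).
apply: eq_borel => v; split=> [e|e i].
  by apply/funext => i; have [c [d [[hc kd] cd]]] := e i; rewrite /zof hc kd.
by exists (h v i), (k v i); split=> //; exact: (congr1 (fun z : cantor_space => z i) e).
Qed.

Lemma sigma11_not_Rng_inj : sigma11 (fun x => ~ Rng_inj (A x)).
Proof.
have : sigma11 (fun x => exists y, exists y',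
    (body (density_tree true x) y /\ body (density_tree true x) y') /\
    ((~ zof (fstB y) = zof (fstB y')) /\ ~ exists n, apart true (mkseq y n) (mkseq y' n))).
  apply: sigma11_existsB; apply: sigma11_existsB; apply: borel_sigma11; apply: borel_and.
    by apply: borel_and; apply: borel_bodyc; cont.
  apply: borel_and; apply: borel_not; first by apply: borel_zof_eq; cont.
  by apply: borel_apartc; cont.
apply: eq_sigma11 => x; split.
  move=> [y [y' [[Ty Ty'] [ne /(contra_not (apartP Ty Ty').1)/contrapT e]]]] inj; apply: ne.
  have [dy /(_ isT) r01 _] := coded_densityP Ty; have [dy' _ _] := coded_densityP Ty'.
  by apply: inj dy _ r01; rewrite e.
move=> /existsNP[z1 /existsNP[z2 /existsNP[r /not_implyP[d1 /not_implyP[d2 /not_implyP[r01 ne]]]]]].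
have [y [Ty yz ry]] := @coded_density_complete true _ _ _ d1 (fun=> r01).
have [y' [Ty' yz' ry']] := @coded_density_complete true _ _ _ d2 (fun=> r01).
exists y, y'; split=> //; rewrite yz yz'; split=> // /(apartP Ty Ty').
by rewrite ry ry'.
Qed.

Lemma sigma11_not_Rng_MGR : sigma11 (fun x => ~ Rng_MGR (A x)).
Proof.
have := sigma11_nonmeager borel_code_tree (@closed_code_limit false).
by apply: eq_sigma11 => x; rewrite -ran_dens_souslin -ranDE.
Qed.

Lemma sigma11_Rng_lam_gt (a : reals) : sigma11 (fun x => (a%:E < lebesgue_measure (ranD (A x)))%E).
Proof.
have := sigma11_lebesgue_gt borel_code_tree (@closed_code_limit false) (@code_limit01 false)
  (@code_tree_rcons A) (@code_limit_rcons false) a.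
by apply: eq_sigma11 => x; rewrite -ran_dens_souslin -ranDE.
Qed.

Lemma sigma11_Rng_lam_ge (a : reals) : sigma11 (fun x => (a%:E <= lebesgue_measure (ranD (A x)))%E).
Proof.
apply: eq_sigma11 (sigma11_forall (fun k => sigma11_Rng_lam_gt (a - 2 ^- k))) => x.
split=> [h|h k]; last first.
  by apply: lt_le_trans h; rewrite lte_fin gtrBl exp2N_gt0.
case: (lebesgue_measure _) h => [l| |] h; rewrite ?leey //; last by have := h 0%N.
rewrite lee_fin; apply: (@ler_addexp2N _ _ 1) => // k.
by have := h k; rewrite lte_fin mul1r; lra.
Qed.

Let borel_code_limit b m r (k : baire -> baire) : continuous_baire k ->
  borel_baire (fun v => code_limit b (mkseq (k v) m) r).
Proof.
move=> ck; apply: (@borel_preimage k (fun y => code_limit b (mkseq y m) r)) => //.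
by apply: clopen_borel; apply: (@uniform_clopen _ m) => x y /agree_mkseq ->.
Qed.

Let coded_density_eqP b x y r : body (density_tree b x) y ->
  coded_density b y = r <-> forall m, code_limit b (mkseq y m) r.
Proof. by move=> /coded_densityP[_ _ ly]; split=> [<-//|lr]; apply: code_limit_unique ly lr. Qed.

Lemma sigma11_ranD_not_sub (e : nat -> reals) : sigma11 (fun x => ~ (ranD (A x) `<=` range e)).
Proof.
have : sigma11 (fun x => exists y, body (density_tree false x) y /\
    forall n, ~ forall m, code_limit false (mkseq y m) (e n)).
  apply: sigma11_existsB; apply: borel_sigma11; apply: borel_and.
    by apply: borel_bodyc; cont.
  apply: borel_forall => n; apply: borel_not; apply: borel_forall => m.
  by apply: borel_code_limit; cont.
apply: eq_sigma11 => x; rewrite ranDE ran_densE; split.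
  move=> [y [Ty hy]] /(_ _ (imageP _ Ty))[n _ en]; apply: (hy n).
  by apply/(coded_density_eqP _ Ty).
move=> /existsNP[_ /not_implyP[[y Ty <-] ne]]; exists y; split=> // n.
by move=> /(coded_density_eqP _ Ty) e_n; apply: ne; exists n.
Qed.

Lemma sigma11_ranD_sup (e : nat -> reals) : sigma11 (fun x => range e `<=` ranD (A x)).
Proof.
have : sigma11 (fun x => forall n, exists y, body (density_tree false x) y /\
    forall m, code_limit false (mkseq y m) (e n)).
  apply: sigma11_forall => n; apply: sigma11_existsB; apply: borel_sigma11; apply: borel_and.
    by apply: borel_bodyc; cont.
  by apply: borel_forall => m; apply: borel_code_limit; cont.
apply: eq_sigma11 => x; rewrite ranDE ran_densE; split=> [h _ [n _ <-]|h n].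
  by have [y [Ty /(coded_density_eqP _ Ty) <-]] := h n; exists y.
have [|y Ty ye] := h (e n); first by exists n.
by exists y; split=> //; apply/(coded_density_eqP _ Ty).
Qed.

(** A point has at most one density, so the universal quantifier over [r] turns into an existential
    one: either there is no density, or two codes give the same value, one at this point and one for
    the second set. *)
Lemma sigma11_density_in_ran (h1 h2 k : baire -> baire) :
  continuous_baire h1 -> continuous_baire h2 -> continuous_baire k ->
  sigma11 (fun v => forall r, dens (A (h1 v)) (zof (k v)) r -> ranD (A (h2 v)) r).
Proof.
move=> c1 c2 ck.
have : sigma11 (fun v => ~ (exists r, dens (A (h1 v)) (zof (k v)) r) \/
    exists y, exists y', (body (density_tree false (h1 v)) y /\ body (density_tree false (h2 v)) y') /\
    (zof (fstB y) = zof (k v) /\ ~ exists n, apart false (mkseq y n) (mkseq y' n))).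
  apply: sigma11_or; first by apply: borel_sigma11; apply: borel_not; apply: borel_has_density.
  have ff : continuous_baire (fun v => fstB (fstB v)) by cont.
  apply: sigma11_existsB; apply: sigma11_existsB; apply: borel_sigma11; apply: borel_and.
    apply: borel_and; apply: borel_bodyc; try by cont.
      exact: (continuous_comp c1 ff).
    exact: (continuous_comp c2 ff).
  apply: borel_and; first by apply: borel_zof_eq; [cont|exact: (continuous_comp ck ff)].
  by apply: borel_not; apply: borel_apartc; cont.
apply: eq_sigma11 => v; split=> [[nd r dr|[y [y' [[Ty Ty'] [yz na]]]] r dr]|h].
- by case: nd; exists r.
- have /contrapT e := contra_not (apartP Ty Ty').1 na.
  have [dy _ _] := coded_densityP Ty; have [dy' _ _] := coded_densityP Ty'.
  by exists (zof (fstB y')); rewrite yz in dy; rewrite (dens_unique dr dy) e.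
- case: (pselect (exists r, dens (A (h1 v)) (zof (k v)) r)) => [[r dr]|]; last by left.
  have [z' dr'] := h r dr; right.
  have [//|y [Ty yz yr]] := @coded_density_complete false _ _ _ dr.
  have [//|y' [Ty' _ yr']] := @coded_density_complete false _ _ _ dr'.
  by exists y, y'; split=> //; split=> // /(apartP Ty Ty'); rewrite yr yr'.
Qed.

End Density.

Lemma eq_dens (A B : set cantor_space) :
  (forall s, mu (A `&` cyl s) = mu (B `&` cyl s)) -> dens A = dens B.
Proof.
move=> AB; apply/funext => z; apply/funext => r; rewrite !densE.
by congr (_ @ \oo --> r); apply/funext => n; rewrite /density_ratio AB.
Qed.

(** The properties of MALG and K on which the classification rests: codes in Baire space, symmetry
    of nearness, and upper semicontinuity of the measure inside cylinders. *)
Definition density_space (X : space) (S : pt X -> set cantor_space) : Prop :=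
  [/\ exists f, @parametrizes X f,
      forall n (a b : pt X), near n a b -> near n b a &
      forall a s q, mu (S a `&` cyl s) < q ->
        exists n, forall b : pt X, near n a b -> mu (S b `&` cyl s) < q].

Lemma density_MALG : @density_space MALG sval.
Proof.
split; [exact: MALG_parametrized|by move=> n a b; rewrite /= setUC|].
exact: mu_cyl_near_MALG.
Qed.

Lemma density_Kspace : @density_space Kspace sval.
Proof.
split; [exact: Kspace_parametrized| |exact: mu_cyl_near_Kspace].
by move=> n a b h s /h; apply: iff_sym.
Qed.

(** * Transfer from codes to the two spaces *)

Section Classes.
Variables (X : space) (S : pt X -> set cantor_space) (f : baire -> pt X).
Hypothesis pf : parametrizes f.
Hypothesis near_sym : forall n (a b : pt X), near n a b -> near n b a.
Hypothesis near_mu : forall a s q, mu (S a `&` cyl s) < q ->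
  exists n, forall b : pt X, near n a b -> mu (S b `&` cyl s) < q.

Let A x := S (f x).

Let oA s q : open_baire (fun x => mu (A x `&` cyl s) < q).
Proof.
move=> x /near_mu[n hn]; have [m hm] := pf.1 x n.
by exists m => y /hm/hn.
Qed.

(** Semicontinuity yields one inequality between the measures inside each cylinder; symmetry of
    nearness yields the other. *)
Let eqv_dens a b : eqv a b -> dens (S a) = dens (S b).
Proof.
have le a' b' s : eqv a' b' -> mu (S b' `&` cyl s) <= mu (S a' `&` cyl s).
  move=> ab; rewrite leNgt; apply/negP => /near_mu[n /(_ b' (ab n))].
  by rewrite ltxx.
move=> ab; apply: eq_dens => s; apply/eqP; rewrite eq_le !le // => n.
exact/near_sym/ab.
Qed.

Lemma analytic_dens (Phi : (cantor_space -> reals -> Prop) -> Prop) :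
  sigma11 (fun x => Phi (dens (A x))) -> analytic (fun a => Phi (dens (S a))).
Proof. by apply: sigma11_analytic pf _ => x a /eqv_dens ->. Qed.

Lemma coanalytic_dens (Phi : (cantor_space -> reals -> Prop) -> Prop) :
  sigma11 (fun x => ~ Phi (dens (A x))) -> coanalytic (fun a => Phi (dens (S a))).
Proof. exact: (@analytic_dens (fun D => ~ Phi D)). Qed.

Notation densities := (cantor_space -> reals -> Prop).

Let sharpD (D : densities) : set cantor_space := [set z | exists r, D z r /\ 0 < r < 1].
Let blurD (D : densities) : set cantor_space := [set z | ~ exists r, D z r].
Let ranDD (D : densities) : set reals := [set r | exists z, D z r].
Let ran01D (D : densities) : set reals := [set r | ranDD D r /\ 0 < r < 1].

Let sigma11_not_sharp k : sigma11 (fun x => ~ card_sat k (Sharp (A x))).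
Proof. by apply: sigma11_not_card_section; apply: borel_Sharp. Qed.

Let sigma11_not_blur k : sigma11 (fun x => ~ card_sat k (Blur (A x))).
Proof. by apply: sigma11_not_card_section; apply: borel_Blur. Qed.

Let card_sat0 (B : set cantor_space) : card_sat (CEq 0) B <-> B = set0.
Proof. by rewrite /= II0 card_eq0; split=> /eqP. Qed.

Let sigma11_not_qDl : sigma11 (fun x => ~ qDl (A x)).
Proof.
by apply: eq_sigma11 (sigma11_not_sharp (CEq 0)) => x; rewrite /qDl card_sat0.
Qed.

Let sigma11_not_Sld : sigma11 (fun x => ~ Sld (A x)).
Proof.
by apply: eq_sigma11 (sigma11_not_blur (CEq 0)) => x; rewrite /Sld card_sat0.
Qed.

Lemma coanalytic_Shrp k : coanalytic (fun a => Shrp k (S a)).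
Proof. exact: (@coanalytic_dens (fun D => card_sat k (sharpD D)) (sigma11_not_sharp k)). Qed.

Lemma coanalytic_Blr k : coanalytic (fun a => Blr k (S a)).
Proof. exact: (@coanalytic_dens (fun D => card_sat k (blurD D)) (sigma11_not_blur k)). Qed.

Lemma coanalytic_Rng_le n : coanalytic (fun a => Rng (CLe n) (S a)).
Proof.
exact: (@coanalytic_dens (fun D => card_sat (CLe n) (ran01D D)) (sigma11_ran01_not_le oA n)).
Qed.

Lemma coanalytic_Rng_finite : coanalytic (fun a => Rng CLtw (S a)).
Proof.
exact: (@coanalytic_dens (fun D => card_sat CLtw (ran01D D)) (sigma11_ran01_infinite oA)).
Qed.

Lemma coanalytic_Rng_countable : coanalytic (fun a => Rng CLew (S a)).
Proof.
exact: (@coanalytic_dens (fun D => card_sat CLew (ran01D D)) (sigma11_ran01_uncountable oA)).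
Qed.

Lemma coanalytic_Rng_inj : coanalytic (fun a => Rng_inj (S a)).
Proof.
exact: (@coanalytic_dens (fun D => forall z1 z2 r, D z1 r -> D z2 r -> 0 < r < 1 -> z1 = z2)
  (sigma11_not_Rng_inj oA)).
Qed.

Lemma coanalytic_Rng_MGR : coanalytic (fun a => Rng_MGR (S a)).
Proof. exact: (@coanalytic_dens (fun D => meager_set (ranDD D)) (sigma11_not_Rng_MGR oA)). Qed.

Lemma coanalytic_Rng_lam_le a0 : coanalytic (fun a => Rng_lam_le a0 (S a)).
Proof.
apply: (@coanalytic_dens (fun D => (lebesgue_measure (ranDD D) <= a0%:E)%E)).
by apply: eq_sigma11 (sigma11_Rng_lam_gt oA a0) => x; rewrite ltNge; split=> /negP.
Qed.

Lemma coanalytic_Rng_lam_lt a0 : coanalytic (fun a => Rng_lam_lt a0 (S a)).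
Proof.
apply: (@coanalytic_dens (fun D => (lebesgue_measure (ranDD D) < a0%:E)%E)).
by apply: eq_sigma11 (sigma11_Rng_lam_ge oA a0) => x; rewrite leNgt; split=> /negP.
Qed.

Lemma coanalytic_Sld : coanalytic (fun a => Sld (S a)).
Proof. exact: (@coanalytic_dens (fun D => blurD D = set0) sigma11_not_Sld). Qed.

Lemma coanalytic_qDl : coanalytic (fun a => qDl (S a)).
Proof. exact: (@coanalytic_dens (fun D => sharpD D = set0) sigma11_not_qDl). Qed.

Lemma coanalytic_Dl : coanalytic (fun a => Dl (S a)).
Proof.
apply: (@coanalytic_dens (fun D => blurD D = set0 /\ sharpD D = set0)).
by apply: eq_sigma11 (sigma11_or sigma11_not_Sld sigma11_not_qDl) => x; rewrite -not_andP.
Qed.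

Lemma diff_analytic_Rng_eq n : diff_analytic (fun a => Rng (CEq n.+1) (S a)).
Proof.
exists (fun a => ~ Rng (CLe n) (S a)), (fun a => Rng (CLe n.+1) (S a)); split.
  exact: (@analytic_dens (fun D => ~ card_sat (CLe n) (ran01D D)) (sigma11_ran01_not_le oA n)).
split; first exact: coanalytic_Rng_le.
move=> a; rewrite /Rng /= card_not_le_II card_eq_le.
by split=> [/andP[]|[? ?]]; [|apply/andP].
Qed.

Lemma diff_analytic_Rng_omega : diff_analytic (fun a => Rng CEqw (S a)).
Proof.
exists (fun a => ~ Rng CLtw (S a)), (fun a => Rng CLew (S a)); split.
  exact: (@analytic_dens (fun D => ~ card_sat CLtw (ran01D D)) (sigma11_ran01_infinite oA)).
split; first exact: coanalytic_Rng_countable.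
move=> a; rewrite /Rng /= infiniteP card_eq_le.
by split=> [/andP[]|[? ?]]; [|apply/andP].
Qed.

Lemma diff_analytic_Rng_lam_eq a0 : diff_analytic (fun a => Rng_lam_eq a0 (S a)).
Proof.
exists (fun a => (a0%:E <= lebesgue_measure (ranD (S a)))%E), (fun a => Rng_lam_le a0 (S a)); split.
  exact: (@analytic_dens (fun D => (a0%:E <= lebesgue_measure (ranDD D))%E : Prop)
    (sigma11_Rng_lam_ge oA a0)).
split; first exact: coanalytic_Rng_lam_le.
move=> a; rewrite /Rng_lam_eq /Rng_lam_le; split=> [->|[h1 h2]]; first by rewrite lexx.
by apply/eqP; rewrite eq_le h1 h2.
Qed.

Lemma diff_analytic_RngS (B : set reals) : countable B -> diff_analytic (fun a => RngS B (S a)).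
Proof.
move=> cB; have cB' : countable (B `|` [set 0; 1]).
  rewrite -bigcup2E; apply: bigcup_countable => // -[|[|i]] _ //=.
  by apply: finite_set_countable; exact: finite_set2.
have [e eB] : exists e : nat -> reals, B `|` [set 0; 1] = range e.
  move: cB' => /pfcard_geP[B0|/surjfunPex[e ->]]; last by exists e.
  have h0 : (B `|` [set 0; 1]) 0 by right; left.
  by rewrite B0 in h0.
exists (fun a => range e `<=` ranD (S a)), (fun a => ranD (S a) `<=` range e); split.
  exact: (@analytic_dens (fun D => range e `<=` ranDD D) (sigma11_ranD_sup oA e)).
split.
  exact: (@coanalytic_dens (fun D => ranDD D `<=` range e) (sigma11_ranD_not_sub oA e)).
by move=> a; rewrite /RngS eB; split=> [->//|[h1 h2]]; apply/seteqP.
Qed.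

Lemma diff_analytic_Spng : diff_analytic (fun a => Spng (S a)).
Proof.
exists (fun a => ~ Sld (S a)), (fun a => qDl (S a)); split.
  exact: (@analytic_dens (fun D => ~ blurD D = set0) sigma11_not_Sld).
by split; [exact: coanalytic_qDl|move=> a; rewrite /Spng; split=> -[]].
Qed.

Lemma parametrizes_prodB : @parametrizes (prodB X) (fun v => (f (fstB v), sndB v)).
Proof.
have [cf sf] := pf; split=> [v n|[a y]].
  have [m hm] := cf (fstB v) n; have [k hk] := continuous_fstB v m.
  have [l hl] := continuous_sndB v n; exists (maxn k l) => w vw; split=> /=.
    by apply: hm; apply: hk; apply: agree_le vw; apply: leq_maxl.
  move=> i lt; apply/esym; apply: hl lt; apply: agree_le vw; apply: leq_maxr.
have [x xa] := sf a; exists (pairB x y) => n; split=> /= [|i _].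
  by rewrite fst_pairB.
by rewrite snd_pairB.
Qed.

(* If some [x0] has [ranD (A x0) = B `|` [set 0; 1]], then [a] fails to be in the class when its
   range and that of [x0] are distinguished by the density at some point [zof y]. *)
Lemma pi12_RngS (B : set reals) : pi12 (fun a => RngS B (S a)).
Proof.
(* An arbitrary [B] has no definability of its own. Either the class is empty and its complement is
   everything, or a member of the class supplies a code from which [B] can be read off. *)
case: (pselect (exists a, RngS B (S a))) => [[a0 Ba0]|/forallNP nB]; last first.
  exists (fun=> True); split; first by left=> a; apply.
  by move=> a; split=> [_|_]; [exists (fun=> 0%N)|exact: nB].
have [x0 /eqv_dens e0] := pf.2 a0.
have B0 : ranD (A x0) = B `|` [set 0; 1] by rewrite -Ba0 /ranD /A e0.
pose Psi (D D' : densities) y := forall r, D (zof y) r -> ranDD D' r.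
exists (fun ay => ~ (Psi (dens (S ay.1)) (dens (A x0)) ay.2 /\
  Psi (dens (A x0)) (dens (S ay.1)) ay.2)); split.
  apply: (sigma11_analytic parametrizes_prodB) => [x [a y] xy|].
    have /eqv_dens e : eqv (f (fstB x)) a by move=> n; have [] := xy n.
    have ey : sndB x = y by apply/funext => i; have [_] := xy i.+1; apply.
    by rewrite /= e ey.
  have bnn (P : baire -> Prop) : sigma11 P -> sigma11 (fun v => ~ ~ P v).
    by apply: eq_sigma11 => v; rewrite notK.
  apply/bnn/sigma11_and.
    by apply: (@sigma11_density_in_ran A oA fstB (fun=> x0) sndB); cont.
  by apply: (@sigma11_density_in_ran A oA (fun=> x0) fstB sndB); cont.
move=> a; rewrite /RngS -B0; split.
  move=> ne; apply: contrapT => /forallNP h; apply: ne.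
  apply/seteqP; split=> r [z dz]; have [y yz] := zof_surj z;
    have /contrapT[h1 h2] := h y; rewrite -yz in dz; [exact: h1 dz|exact: h2 dz].
move=> [y nPsi] e; apply: nPsi; split=> r dr; last by rewrite -[ranDD _]/(ranD (S a)) e; exists (zof y).
by rewrite -[ranDD _]/(ranD (A x0)) -e; exists (zof y).
Qed.

End Classes.

Unset Implicit Arguments.

Theorem theorem3p8 (n : nat) :
  (* (a) Π^1_1 *)
  (in_class coanalytic (Shrp (CEq n)) /\ in_class coanalytic (Shrp (CLe n)) /\
   in_class coanalytic (Shrp CLtw) /\ in_class coanalytic (Shrp CLew) /\
   in_class coanalytic (Shrp CEqw) /\
   in_class coanalytic (Blr (CEq n)) /\ in_class coanalytic (Blr (CLe n)) /\
   in_class coanalytic (Blr CLtw) /\ in_class coanalytic (Blr CLew) /\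
   in_class coanalytic (Blr CEqw) /\
   in_class coanalytic (Rng (CLe n)) /\ in_class coanalytic (Rng CLtw) /\
   in_class coanalytic (Rng CLew) /\
   in_class coanalytic Rng_inj /\ in_class coanalytic Rng_MGR /\
   (forall a : Rdefinitions.R, 0 <= a <= 1 ->
      in_class coanalytic (Rng_lam_le a) /\ in_class coanalytic (Rng_lam_lt a)) /\
   in_class coanalytic Sld /\ in_class coanalytic qDl /\ in_class coanalytic Dl) /\
  (* (b) 2-Σ^1_1 *)
  (in_class diff_analytic (Rng (CEq n.+1)) /\ in_class diff_analytic (Rng CEqw) /\
   (forall a : Rdefinitions.R, 0 <= a <= 1 -> in_class diff_analytic (Rng_lam_eq a)) /\
   (forall S : set Rdefinitions.R, S `<=` [set r | 0 < r < 1] -> countable S ->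
      in_class diff_analytic (RngS S)) /\
   in_class diff_analytic Spng) /\
  (* (c) Π^1_2 *)
  (forall S : set Rdefinitions.R, S `<=` [set r | 0 < r < 1] -> in_class pi12 (RngS S)).
Proof.
have [[fM pM] sM nM] := density_MALG; have [[fK pK] sK nK] := density_Kspace.
have shrp k : in_class coanalytic (Shrp k).
  by split; [exact: (coanalytic_Shrp pM sM nM)|exact: (coanalytic_Shrp pK sK nK)].
have blr k : in_class coanalytic (Blr k).
  by split; [exact: (coanalytic_Blr pM sM nM)|exact: (coanalytic_Blr pK sK nK)].
split; [|split].
- do 10 (split; first by []).
  split; first by split; [exact: (coanalytic_Rng_le pM sM nM)|exact: (coanalytic_Rng_le pK sK nK)].
  split; first by split; [exact: (coanalytic_Rng_finite pM sM nM)|exact: (coanalytic_Rng_finite pK sK nK)].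
  split.
    by split; [exact: (coanalytic_Rng_countable pM sM nM)|exact: (coanalytic_Rng_countable pK sK nK)].
  split; first by split; [exact: (coanalytic_Rng_inj pM sM nM)|exact: (coanalytic_Rng_inj pK sK nK)].
  split; first by split; [exact: (coanalytic_Rng_MGR pM sM nM)|exact: (coanalytic_Rng_MGR pK sK nK)].
  split.
    move=> a _; split; split.
    + exact: (coanalytic_Rng_lam_le pM sM nM).
    + exact: (coanalytic_Rng_lam_le pK sK nK).
    + exact: (coanalytic_Rng_lam_lt pM sM nM).
    + exact: (coanalytic_Rng_lam_lt pK sK nK).
  split; first by split; [exact: (coanalytic_Sld pM sM nM)|exact: (coanalytic_Sld pK sK nK)].
  split; first by split; [exact: (coanalytic_qDl pM sM nM)|exact: (coanalytic_qDl pK sK nK)].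
  by split; [exact: (coanalytic_Dl pM sM nM)|exact: (coanalytic_Dl pK sK nK)].
- split.
    by split; [exact: (diff_analytic_Rng_eq pM sM nM)|exact: (diff_analytic_Rng_eq pK sK nK)].
  split.
    by split; [exact: (diff_analytic_Rng_omega pM sM nM)|exact: (diff_analytic_Rng_omega pK sK nK)].
  split.
    move=> a _.
    by split; [exact: (diff_analytic_Rng_lam_eq pM sM nM)|exact: (diff_analytic_Rng_lam_eq pK sK nK)].
  split.
    move=> S _ cS.
    by split; [exact: (diff_analytic_RngS pM sM nM cS)|exact: (diff_analytic_RngS pK sK nK cS)].
  by split; [exact: (diff_analytic_Spng pM sM nM)|exact: (diff_analytic_Spng pK sK nK)].
- move=> S _.
  by split; [exact: (pi12_RngS pM sM nM)|exact: (pi12_RngS pK sK nK)].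
Qed.
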